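(* Suppose that Assumptions 1, 2, 3, 4 and 5 (listed in the context) hold. Then, under the alternative hypothesis $H_1$ of the context (a change of parameter from $\boldsymbol\theta_0$ to $\boldsymbol\theta_*\ne\boldsymbol\theta_0$ after observation $N+K_*$), as $N\to\infty$, $$\sup_{1\le K<\infty}\frac{|\hat Q(N,K)|}{g_1(N,K)}\longrightarrow\infty\quad\text{in probability}.$$ In particular, $\lim_{N\to\infty}P\{\tau_{\hat Q}(N)<\infty\}=1$.
   Context: Parameters. Let $p\ge1$, $\sigma>0$, $\boldsymbol\theta_0=(\boldsymbol\mu^\top,a)^\top=(\mu_1,\dots,\mu_p,a)^\top$ and $\boldsymbol\theta_*=(\boldsymbol\mu_*^\top,a_* )^\top=(\mu_{1*},\dots,\mu_{p*},a_* )^\top$ be elements of the parameter space $\mathcal O\subset\mathbb{R}^p\times(0,\infty)$, and let $\boldsymbol\varphi(t)=(\varphi_1(t),\dots,\varphi_p(t))^\top$ be real-valued functions of $t$. $(B_t)_{t\ge0}$ is a standard Brownian motion on a complete probability space. Assumption 1: the law of $X_0$ does not depend on the drift parameter, $X_0$ is independent of $(B_t)_{t\ge0}$, and $E[|X_0|^d]<\infty$ for some $d\ge2$. Assumption 2: for every $T>0$, $\boldsymbol\varphi$ is Riemann-integrable on $[0,T]$; $\varphi_1\equiv1$; $\boldsymbol\varphi$ is periodic with period $1$ (the paper takes the period to be $1$ without loss of generality); $\int_0^1\boldsymbol\varphi(t)\boldsymbol\varphi^\top(t)\,dt=I_p$. Assumption 3: $0\le\gamma<1/2$, $N=\lfloor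 T^{\delta}\rfloor$ with $2<\delta<1/\gamma$ ($1/\gamma=\infty$ if $\gamma=0$), and $\Delta_N=T/N\to0$ as $T\to\infty$. Limits $N\to\infty$ are taken along $T\to\infty$. Put $t_i=i\Delta_N$ for all $i\ge0$. Assumption 4: $C(\Delta_N)=O(\Delta_N^{1/2})$, where $C(\Delta_N)=\sup_{i\ge1}\frac1{\Delta_N}\int_{t_{i-1}}^{t_i}\|\boldsymbol\varphi(s)-\boldsymbol\varphi(t_{i-1})\|\,ds$ and $\|\cdot\|$ is the maximum norm. Assumption 5: $K_*/N\to t_*\ge0$ and $\kappa_{\hat Q,\boldsymbol\theta_0,\boldsymbol\theta_*}=a\left(\frac{\mu_{1*}}{a_*}-\frac{\mu_1}{a}\right)\ne0$. Alternative hypothesis $H_1$: there is $K_*\ge0$ (possibly depending on $N$) such that the parameter is $\boldsymbol\theta_0$ for observations $i\le N+K_*$ and $\boldsymbol\theta_*\neq\boldsymbol\theta_0$ for $i>N+K_*$; that is, $X$ is the continuous process with $dX_t=(\boldsymbol\mu^\top\boldsymbol\varphi(t)-aX_t)\,dt+\sigma\,dB_t$ for $0\le t\le t_{N+K_*}$ and $dX_t=(\boldsymbol\mu_*^\top\boldsymbol\varphi(t)-a_*X_t)\,dt+\sigma\,dB_t$ for $t>t_{N+K_*}$. Discrete observations. For $i\ge1$, $Y_{N,i}=(X_{t_i}-X_{t_{i-1}})/\Delta_N^{1/2}$, $\mathbf{Z}_{N,i}=\Delta_N^{1/2}(\varphi_1(t_{i-1}),\dots,\varphi_p(t_{i-1}),-X_{t_{i-1}})^\top$.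 Let $\mathbf{Y}_N=(Y_{N,1},\dots,Y_{N,N})^\top$, let $\mathbf{Z}_N$ be the $N\times(p+1)$ matrix with rows $\mathbf{Z}_{N,i}^\top$, and $\hat{\boldsymbol\theta}_N=(\mathbf{Z}_N^\top\mathbf{Z}_N)^{-1}\mathbf{Z}_N^\top\mathbf{Y}_N$. The residuals are $\hat\epsilon_{N,i}=Y_{N,i}-\mathbf{Z}_{N,i}^\top\hat{\boldsymbol\theta}_N$, $i\ge1$. Detector. $\hat Q(N,K)=\sum_{N<i\le N+K}\hat\epsilon_{N,i}$ for $K\ge1$. With the same $\gamma$ as in Assumption 3, $\ell_\gamma(s)=\left(\frac{s}{1+s}\right)^{\gamma}$, $g_1(N,K)=N^{1/2}\left(1+\frac KN\right)\ell_\gamma\left(\frac KN\right)$, $g(N,K)=c\,\sigma\,g_1(N,K)$ with $c>0$ a fixed constant, and $\tau_{\hat Q}(N)=\inf\{K\ge1:|\hat Q(N,K)|\ge g(N,K)\}$ with $\inf\emptyset=\infty$. *)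

(* Defs.v *)
From HB Require Import structures.
From mathcomp Require Import all_boot all_order all_algebra.
From mathcomp Require Import all_classical all_reals all_analysis.

Set Implicit Arguments.
Unset Strict Implicit.
Unset Printing Implicit Defensive.

Import Order.TTheory GRing.Theory Num.Theory.
Import numFieldNormedType.Exports.

Local Open Scope classical_set_scope.
Local Open Scope ring_scope.

(* The Riemann integral of f over [a, b] (a <= b) exists and equals v: limit of
   the sums over tagged partitions a = x_0 <= ... <= x_n = b as the mesh goes
   to 0. *)
Definition is_riemann_integral (R : realType) (f : R -> R) (a b v : R) : Prop :=
  a <= b /\
  forall e : R, 0 < e -> exists2 h : R, 0 < h &
    forall (n : nat) (x xi : nat -> R),
      x 0%N = a -> x n = b ->
      (forall i, (i < n)%N -> x i <= xi i <= x i.+1 /\ x i.+1 - x i < h) ->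
      `|\sum_(i < n) f (xi i) * (x i.+1 - x i) - v| < e.

Definition riemann_integrable (R : realType) (f : R -> R) (a b : R) : Prop :=
  exists v, is_riemann_integral f a b v.

Definition riemann_integral (R : realType) (f : R -> R) (a b : R) : R :=
  get [set v | is_riemann_integral f a b v].

(* Real-indexed processes are only constrained on the times t >= 0. *)
Definition independent_increments d (Omega : measurableType d) (R : realType)
    (P : probability Omega R) (B : R -> {RV P >-> R}) : Prop :=
  forall (n : nat) (t : nat -> R) (A : nat -> set R),
    0 <= t 0%N -> (forall i, (i < n)%N -> t i <= t i.+1) ->
    (forall i, measurable (A i)) ->
    P [set w | forall i, (i < n)%N -> A i (B (t i.+1) w - B (t i) w)] =
    (\prod_(i < n) P [set w | A i (B (t i.+1) w - B (t i) w)%R])%E.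

Definition brownian_motion d (Omega : measurableType d) (R : realType)
    (P : probability Omega R) (B : R -> {RV P >-> R}) : Prop :=
  [/\ {ae P, forall w, B 0 w = 0},
      independent_increments B,
      forall s t : R, 0 <= s -> s < t -> forall A : set R, measurable A ->
        P [set w | A (B t w - B s w)] = normal_prob 0 (Num.sqrt (t - s)) A
    & {ae P, forall w, {within `[0, +oo[, continuous (fun t : R => B t w)}}].

(* Independence of the sigma-algebras generated by X0 and by (B_t)_{t >= 0}. *)
Definition independent_of_process d (Omega : measurableType d) (R : realType)
    (P : probability Omega R) (X0 : {RV P >-> R}) (B : R -> {RV P >-> R})
    : Prop :=
  forall E F : set Omega,
    preimage_set_system setT X0 measurable E ->
    <<s \bigcup_(t in [set t : R | 0 <= t])
          preimage_set_system setT (B t) measurable >> F ->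
    P (E `&` F) = (P E * P F)%E.

(* A parameter is theta = (mu^T, a)^T. *)
Definition mu_of (R : realType) (p : nat) (theta : 'cV[R]_(p + 1)) : 'cV[R]_p :=
  usubmx theta.

Definition a_of (R : realType) (p : nat) (theta : 'cV[R]_(p + 1)) : R :=
  dsubmx theta 0 0.

Definition drift (R : realType) (p : nat) (phi : R -> 'cV[R]_p)
    (theta : 'cV[R]_(p + 1)) (t x : R) : R :=
  ((mu_of theta)^T *m phi t) 0 0 - a_of theta * x.

(* dx_t = drift(t, x_t) dt + sigma db_t on the time interval I, for given paths
   x and b.  The noise is additive, so the equation is pathwise. *)
Definition solves_sde (R : realType) (p : nat) (phi : R -> 'cV[R]_p)
    (sigma : R) (theta : 'cV[R]_(p + 1)) (I : set R) (x b : R -> R) : Prop :=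
  forall s t : R, I s -> I t -> s <= t ->
    is_riemann_integral (fun u => drift phi theta u (x u)) s t
      (x t - x s - sigma * (b t - b s)).

Definition sample_size (R : realType) (delta T : R) : nat :=
  Num.truncn (T `^ delta).

Definition mesh (R : realType) (delta T : R) : R :=
  T / (sample_size delta T)%:R.

Definition grid (R : realType) (D : R) (i : nat) : R := i%:R * D.

(* For phi bounded, as it is when Riemann-integrable and periodic, the set is
   bounded, so that its supremum is a genuine one; `|_| on 'cV[R]_p is the
   maximum norm. *)
Definition modulus (R : realType) (p : nat) (phi : R -> 'cV[R]_p) (D : R) : R :=
  sup [set D^-1 * riemann_integral (fun s => `|phi s - phi (grid D i.-1)|)
                    (grid D i.-1) (grid D i) | i in [set i : nat | (1 <= i)%N]].

(* x is a path of the observed process, D the mesh; the index i is >= 1. *)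
Definition Yobs (R : realType) (D : R) (x : R -> R) (i : nat) : R :=
  (x (grid D i) - x (grid D i.-1)) / Num.sqrt D.

Definition Zobs (R : realType) (p : nat) (phi : R -> 'cV[R]_p) (D : R)
    (x : R -> R) (i : nat) : 'cV[R]_(p + 1) :=
  Num.sqrt D *: col_mx (phi (grid D i.-1)) (- x (grid D i.-1))%:M.

Definition Yvec (R : realType) (D : R) (x : R -> R) (N : nat) : 'cV[R]_N :=
  \col_(i < N) Yobs D x i.+1.

Definition Zmat (R : realType) (p : nat) (phi : R -> 'cV[R]_p) (D : R)
    (x : R -> R) (N : nat) : 'M[R]_(N, p + 1) :=
  \matrix_(i < N) (Zobs phi D x i.+1)^T.

(* invmx M is M itself when M is singular. *)
Definition theta_hat (R : realType) (p : nat) (phi : R -> 'cV[R]_p) (D : R)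
    (x : R -> R) (N : nat) : 'cV[R]_(p + 1) :=
  let Z := Zmat phi D x N in
  invmx (Z^T *m Z) *m Z^T *m Yvec D x N.

Definition residual (R : realType) (p : nat) (phi : R -> 'cV[R]_p) (D : R)
    (x : R -> R) (N i : nat) : R :=
  Yobs D x i - ((Zobs phi D x i)^T *m theta_hat phi D x N) 0 0.

Definition Qhat (R : realType) (p : nat) (phi : R -> 'cV[R]_p) (D : R)
    (x : R -> R) (N K : nat) : R :=
  \sum_(N.+1 <= i < (N + K).+1) residual phi D x N i.

Definition ell (R : realType) (gamma s : R) : R := (s / (1 + s)) `^ gamma.

Definition g1 (R : realType) (gamma : R) (N K : nat) : R :=
  Num.sqrt N%:R * (1 + K%:R / N%:R) * ell gamma (K%:R / N%:R).

Definition gbound (R : realType) (c sigma gamma : R) (N K : nat) : R :=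
  c * sigma * g1 gamma N K.

(* +oo when the detector never exceeds the boundary. *)
Definition tauQ (R : realType) (p : nat) (phi : R -> 'cV[R]_p) (D : R)
    (x : R -> R) (c sigma gamma : R) (N : nat) : \bar R :=
  ereal_inf [set (K%:R)%:E | K in
    [set K : nat | (1 <= K)%N /\
                   gbound c sigma gamma N K <= `|Qhat phi D x N K|]].

Definition supQ (R : realType) (p : nat) (phi : R -> 'cV[R]_p) (D : R)
    (x : R -> R) (gamma : R) (N : nat) : \bar R :=
  ereal_sup [set (`|Qhat phi D x N K| / g1 gamma N K)%:E | K in
    [set K : nat | (1 <= K)%N]].

Definition kappaQ (R : realType) (p : nat) (hp : (0 < p)%N)
    (theta0 thetas : 'cV[R]_(p + 1)) : R :=
  a_of theta0 * (mu_of thetas (Ordinal hp) 0 / a_of thetas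
                 - mu_of theta0 (Ordinal hp) 0 / a_of theta0).

(* Main.v *)
Require Import Defs.
From HB Require Import structures.
From mathcomp Require Import all_boot all_order all_algebra.
From mathcomp Require Import all_classical all_reals all_analysis.
From mathcomp Require Import measurable_realfun.
From mathcomp Require Import ring lra.

(** Write D for the mesh, T = N D, t_i = i D and xi_i for the increment of B over
    [t_i, t_(i+1)]. The sum of the residuals telescopes: sqrt D * Qhat(N, K) is
    X(t_(N+K)) - X(t_N) minus the drift fitted by theta_hat, integrated over the
    monitoring window (sqrt_mesh_Qhat). Take a window K = N (K_* + 1) so long that
    the observations before the change do not count in it, and divide by K D. The
    path increment disappears. The averages over the window of phi_1 = 1 and of
    the other regressors are 1 and nearly 0, by periodicity and orthonormality. After the change the
    drift averages out, so that X has mean mu_1* / a_* (post_change_mean). With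
    theta_hat near theta_0 the quotient is thus near
    a mu_1* / a_* - mu_1 = kappa, and |Qhat| >= |kappa| K sqrt D / 2
    (detection_threshold). As K >= N, the boundary satisfies
    g_1 <= (N + K) / sqrt N <= 2 K / sqrt N, so the ratio is at least
    |kappa| sqrt T / 4 (statistic_ratio), which tends to infinity. The detector
    stops as soon as the ratio exceeds c sigma, whence the second claim.

    Consistency of theta_hat rests on a splitting of X along the grid. The path
    follows an Euler scheme with coefficients a_i and drift integrals f_i, up to
    errors e_i with E e_i^2 = O(D^3) (path_step, error_second_moment). By
    linearity X(t_i) = h_i + U_i + J_i + W_i: a bounded deterministic signal, a
    noise driven by the increments alone, the contracted initial value, and a
    remainder driven by the errors, with E W_i^2 = O(D). The averages of
    phi_j phi_k tend to the identity, by the orthonormality of the regressors; U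
    is nearly uncorrelated with them and with h, and its energy stays away from 0
    (energy_lower_bound). So the Gram matrix is non-degenerate
    (gram_lower_bound), and the normal equations bound theta_hat - theta_0 by the
    correlations of the regressors with the increments and the errors
    (least_squares_error).

    All the random quantities that have to be small are added up in path_error.
    Given that they are, detection is a deterministic statement. The mean of
    path_error is at most a constant times 1/T + sqrt (T D), plus a discretisation
    error of the drift (path_error_mean): this needs second moments only, the
    independence of the increments being used through the orthogonality of
    martingale increments (absmean_le_martingale). As N ~ T^delta with delta > 2,
    T D tends to 0 (horizon_mesh_small), and Markov's inequality gives detection
    with probability tending to 1. Averages of the regressors, which are only
    Riemann integrable, are controlled on grids that need not match the period by
    periodic_tagged_average. *)

Set Implicit Arguments.
Unset Strict Implicit.
Unset Printing Implicit Defensive.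
Import Order.TTheory GRing.Theory Num.Theory.
Import numFieldNormedType.Exports.

Local Open Scope classical_set_scope.
Local Open Scope ring_scope.

(** * Bounds on mean absolute values *)

(** Bounds on a mean absolute value, measurability included so that they can be
    combined and fed to Markov's inequality; second moments are bounded by
    applying it to squares. *)
Definition absmean_le d (T : measurableType d) (R : realType)
    (P : probability T R) (f : T -> R) (c : R) : Prop :=
  measurable_fun setT f /\ (\int[P]_w `|f w|%:E <= c%:E)%E.

Section absmean.
Context d (T : measurableType d) (R : realType) (P : probability T R).
Implicit Types (f g : T -> R) (c e : R).

Lemma absmean_le_ge0 f c : absmean_le P f c -> 0 <= c.
Proof.
case=> _; rewrite -lee_fin; apply: le_trans.
by apply: integral_ge0 => w _; rewrite lee_fin.
Qed.

Lemma absmean_leW f c e : c <= e -> absmean_le P f c -> absmean_le P f e.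
Proof. by move=> ce [mf fc]; split=> //; rewrite (le_trans fc)// lee_fin. Qed.

Lemma absmean_le_dom f g c : measurable_fun setT g ->
  (forall w, `|g w| <= `|f w|) -> absmean_le P f c -> absmean_le P g c.
Proof.
move=> mg gf [mf fc]; split=> //; apply: le_trans fc.
apply: ge0_le_integral => //.
- by apply/measurable_EFinP; exact: measurableT_comp.
- by apply/measurable_EFinP; exact: measurableT_comp.
- by move=> w _; rewrite lee_fin.
Qed.

Lemma absmean_le_ae f g c : measurable_fun setT g ->
  {ae P, forall w, `|g w| <= `|f w|} -> absmean_le P f c -> absmean_le P g c.
Proof.
move=> mg gf [mf fc]; split=> //; apply: le_trans fc.
apply: ae_ge0_le_integral => //.
- by apply/measurable_EFinP; exact: measurableT_comp.
- by apply/measurable_EFinP; exact: measurableT_comp.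
- by apply: filterS gf => w gfw _; rewrite lee_fin.
Qed.

Lemma absmean_le_cst (k : R) : absmean_le P (cst k) `|k|.
Proof.
split; first exact: measurable_cst.
have -> : (\int[P]_w `|cst k w|%:E = `|k|%:E * P setT)%E by rewrite -integral_cst.
by rewrite probability_setT mule1.
Qed.

Lemma absmean_leD f g c e : absmean_le P f c -> absmean_le P g e ->
  absmean_le P (fun w => f w + g w) (c + e).
Proof.
move=> [mf fc] [mg ge]; split; first exact: measurable_funD.
apply: (@le_trans _ _ (\int[P]_w (`|f w|%:E + `|g w|%:E)%E)%E).
  apply: ge0_le_integral => //.
  - by apply/measurable_EFinP/measurableT_comp => //; exact: measurable_funD.
  - by apply: emeasurable_funD; apply/measurable_EFinP; exact: measurableT_comp.
  - by move=> w _; rewrite -EFinD lee_fin ler_normD.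
rewrite ge0_integralD//.
- by rewrite EFinD leeD.
- by apply/measurable_EFinP; exact: measurableT_comp.
- by apply/measurable_EFinP; exact: measurableT_comp.
Qed.

Lemma absmean_leZ (k : R) f c : absmean_le P f c ->
  absmean_le P (fun w => k * f w) (`|k| * c).
Proof.
move=> [mf fc]; split; first exact: measurable_funM.
under eq_integral do rewrite normrM EFinM.
rewrite ge0_integralZl//; last first.
  by apply/measurable_EFinP; exact: measurableT_comp.
by rewrite EFinM; apply: lee_wpmul2l => //; rewrite lee_fin.
Qed.

Lemma absmean_le_sum (I : Type) (s : seq I) (f : I -> T -> R) (c : I -> R) :
  (forall i, absmean_le P (f i) (c i)) ->
  absmean_le P (fun w => \sum_(i <- s) f i w) (\sum_(i <- s) c i).
Proof.
move=> fc; elim: s => [|i s IH].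
  rewrite big_nil (_ : (fun w => _) = cst 0); last first.
    by apply/funext => w; rewrite big_nil.
  by have := absmean_le_cst 0; rewrite normr0.
rewrite big_cons (_ : (fun w => _) = (fun w => f i w + \sum_(j <- s) f j w)).
  exact: absmean_leD.
by apply/funext => w; rewrite big_cons.
Qed.

Lemma markov_absmean f c (eps : R) : 0 < eps -> absmean_le P f c ->
  (P [set w | (eps <= `|f w|)%R] <= (c / eps)%:E)%E.
Proof.
move=> e0 [mf fc].
have := @le_integral_comp_abse _ _ _ P setT measurableT (EFin \o f) eps id.
rewrite setTI/= => /(_ (@measurable_id _ _ _)) /(_ (fun _ h => h)).
move=> /(_ (fun _ _ _ _ h => h)).
have mf' : measurable_fun setT (EFin \o f) by exact/measurable_EFinP.
move=> /(_ mf' e0) /le_trans /(_ fc).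
by rewrite muleC -lee_pdivlMr// EFinM.
Qed.

End absmean.

(** * Moments of the centred normal law *)

Section normal_moments.
Context (R : realType).
Local Notation mu := (@lebesgue_measure R).
Implicit Types (s : R).

(** The law of variance s^2 is the measure of density normal_pdf, through the
    uniqueness of the Radon-Nikodym derivative. *)
Lemma ge0_integral_normal_prob s (f : R -> \bar R) :
  measurable_fun setT f -> (forall x, (0 <= f x)%E) ->
  (\int[normal_prob 0 s]_x f x = \int[mu]_x (f x * (normal_pdf 0 s x)%:E))%E.
Proof.
move=> mf f0; set nu := (normal_prob 0 s : probability _ R).
have num : nu `<< mu by exact: normal_prob_dominates.
have mpdf : measurable_fun setT (fun x : R => (normal_pdf 0 s x)%:E).
  by apply/measurable_EFinP; exact: measurable_normal_pdf.
rewrite -(Radon_Nikodym_SigmaFinite.change_of_variables num)//.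
have mRN : measurable_fun setT (Radon_Nikodym_SigmaFinite.f nu mu).
  exact: measurable_int (Radon_Nikodym_SigmaFinite.f_integrable num).
apply: ge0_ae_eq_integral => //.
- exact: emeasurable_funM.
- exact: emeasurable_funM.
- by move=> x _; rewrite mule_ge0// Radon_Nikodym_SigmaFinite.f_ge0.
- by move=> x _; rewrite mule_ge0// lee_fin normal_pdf_ge0.
- apply: ae_eqe_mul2l; apply: integral_ae_eq => //.
    exact: Radon_Nikodym_SigmaFinite.f_integrable.
  by move=> E _ mE; rewrite -(Radon_Nikodym_SigmaFinite.f_integral num).
Qed.

Let normal_peakE s : normal_peak s = (Num.sqrt (2 * (s ^+ 2 * pi)))^-1.
Proof. by rewrite /normal_peak mulr_natl. Qed.

Let sqr_pi_gt0 s : 0 < s -> 0 < 2 * (s ^+ 2 * pi).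
Proof. by move=> s0; rewrite !mulr_gt0// ?exprn_gt0// ?pi_gt0. Qed.

(** Since y e^(-y) <= 1, the function x^2 times the density of variance s^2 lies
    below 8 s^2 times the density of variance 2 s^2, whose integral is 1. This
    crude constant avoids an integration by parts. *)
Lemma normal_second_moment_le s : 0 < s ->
  (\int[normal_prob 0 s]_x (x ^+ 2)%:E <= (8 * s ^+ 2)%:E)%E.
Proof.
move=> s0; rewrite ge0_integral_normal_prob//; first last.
  by move=> x; rewrite lee_fin sqr_ge0.
  by apply/measurable_EFinP; exact: measurable_funX.
pose s' := Num.sqrt 2 * s.
have s'0 : 0 < s' by rewrite mulr_gt0// sqrtr_gt0.
have s'2 : s' ^+ 2 = 2 * s ^+ 2 by rewrite exprMn sqr_sqrtr.
have peak : normal_peak s <= 2 * normal_peak s'.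
  rewrite !normal_peakE -[leLHS]mul1r ler_pdivrMr ?sqrtr_gt0 ?sqr_pi_gt0//.
  rewrite mulrAC ler_pdivlMr ?sqrtr_gt0 ?sqr_pi_gt0//.
  have sqrt4 (y : R) : 2 * Num.sqrt y = Num.sqrt (2 ^+ 2 * y).
    by rewrite sqrtrM ?sqr_ge0// sqrtr_sqr ger0_norm.
  rewrite mul1r s'2 sqrt4 ler_wsqrtr//.
  have : 0 <= s ^+ 2 * pi by rewrite mulr_ge0 ?sqr_ge0 ?pi_ge0.
  by nra.
apply: (@le_trans _ _ (\int[mu]_x ((8 * s ^+ 2)%:E * (normal_pdf 0 s' x)%:E))%E).
  apply: ge0_le_integral => //.
  - by move=> x _; rewrite -EFinM lee_fin mulr_ge0 ?sqr_ge0 ?normal_pdf_ge0.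
  - apply: emeasurable_funM; apply/measurable_EFinP; first exact: measurable_funX.
    exact: measurable_normal_pdf.
  - apply: emeasurable_funM => //; apply/measurable_EFinP.
    exact: measurable_normal_pdf.
  move=> x _; rewrite -!EFinM lee_fin !normal_pdfE ?gt_eqF// /normal_fun subr0.
  set y := x ^+ 2 / (4 * s ^+ 2).
  have -> : - x ^+ 2 / (s' ^+ 2 *+ 2) = - y.
    by rewrite s'2 /y mulr2n mulNr; congr (- (_ / _)); ring.
  have -> : - x ^+ 2 / (s ^+ 2 *+ 2) = - y + - y.
    by rewrite /y mulr2n; field; rewrite -mulr2n -mulr_natl mulf_neq0 ?expf_neq0 ?gt_eqF.
  have -> : x ^+ 2 = 4 * s ^+ 2 * y by rewrite /y; field; rewrite gt_eqF.
  have y0 : 0 <= y by rewrite divr_ge0 ?sqr_ge0// mulr_ge0 ?sqr_ge0.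
  rewrite expRD.
  have ye : y * expR (- y) <= 1.
    rewrite expRN ler_pdivrMr ?expR_gt0// mul1r.
    by rewrite (le_trans _ (expR_ge1Dx _))// lerDr.
  have E0 := expR_ge0 (- y).
  have k0 := normal_peak_ge0 s.
  have h1 : (y * expR (- y)) * (normal_peak s * expR (- y)) <= normal_peak s * expR (- y).
    by rewrite ler_piMl// mulr_ge0.
  have h2 : normal_peak s * expR (- y) <= 2 * normal_peak s' * expR (- y).
    by rewrite ler_wpM2r.
  have h3 := le_trans h1 h2.
  have : 4 * s ^+ 2 * ((y * expR (- y)) * (normal_peak s * expR (- y))) <=
         4 * s ^+ 2 * (2 * normal_peak s' * expR (- y)).
    by rewrite ler_wpM2l// mulr_ge0// sqr_ge0.
  by move=> h4; lra.
rewrite ge0_integralZl//.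
- by rewrite integral_normal_pdf mule1.
- by apply/measurable_EFinP; exact: measurable_normal_pdf.
- by move=> x _; rewrite lee_fin normal_pdf_ge0.
- by rewrite lee_fin mulr_ge0// sqr_ge0.
Qed.

(** Reflection invariance, from which the increments have mean 0. *)
Lemma normal_symmetric_mean s (f : R -> \bar R) : s != 0 ->
  measurable_fun setT f -> (forall x, (0 <= f x)%E) ->
  (\int[normal_prob 0 s]_x f x = \int[normal_prob 0 s]_x f (- x)%R)%E.
Proof.
move=> s0 mf f0.
have mN : measurable_fun setT (-%R : R -> R) by exact: measurable_funN.
have mfN : measurable_fun setT (fun x : R => f (- x)%R) by exact: measurableT_comp.
rewrite !ge0_integral_normal_prob//.
pose g x := (f x * (normal_pdf 0 s x)%:E)%E.
have mg : measurable_fun setT g.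
  apply: emeasurable_funM => //; apply/measurable_EFinP.
  exact: measurable_normal_pdf.
transitivity (\int[mu]_x g (- x)%R)%E.
  have -> : (\int[mu]_x g (- x)%R = \int[mu]_(x in
      (-%R : measurableTypeR R -> measurableTypeR R) @^-1` setT) (g \o -%R) x)%E.
    by rewrite preimage_setT.
  rewrite -ge0_integral_pushforward//=.
  - by apply: eq_measure_integral => A mA _; exact/esym/lebesgue_measureN.
  - by move=> x _; rewrite /g mule_ge0// lee_fin normal_pdf_ge0.
apply: eq_integral => x _; rewrite /g; congr (_ * _%:E)%E.
by rewrite !normal_pdfE// /normal_fun !subr0 sqrrN.
Qed.

(** The density is at most 1 / (2 s): a centred normal variable exceeds a quarter
    of its standard deviation with probability at least 3/4. *)
Lemma normal_prob_small s : 0 < s ->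
  (normal_prob 0 s [set x : R | (`|x| < s / 4)%R] <= (4^-1)%:E)%E.
Proof.
move=> s0; have sn0 : s != 0 by rewrite gt_eqF.
have -> : [set x : R | `|x| < s / 4] = `]- (s / 4), (s / 4)[%classic.
  by apply/seteqP; split => x /=; rewrite in_itv/= ltr_norml.
have peak : normal_peak s <= (2 * s)^-1.
  rewrite normal_peakE lef_pV2 ?posrE ?mulr_gt0//; last first.
    by rewrite sqrtr_gt0 sqr_pi_gt0.
  rewrite (_ : 2 * s = Num.sqrt ((2 * s) ^+ 2)); last first.
    by rewrite sqrtr_sqr gtr0_norm ?mulr_gt0.
  rewrite ler_wsqrtr//.
  have := pi_ge2 R; have : 0 <= s ^+ 2 by rewrite sqr_ge0.
  by nra.
rewrite /normal_prob.
apply: (@le_trans _ _ (\int[mu]_(x in `](- (s / 4))%R, (s / 4)%R[) ((2 * s)^-1)%:E)%E).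
  apply: ge0_le_integral => //.
  - by move=> x _; rewrite lee_fin normal_pdf_ge0.
  - by apply/measurable_EFinP; apply: measurable_funTS; exact: measurable_normal_pdf.
  - by move=> x _; rewrite lee_fin (le_trans (normal_pdf_ub _ _ sn0)).
rewrite integral_cst//= lebesgue_measure_itv/= lte_fin ifT; last first.
  by lra.
by rewrite -EFinD -EFinM lee_fin le_eqVlt; apply/orP; left; apply/eqP; field.
Qed.

End normal_moments.

(** * Products with independent factors *)

Section independent_pair.
Context d (T : measurableType d) (R : realType) (P : probability T R).
Variables (F G : T -> R).
Hypotheses (mF : measurable_fun setT F) (mG : measurable_fun setT G).
Hypothesis FG_indep : forall A C : set R, measurable A -> measurable C ->
  P (F @^-1` A `&` G @^-1` C) = (P (F @^-1` A) * P (G @^-1` C))%E.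

Let rvF : {mfun T >-> R} := HB.pack F (isMeasurableFun.Build _ _ _ _ F mF).
Let rvG : {mfun T >-> R} := HB.pack G (isMeasurableFun.Build _ _ _ _ G mG).
Let pair w := (F w, G w).
Let mpair : measurable_fun setT pair.
Proof. exact: measurable_fun_pair. Qed.
Let rvFG : {mfun T >-> (R * R)%type} :=
  HB.pack pair (isMeasurableFun.Build _ _ _ _ pair mpair).
Let lawF := (distribution P rvF : probability R R).
Let lawG := (distribution P rvG : probability R R).
Let lawFG := (distribution P rvFG : probability _ R).

Let joint_law (X : set (R * R)) : measurable X -> (lawF \x lawG)%E X = lawFG X.
Proof.
apply: product_measure_unique => A C mA mC.
by rewrite /lawFG /lawF /lawG /distribution/= /pushforward/= -FG_indep.
Qed.

(** The joint law of an independent pair is the product of its marginals, so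
    Tonelli's theorem applies. *)
Lemma ge0_integral_independent_pair (f : R * R -> \bar R) :
  measurable_fun setT f -> (forall x, (0 <= f x)%E) ->
  (\int[P]_w f (F w, G w) = \int[P]_w \int[P]_v f (F w, G v))%E.
Proof.
move=> mf f0.
transitivity (\int[lawFG]_x f x)%E; first by rewrite ge0_integral_distribution.
transitivity (\int[(lawF \x lawG)%E]_x f x)%E.
  by apply: eq_measure_integral => A mA _; exact/esym/joint_law.
rewrite fubini_tonelli1// /fubini_F ge0_integral_distribution//=.
- apply: eq_integral => w _ /=; rewrite ge0_integral_distribution//.
  exact: measurableT_comp.
- exact: measurable_fun_fubini_tonelli_F.
- by move=> y; apply: integral_ge0.
Qed.

Lemma absmean_le_independentM c e :
  absmean_le P F c -> absmean_le P G e -> absmean_le P (fun w => F w * G w) (c * e).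
Proof.
move=> Fc Ge; have c0 := absmean_le_ge0 Fc; have e0 := absmean_le_ge0 Ge.
have [_ Fc'] := Fc; have [_ Ge'] := Ge.
split; first exact: measurable_funM.
rewrite (ge0_integral_independent_pair (f := fun x => `|x.1 * x.2|%:E))//; last first.
  apply/measurable_EFinP; apply: measurableT_comp => //; apply: measurable_funM.
    exact: measurable_fst.
  exact: measurable_snd.
apply: (@le_trans _ _ (\int[P]_w (`|F w|%:E * e%:E))%E).
  apply: ge0_le_integral => //.
  - by move=> w _; apply: integral_ge0.
  - apply: (@measurable_fun_fubini_tonelli_F _ _ T T R P (fun x => `|F x.1 * G x.2|%:E)) => //.
    apply/measurable_EFinP; apply: measurableT_comp => //; apply: measurable_funM.
      by apply: measurableT_comp => //; exact: measurable_fst.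
    by apply: measurableT_comp => //; exact: measurable_snd.
  - by apply: emeasurable_funM => //; apply/measurable_EFinP; exact: measurableT_comp.
  move=> w _ /=; under eq_integral do rewrite normrM EFinM.
  rewrite ge0_integralZl//.
    by apply: lee_wpmul2l => //; rewrite lee_fin.
  by apply/measurable_EFinP; exact: measurableT_comp.
rewrite ge0_integralZr//.
- by rewrite EFinM; apply: lee_wpmul2r => //; rewrite lee_fin.
- by apply/measurable_EFinP; exact: measurableT_comp.
Qed.

(** The positive and negative parts of F G have the same mean: both are iterated
    integrals, and for each value of F the inner ones agree as G has mean 0. *)
Lemma integral_independentM_eq0 c :
  P.-integrable setT (EFin \o G) -> (\int[P]_w (G w)%:E = 0)%E ->
  absmean_le P (fun w => F w * G w) c -> (\int[P]_w (F w * G w)%:E = 0)%E.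
Proof.
move=> iG G0 FGc.
have half (k : R) : measurable_fun setT (fun x : R * R => (Num.max (k * (x.1 * x.2)) 0)%:E).
  apply/measurable_EFinP; apply: measurable_maxr => //.
  apply: measurable_funM => //; apply: measurable_funM.
    exact: measurable_fst.
  exact: measurable_snd.
have h0 (k : R) (x : R * R) : (0 <= (Num.max (k * (x.1 * x.2)) 0)%:E)%E.
  by rewrite lee_fin le_max lexx orbT.
have iFG : P.-integrable setT (EFin \o (fun w => F w * G w)).
  apply/integrableP; split; first by apply/measurable_EFinP; case: FGc.
  by apply: le_lt_trans (ltry c); case: FGc.
rewrite integralE.
have -> : (\int[P]_w (fun w => (F w * G w)%:E)^\+ w =
           \int[P]_w \int[P]_v (Num.max (1 * (F w * G v)) 0)%:E)%E.
  rewrite -(ge0_integral_independent_pair (half 1)) //.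
  by apply: eq_integral => w _; rewrite funeposE mul1r -EFin_max.
have -> : (\int[P]_w (fun w => (F w * G w)%:E)^\- w =
           \int[P]_w \int[P]_v (Num.max (-1 * (F w * G v)) 0)%:E)%E.
  rewrite -(ge0_integral_independent_pair (half (-1))) //.
  by apply: eq_integral => w _; rewrite funenegE mulN1r -EFin_max.
have sym w : (\int[P]_v (Num.max (1 * (F w * G v)) 0)%:E =
              \int[P]_v (Num.max (-1 * (F w * G v)) 0)%:E)%E.
  have iFwG : P.-integrable setT (fun v => (F w * G v)%:E).
    by under eq_fun do rewrite EFinM; exact: integrableZl.
  have := integralE P setT (fun v => (F w * G v)%:E).
  under eq_integral do rewrite EFinM.
  rewrite integralZl// G0 mule0 => /esym/eqP.
  rewrite sube_eq//.
  - rewrite add0e => /eqP.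
    under eq_integral do rewrite funeposE -EFin_max.
    under [X in _ = X -> _]eq_integral do rewrite funenegE -EFin_max.
    move=> e1; under eq_integral do rewrite mul1r.
    by under [RHS]eq_integral do rewrite mulN1r.
  - exact: integrable_pos_fin_num.
under eq_integral do rewrite sym.
rewrite subee//.
rewrite -(ge0_integral_independent_pair (half (-1)))//.
have := @integrable_neg_fin_num _ _ _ P setT measurableT _ iFG.
by under eq_integral do rewrite funenegE -EFin_max /= -mulN1r.
Qed.

End independent_pair.

Section square_step.
Context d (T : measurableType d) (R : realType) (P : probability T R).

(** The cross term of the square of M + F G vanishes as soon as G is centred
    and independent of M F. *)
Lemma absmean_le_sqr_step (M F G : T -> R) (m c e : R) :
  measurable_fun setT M -> measurable_fun setT F -> measurable_fun setT G ->
  (forall A C : set R, measurable A -> measurable C ->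
    P ((fun w => M w * F w) @^-1` A `&` G @^-1` C) =
    (P ((fun w => M w * F w)%R @^-1` A) * P (G @^-1` C))%E) ->
  (forall A C : set R, measurable A -> measurable C ->
    P (F @^-1` A `&` G @^-1` C) = (P (F @^-1` A) * P (G @^-1` C))%E) ->
  absmean_le P (fun w => M w ^+ 2) m -> absmean_le P (fun w => F w ^+ 2) c ->
  absmean_le P (fun w => G w ^+ 2) e -> (\int[P]_w (G w)%:E = 0)%E ->
  absmean_le P (fun w => (M w + F w * G w) ^+ 2) (m + c * e).
Proof.
move=> mM mF mG MFG FG Mm Fc Ge G0.
have mMF : measurable_fun setT (fun w => M w * F w) by exact: measurable_funM.
have aMF : absmean_le P (fun w => M w * F w) (m + c).
  apply: absmean_le_dom (absmean_leD Mm Fc) => // w.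
  rewrite normrM [leRHS]ger0_norm ?addr_ge0 ?sqr_ge0// -(real_normK (num_real (M w))) -(real_normK (num_real (F w))).
  by have := sqr_ge0 (`|M w| - `|F w|); have := normr_ge0 (M w); have := normr_ge0 (F w); nra.
have aG : absmean_le P G (1 + e).
  have := absmean_le_cst P (1 : R); rewrite normr1 => a1.
  apply: absmean_le_dom (absmean_leD a1 Ge) => // w.
  rewrite [leRHS]ger0_norm ?addr_ge0 ?sqr_ge0// -(real_normK (num_real (G w))).
  by have := sqr_ge0 (`|G w| - 1); have := normr_ge0 (G w); rewrite /=; nra.
have iG : P.-integrable setT (EFin \o G).
  apply/integrableP; split; first exact/measurable_EFinP.
  by apply: le_lt_trans (ltry (1 + e)); case: aG.
have aMFG := absmean_le_independentM mMF mG MFG aMF aG.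
have cross := integral_independentM_eq0 mMF mG MFG iG G0 aMFG.
have indep2 : absmean_le P (fun w => F w ^+ 2 * G w ^+ 2) (c * e).
  apply: absmean_le_independentM => //; try exact: measurable_funX.
  move=> A C mA mC.
  have msq : measurable_fun setT (fun x : R => x ^+ 2) by exact: measurable_funX.
  have mA' := msq measurableT _ mA; have mC' := msq measurableT _ mC.
  rewrite setTI in mA'; rewrite setTI in mC'.
  exact: (FG _ _ mA' mC').
have MFG2 := absmean_leZ 2 aMFG.
have [mB B1] := absmean_leD Mm indep2.
have mall : measurable_fun setT (fun w => (M w + F w * G w) ^+ 2).
  by apply: measurable_funX; apply: measurable_funD => //; exact: measurable_funM.
split=> //.
under eq_integral => w _.
  rewrite ger0_norm ?sqr_ge0//.
  rewrite (_ : _ ^+ 2 = (M w ^+ 2 + F w ^+ 2 * G w ^+ 2) + 2 * (M w * F w * G w)); last by ring.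
  over.
rewrite (@integralD_EFin _ _ _ P setT measurableT
  (fun w => M w ^+ 2 + F w ^+ 2 * G w ^+ 2) (fun w => 2 * (M w * F w * G w))).
- have -> : (\int[P]_w (EFin \o (fun w => 2 * (M w * F w * G w))%R) w =
             \int[P]_w (2%:E * (M w * F w * G w)%R%:E))%E by [].
  rewrite integralZl//.
    rewrite cross mule0 adde0; apply: le_trans B1; apply: ge0_le_integral => //.
    + by move=> w _; rewrite lee_fin -exprMn addr_ge0 ?sqr_ge0.
    + exact/measurable_EFinP.
    + by apply/measurable_EFinP; exact: measurableT_comp.
    + by move=> w _; rewrite lee_fin ler_norm.
  apply/integrableP; split; first by apply/measurable_EFinP; case: aMFG.
  by apply: le_lt_trans (ltry ((m + c) * (1 + e))); case: aMFG.
- apply/integrableP; split; first exact/measurable_EFinP.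
  by apply: le_lt_trans (ltry (m + c * e)).
- apply/integrableP; split; first by apply/measurable_EFinP; case: MFG2.
  by apply: le_lt_trans (ltry (`|2| * ((m + c) * (1 + e)))); case: MFG2.
Qed.

End square_step.

(** * Sums against independent sequences *)

Section independent_sequence.
Context d (T : measurableType d) (R : realType) (P : probability T R).
Variable xi : nat -> T -> R.
Hypothesis mxi : forall i, measurable_fun setT (xi i).
Hypothesis xi_indep : forall n (A : nat -> set R), (forall i, measurable (A i)) ->
  P [set w | forall i, (i < n)%N -> A i (xi i w)] =
  (\prod_(i < n) P [set w | A i (xi i w)])%E.

(** A pi-system generating the sigma-algebra of the first n variables. *)
Definition past_cylinders (n : nat) : set (set T) :=
  [set E | exists2 A : nat -> set R, (forall i, measurable (A i)) &
     E = [set w | forall i, (i < n)%N -> A i (xi i w)]].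

Definition adapted (n : nat) (F : T -> R) : Prop :=
  measurable_fun setT (F : g_sigma_algebraType (past_cylinders n) -> R).

Lemma past_cylinders_measurable n : past_cylinders n `<=` measurable.
Proof.
move=> _ [A mA ->].
have -> : [set w | forall i, (i < n)%N -> A i (xi i w)] =
          \bigcap_(i in [set i | (i < n)%N]) (xi i @^-1` (A i)) by [].
apply: bigcap_measurableType => i _.
by rewrite -[X in measurable X]setTI; exact: mxi.
Qed.

Lemma adapted_measurable n F : adapted n F -> measurable_fun setT F.
Proof.
move=> aF _ A mA; have := aF measurableT A mA.
apply: smallest_sub; last exact: past_cylinders_measurable.
exact: sigma_algebra_measurable.
Qed.

Lemma past_cylindersW n m : (n <= m)%N -> past_cylinders n `<=` past_cylinders m.
Proof.
move=> nm _ [A mA ->].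
exists (fun i => if (i < n)%N then A i else setT).
  by move=> i; case: ifP.
apply/seteqP; split=> w /= h i im; first by case: ifPn => // /h.
by have := h i (leq_trans im nm); rewrite im.
Qed.

Lemma adaptedW n m F : (n <= m)%N -> adapted n F -> adapted m F.
Proof.
move=> nm aF _ A mA; have := aF measurableT A mA.
by apply: sub_sigma_algebra2; exact: past_cylindersW.
Qed.

Lemma adapted_xi n i : (i < n)%N -> adapted n (xi i).
Proof.
move=> lin _ A mA; apply: sub_sigma_algebra; rewrite setTI.
exists (fun j => if j == i then A else setT); first by move=> j; case: ifP.
apply/seteqP; split=> w /= h; last by have := h i lin; rewrite eqxx.
by move=> j _; case: eqP => // ->.
Qed.

Lemma adapted_cst n c : adapted n (cst c).
Proof. exact: measurable_cst. Qed.

Lemma adaptedD n F G : adapted n F -> adapted n G ->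
  adapted n (fun w => F w + G w).
Proof. by move=> aF aG; exact: measurable_funD. Qed.

Lemma adaptedM n F G : adapted n F -> adapted n G ->
  adapted n (fun w => F w * G w).
Proof. by move=> aF aG; exact: measurable_funM. Qed.

(** Two finite measures, P restricted to an event of xi n and P scaled by its
    probability, agree on the cylinders and hence on what they generate. *)
Lemma adapted_indep n F (A C : set R) : adapted n F ->
  measurable A -> measurable C ->
  P (F @^-1` A `&` xi n @^-1` C) = (P (F @^-1` A) * P (xi n @^-1` C))%E.
Proof.
move=> aF mA mC; have mE := aF measurableT A mA; rewrite setTI in mE.
have mxC : measurable (xi n @^-1` C) by rewrite -[X in measurable X]setTI; exact: mxi.
have PC0 : 0 <= fine (P (xi n @^-1` C)) by rewrite fine_ge0.
pose k := NngNum PC0.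
pose m1 := mrestr P mxC; pose m2 := mscale k P.
have m2E X : m2 X = (P (xi n @^-1` C) * P X)%E.
  by rewrite /m2 /mscale/= fineK// fin_num_measure.
suff : m1 (F @^-1` A) = m2 (F @^-1` A).
  by rewrite m2E /m1 /mrestr muleC.
apply: (@g_sigma_algebra_measure_unique _ _ _ (past_cylinders n)
  (@past_cylinders_measurable n) (fun _ => setT)) => //.
- move=> _; exists (fun _ => setT) => //.
  by apply/seteqP; split.
- by rewrite bigcup_const.
- move=> _ _ [A1 mA1 ->] [A2 mA2 ->].
  exists (fun i => A1 i `&` A2 i); first by move=> i; exact: measurableI.
  apply/seteqP; split => w /=; first by move=> [h1 h2] i lin; split; [exact: h1|exact: h2].
  by move=> h; split=> i lin; have [] := h i lin.
- move=> _ [A' mA' ->].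
  apply: (etrans _ (esym (m2E _))); rewrite /m1 /mrestr.
  pose A2 i := if (i < n)%N then A' i else C.
  have mA2 i : measurable (A2 i) by rewrite /A2; case: ifP.
  have := xi_indep n.+1 mA2.
  have A2n : A2 n = C by rewrite /A2 ltnn.
  rewrite big_ord_recr/= A2n.
  have -> : [set w | forall i, (i < n.+1)%N -> A2 i (xi i w)] =
            [set w | forall i, (i < n)%N -> A' i (xi i w)] `&` xi n @^-1` C.
    apply/seteqP; split=> w /=.
      move=> h; split=> [i lin|]; last by have := h n (ltnSn n); rewrite /A2 ltnn.
      by have := h i (ltnW lin); rewrite /A2 lin.
    move=> [h1 h2] i; rewrite ltnS leq_eqVlt => /orP[/eqP ->|lin].
      by rewrite /A2 ltnn.
    by rewrite /A2 lin; exact: h1.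
  move=> h; apply: (etrans h); rewrite muleC; congr (_ * _)%E.
  rewrite (xi_indep n mA').
  by apply: eq_bigr => i _; rewrite /A2 ltn_ord.
- move=> _; apply: le_lt_trans (ltry 1).
  by apply: probability_le1; rewrite setTI.
Qed.

(** Orthogonality of martingale increments: each cross term has mean 0 because
    g (xi i) is centred and independent of the past. *)
Lemma absmean_le_martingale (F : nat -> T -> R) (g : R -> R) (c : nat -> R) e n :
  measurable_fun setT g ->
  (forall i, (i < n)%N -> adapted i (F i)) ->
  (forall i, (i < n)%N -> absmean_le P (fun w => F i w ^+ 2) (c i)) ->
  (forall i, (i < n)%N -> absmean_le P (fun w => g (xi i w) ^+ 2) e) ->
  (forall i, (i < n)%N -> (\int[P]_w (g (xi i w))%:E = 0)%E) ->
  absmean_le P (fun w => (\sum_(i < n) F i w * g (xi i w)) ^+ 2)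
    (\sum_(i < n) c i * e).
Proof.
move=> mg; elim: n => [|n IH] aF Fc ge g0.
  rewrite big_ord0; have := absmean_le_cst P (0 : R); rewrite normr0.
  have -> : (fun w => (\sum_(i < 0) F i w * g (xi i w)) ^+ 2) = cst 0 => //.
  by apply/funext => w; rewrite big_ord0 expr0n.
have mgx i : measurable_fun setT (fun w => g (xi i w)) by exact: measurableT_comp.
have adM : adapted n (fun w => \sum_(i < n) F i w * g (xi i w)).
  apply: measurable_sum => i; apply: adaptedM.
    by apply: adaptedW (aF i _); [exact/ltnW/ltn_ord|exact/leqW/ltn_ord].
  by apply: measurableT_comp => //; exact: adapted_xi.
have indep G : adapted n G -> forall A C : set R, measurable A -> measurable C ->
    P (G @^-1` A `&` (fun w => g (xi n w)) @^-1` C) =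
    (P (G @^-1` A) * P ((fun w => g (xi n w)) @^-1` C))%E.
  move=> aG A C mA mC; have mC' := mg measurableT _ mC; rewrite setTI in mC'.
  exact: (adapted_indep aG mA mC').
rewrite big_ord_recr/=.
have -> : (fun w => (\sum_(i < n.+1) F i w * g (xi i w)) ^+ 2) =
  (fun w => (\sum_(i < n) F i w * g (xi i w) + F n w * g (xi n w)) ^+ 2).
  by apply/funext => w; rewrite big_ord_recr.
apply: absmean_le_sqr_step => //.
- exact: adapted_measurable adM.
- exact: adapted_measurable (aF n _).
- by apply: indep; apply: adaptedM => //; exact: aF.
- by apply: indep; exact: aF.
- have lt i : (i < n)%N -> (i < n.+1)%N by exact: leqW.
  by apply: IH => i lin; [apply: aF|apply: Fc|apply: ge|apply: g0]; exact: lt.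
- exact: Fc.
- exact: ge.
- exact: g0.
Qed.

End independent_sequence.

(** * Brownian increments on a grid *)

Section brownian_increments.
Context d (Omega : measurableType d) (R : realType) (P : probability Omega R).
Variables (B : R -> {RV P >-> R}) (D : R).
Hypotheses (B_BM : brownian_motion B) (D_gt0 : 0 < D).

Definition bincr (i : nat) (w : Omega) : R := B (grid D i.+1) w - B (grid D i) w.

Lemma measurable_bdiff s t : measurable_fun setT (fun w => B t w - B s w).
Proof. by apply: measurable_funB. Qed.

Lemma measurable_bincr i : measurable_fun setT (bincr i).
Proof. exact: measurable_bdiff. Qed.

Lemma grid_le i j : (i <= j)%N -> grid D i <= grid D j.
Proof. by move=> ij; rewrite /grid ler_wpM2r ?ler_nat// ltW. Qed.

Lemma gridS i : grid D i.+1 = grid D i + D.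
Proof. by rewrite /grid -natr1 mulrDl mul1r. Qed.

Lemma gridB i : grid D i.+1 - grid D i = D.
Proof. by rewrite gridS addrAC subrr add0r. Qed.

Lemma grid_ge0 i : 0 <= grid D i.
Proof. by rewrite /grid mulr_ge0// ltW. Qed.

Lemma bincr_indep n (A : nat -> set R) : (forall i, measurable (A i)) ->
  P [set w | forall i, (i < n)%N -> A i (bincr i w)] =
  (\prod_(i < n) P [set w | A i (bincr i w)])%E.
Proof.
move=> mA; have [_ + _ _] := B_BM; move=> /(_ n (grid D) A (grid_ge0 0)).
by apply=> // i _; exact: grid_le.
Qed.

Lemma ge0_integral_bdiff s t (f : R -> \bar R) : 0 <= s -> s < t ->
  measurable_fun setT f -> (forall x, (0 <= f x)%E) ->
  (\int[P]_w f (B t w - B s w)%R =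
   \int[normal_prob 0 (Num.sqrt (t - s))]_x f x)%E.
Proof.
move=> s0 st mf f0; have [_ _ law _] := B_BM.
have mX : measurable_fun setT (fun w => B t w - B s w : measurableTypeR R).
  exact: measurable_bdiff.
pose X : {mfun Omega >-> measurableTypeR R} :=
  HB.pack (fun w => B t w - B s w) (isMeasurableFun.Build _ _ _ _ _ mX).
rewrite -[LHS](@ge0_integral_distribution _ _ _ _ R P X f mf f0).
have h := @eq_measure_integral _ (measurableTypeR R) R setT (normal_prob 0 (Num.sqrt (t - s))) (distribution P X) f.
apply: h => A mA _.
exact: (law s t s0 st A mA).
Qed.

Lemma bdiff_second_moment s t : 0 <= s -> s <= t ->
  absmean_le P (fun w => (B t w - B s w) ^+ 2) (8 * (t - s)).
Proof.
move=> s0; rewrite le_eqVlt => /orP[/eqP <-|st].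
  have := absmean_le_cst P (0 : R); rewrite normr0 subrr mulr0.
  rewrite (_ : (fun w => _) = cst 0)//.
  by apply/funext => w; rewrite subrr expr0n.
split; first by apply: measurable_funX; exact: measurable_bdiff.
have ts : 0 < t - s by rewrite subr_gt0.
under eq_integral do rewrite ger0_norm ?sqr_ge0//.
rewrite (@ge0_integral_bdiff s t (fun x => (x ^+ 2)%:E))//.
- have sts : 0 < Num.sqrt (t - s) by rewrite sqrtr_gt0.
  by have := normal_second_moment_le sts; rewrite sqr_sqrtr// ltW.
- by apply/measurable_EFinP; exact: measurable_funX.
- by move=> x; rewrite lee_fin sqr_ge0.
Qed.

Lemma bincr_second_moment i : absmean_le P (fun w => bincr i w ^+ 2) (8 * D).
Proof.
have := bdiff_second_moment (grid_ge0 i) (grid_le (leqnSn i)).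
by rewrite gridB.
Qed.

Lemma bincr_mean0 i : (\int[P]_w (bincr i w)%:E = 0)%E.
Proof.
have st : grid D i < grid D i.+1 by rewrite gridS ltrDl.
have mp : measurable_fun setT (fun x : R => (Num.max x 0)%:E).
  by apply/measurable_EFinP; exact: measurable_maxr.
have mn : measurable_fun setT (fun x : R => (Num.max (- x) 0)%:E).
  by apply/measurable_EFinP; apply: measurable_maxr => //; exact: measurable_funN.
rewrite integralE.
have -> : (\int[P]_w (fun w => (bincr i w)%:E)^\+ w =
    \int[P]_w (Num.max (B (grid D i.+1) w - B (grid D i) w) 0)%:E)%E.
  by apply: eq_integral => w _; rewrite funeposE -EFin_max.
have -> : (\int[P]_w (fun w => (bincr i w)%:E)^\- w =
    \int[P]_w (Num.max (- (B (grid D i.+1) w - B (grid D i) w)) 0)%:E)%E.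
  by apply: eq_integral => w _; rewrite funenegE -EFin_max.
rewrite (ge0_integral_bdiff (grid_ge0 i) st mp); last first.
  by move=> x; rewrite lee_fin le_max lexx orbT.
rewrite (ge0_integral_bdiff (grid_ge0 i) st mn); last first.
  by move=> x; rewrite lee_fin le_max lexx orbT.
rewrite (@normal_symmetric_mean _ _ (fun x : R => (Num.max x 0)%:E))//; last first.
- by move=> x; rewrite lee_fin le_max lexx orbT.
- by rewrite gt_eqF// sqrtr_gt0 subr_gt0.
apply: subee; rewrite -(ge0_integral_bdiff (grid_ge0 i) st mn); last first.
  by move=> x; rewrite lee_fin le_max lexx orbT.
have [mb bc] := bincr_second_moment i.
rewrite ge0_fin_numE; last by apply: integral_ge0 => w _; rewrite lee_fin le_max lexx orbT.
apply: (@le_lt_trans _ _ (1 + 8 * D)%:E); last exact: ltry.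
have := absmean_le_cst P (1 : R); rewrite normr1 => a1.
have [m1 b1] := absmean_leD a1 (bincr_second_moment i).
apply: le_trans b1; apply: ge0_le_integral => //.
- by move=> w _; rewrite lee_fin le_max lexx orbT.
- apply/measurable_EFinP; apply: measurable_maxr => //; apply: measurable_funN.
  exact: measurable_bdiff.
- by apply/measurable_EFinP; exact: measurableT_comp.
- move=> w _; rewrite lee_fin [leRHS]ger0_norm ?addr_ge0 ?sqr_ge0// -/(bincr i w) /=.
  rewrite ge_max addr_ge0 ?sqr_ge0// andbT.
  by have := sqr_ge0 (bincr i w + 1); nra.
Qed.

Lemma weighted_bincr_second_moment (c : nat -> R) n :
  absmean_le P (fun w => (\sum_(i < n) c i * bincr i w) ^+ 2)
    (\sum_(i < n) c i ^+ 2 * (8 * D)).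
Proof.
have h := @absmean_le_martingale _ _ _ P bincr measurable_bincr bincr_indep
  (fun i => cst (c i)) (fun x => x) (fun i => c i ^+ 2) (8 * D) n.
apply: h => //.
- by move=> i _; exact: adapted_cst.
- by move=> i _; have := absmean_le_cst P (c i ^+ 2); rewrite ger0_norm ?sqr_ge0.
- by move=> i _; exact: bincr_second_moment.
- by move=> i _; exact: bincr_mean0.
Qed.

(** Increments of the typical size sqrt D; their frequency, at least 1/2 in the
    long run, bounds the quadratic variation from below without fourth
    moments. *)
Definition big_step (x : R) : R := if Num.sqrt D / 4 <= `|x| then 1 else 0.

Definition big_step_prob : R :=
  fine (normal_prob 0 (Num.sqrt D) [set x : R | Num.sqrt D / 4 <= `|x|]).

Let measurable_big_step : measurable_fun setT big_step.
Proof.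
apply: measurable_fun_ifT => //.
by apply: measurable_fun_ler => //; exact: measurableT_comp.
Qed.

Let big_step_ge0 x : 0 <= big_step x.
Proof. by rewrite /big_step; case: ifP. Qed.

Let measurable_big : measurable [set x : R | Num.sqrt D / 4 <= `|x|].
Proof.
have := measurable_big_step measurableT (measurable_set1 (1 : R)).
rewrite setTI; congr measurable; apply/seteqP; split => x; rewrite /big_step/=.
  by case: ifP => // _ /esym /eqP; rewrite oner_eq0.
by move=> ->.
Qed.

Lemma big_step_prob_ge : 3 / 4 <= big_step_prob.
Proof.
have s0 : 0 < Num.sqrt D by rewrite sqrtr_gt0.
have := normal_prob_small s0.
have -> : [set x : R | `|x| < Num.sqrt D / 4] =
          ~` [set x : R | Num.sqrt D / 4 <= `|x|].
  by apply/seteqP; split => x /=; rewrite ltNge => /negP.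
rewrite probability_setC// -[X in (_ - X)%E]fineK ?fin_num_measure//.
by rewrite -EFinD lee_fin /big_step_prob; lra.
Qed.

Lemma big_step_prob_le1 : big_step_prob <= 1.
Proof.
rewrite -lee_fin /big_step_prob fineK ?fin_num_measure//.
exact: probability_le1.
Qed.

Lemma big_step_mean i : (\int[P]_w (big_step (bincr i w) - big_step_prob)%:E = 0)%E.
Proof.
have st : grid D i < grid D i.+1 by rewrite gridS ltrDl.
have h : (\int[P]_w (big_step (bincr i w))%:E = big_step_prob%:E)%E.
  rewrite (@ge0_integral_bdiff _ _ (fun x => (big_step x)%:E) (grid_ge0 i) st)//.
    rewrite gridB /big_step_prob fineK ?fin_num_measure//.
    rewrite -[X in normal_prob _ _ X]setIT.
    apply: (etrans _ (integral_indic (normal_prob 0 (Num.sqrt D)) measurableT measurable_big)).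
    apply: eq_integral => x _; rewrite indicE /big_step; congr (_%:E).
    by case: ifPn => h; [rewrite mem_set|rewrite memNset//; exact/negP].
  exact/measurable_EFinP.
have mb : measurable_fun setT (fun w => big_step (bincr i w)).
  by apply: measurableT_comp => //; exact: measurable_bincr.
have ib : P.-integrable setT (EFin \o (fun w => big_step (bincr i w))).
  apply/integrableP; split; first exact/measurable_EFinP.
  by under eq_integral do rewrite /= ger0_norm//; rewrite h ltry.
under eq_integral do rewrite EFinB.
rewrite integralB//; last exact: finite_measure_integrable_cst.
rewrite h [X in (_ - X)%E](_ : _ = big_step_prob%:E) ?subee//.
rewrite -[RHS]mule1 -(@probability_setT _ _ _ P).
exact: integral_cst.
Qed.

Lemma big_step_count_second_moment n :
  absmean_le P (fun w => (\sum_(i < n) (big_step (bincr i w) - big_step_prob)) ^+ 2)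
    n%:R.
Proof.
have h := @absmean_le_martingale _ _ _ P bincr measurable_bincr bincr_indep
  (fun _ => cst 1) (fun x => big_step x - big_step_prob) (fun _ => 1) 1 n.
have -> : (fun w => (\sum_(i < n) (big_step (bincr i w) - big_step_prob)) ^+ 2) =
    (fun w => (\sum_(i < n) cst 1 w * (big_step (bincr i w) - big_step_prob)) ^+ 2).
  by apply/funext => w; congr (_ ^+ 2); apply: eq_bigr => i _; rewrite mul1r.
have -> : n%:R = \sum_(i < n) 1 * 1 :> R.
  by rewrite sumr_const card_ord mul1r.
apply: h.
- exact: measurable_funB.
- by move=> i _; exact: adapted_cst.
- move=> i _; have := absmean_le_cst P (1 : R); rewrite normr1.
  by congr absmean_le; apply/funext => w; rewrite /= expr1n.
- move=> i _; have := absmean_le_cst P (1 : R); rewrite normr1.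
  apply: absmean_le_dom.
    apply: measurable_funX; apply: measurable_funB => //.
    by apply: measurableT_comp => //; exact: measurable_bincr.
  move=> w; rewrite normr1 ger0_norm ?sqr_ge0//.
  have := big_step_prob_ge; have := big_step_prob_le1; rewrite /big_step.
  by case: ifP => _ /=; nra.
- by move=> i _; exact: big_step_mean.
Qed.

Lemma sqr_ge_big_step x : D / 16 * big_step x <= x ^+ 2.
Proof.
rewrite /big_step; case: ifPn => [h|_] /=; rewrite ?mulr0 ?sqr_ge0// mulr1.
rewrite -(real_normK (num_real x)) -[D in leLHS](sqr_sqrtr (ltW D_gt0)).
have : 0 <= Num.sqrt D by rewrite sqrtr_ge0.
by move: h; nra.
Qed.

End brownian_increments.

(** * Riemann sums of continuous functions *)

Definition rsum (R : realType) (f : R -> R) (s L : R) (n : nat) : R :=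
  L / n.+1%:R * \sum_(k < n.+1) f (s + k%:R * (L / n.+1%:R)).

Section riemann_sums.
Context (R : realType).
Local Notation mu := (@lebesgue_measure R).
Implicit Types (f g : R -> R) (s L : R).

(** Heine's theorem, for the continuity in the subspace topology that the paths
    are given with. *)
Lemma uniform_continuity_segment (a b : R) f : {within `[a, b], continuous f} ->
  forall e : R, 0 < e -> exists2 h : R, 0 < h &
    forall x y, a <= x <= b -> a <= y <= b -> `|x - y| < h -> `|f x - f y| < e.
Proof.
move=> cf e e0.
have e20 : 0 < e / 2 by rewrite divr_gt0.
have cov := (compact_near_coveringP _).1 (@segment_compact R a b).
pose Q (h : R) (x : R) := forall y, a <= y <= b -> `|x - y| < h -> a <= x <= b -> `|f x - f y| < e.
have : \forall h \near 0^'+, `[a, b]%classic `<=` Q h.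
  apply: cov => x xab.
  have := (subspace_continuousP _ _).1 cf x xab.
  move=> /cvgrPdist_lt /(_ _ e20).
  rewrite near_withinE => /nbhs_ballP[del del0 hd].
  have del2 : 0 < del / 2 by rewrite divr_gt0.
  exists (ball x (del / 2), [set h : R | h < del / 2]).
    split; first exact: nbhsx_ballx.
    by exists (del / 2) => //= z /=; rewrite sub0r normrN => zd z0; rewrite (le_lt_trans (ler_norm _) zd).
  move=> [x' h] /= [xx' hh] y yab x'y x'ab.
  have d1 : `|f x - f x'| < e / 2.
    apply: hd; last by rewrite /= in_itv.
    by apply: le_ball xx'; lra.
  have d2 : `|f x - f y| < e / 2.
    apply: hd; last by rewrite /= in_itv.
    rewrite /ball/= in xx' *.
    have : `|x - y| <= `|x - x'| + `|x' - y|.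
      by rewrite (_ : x - y = (x - x') + (x' - y)) ?ler_normD//; ring.
    lra.
  have : `|f x' - f y| <= `|f x' - f x| + `|f x - f y|.
    by rewrite (_ : f x' - f y = (f x' - f x) + (f x - f y)) ?ler_normD//; ring.
  by rewrite (distrC (f x') (f x)); lra.
move=> hQ.
have hQ0 : \forall h \near (0 : R)^'+, `[a, b]%classic `<=` Q h /\ 0 < h.
  by apply: filterI hQ _; exact: nbhs_right_gt.
have [h [hh h0]] := @filter_ex R _ (at_right_proper_filter (0 : R)) _ hQ0.
exists h; first exact: h0.
by move=> x y xab yab xy; apply: (hh x) => //=; rewrite in_itv.
Qed.

Lemma within_continuous_dist (A : set R) f (c : R) : {within A, continuous f} ->
  {within A, continuous (fun u => `|f u - c|)}.
Proof.
move=> cf x; apply: cvg_norm; apply: cvgB; first exact: cf.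
exact: cvg_cst.
Qed.

Lemma continuous_segment_integrable (a b : R) f : {within `[a, b], continuous f} ->
  mu.-integrable `[a, b] (EFin \o f).
Proof. by apply: continuous_compact_integrable; exact: segment_compact. Qed.

(** Uniform Riemann sums of a continuous function tend to its Lebesgue integral,
    which supplies monotonicity and linearity for the path estimates. *)
Lemma rsum_cvg_Rintegral f s L : 0 <= L -> {within `[s, s + L], continuous f} ->
  rsum f s L n @[n --> \oo] --> \int[mu]_(x in `[s, s + L]) f x.
Proof.
move=> L0 cf; have uc := uniform_continuity_segment cf.
apply/cvgrPdist_le => e e0.
have eL : 0 < e / (L + 1) by rewrite divr_gt0// ltr_wpDl.
have [h h0 hf] := uc _ eL.
have nh : \forall n \near \oo, L / n.+1%:R < h.
  near=> n; rewrite ltr_pdivrMr// mulrC -ltr_pdivrMr//.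
  near: n; exists (Num.truncn (L / h)) => // n /= hn.
  by apply: (lt_le_trans (truncnS_gt _)); rewrite ler_nat ltnS.
near=> n.
have Lnh : L / n.+1%:R < h by near: n.
set dl := L / n.+1%:R in Lnh *.
have dl0 : 0 <= dl by rewrite divr_ge0.
pose u (k : nat) := s + k%:R * dl.
pose F t := \int[mu]_(x in `[s, t]) f x.
have uS k : u k.+1 = u k + dl by rewrite /u -natr1; ring.
have us k : s <= u k by rewrite /u lerDl mulr_ge0.
have uL k : (k <= n.+1)%N -> u k <= s + L.
  move=> kn; rewrite /u lerD2l -[leRHS](@divfK _ n.+1%:R)// mulrC.
  by rewrite ler_wpM2l// ler_nat.
have un : u n.+1 = s + L by rewrite /u /dl mulrC divfK.
have step k : (k < n.+1)%N -> `|F (u k.+1) - F (u k) - f (u k) * dl| <= e / (L + 1) * dl.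
  move=> kn.
  have uk1 : u k.+1 <= s + L by exact: uL.
  have cf' : {within `[s, u k.+1], continuous f}.
    apply: continuous_subspaceW cf => x /=; rewrite !in_itv/= => /andP[-> /=].
    by move/le_trans; apply.
  have int1 := continuous_segment_integrable cf'.
  rewrite /F Rintegral_itvB//; last 2 first.
  - by rewrite bnd_simp.
  - by rewrite bnd_simp uS lerDl.
  have sub : `]u k, u k.+1]%classic `<=` `[s, u k.+1]%classic.
    move=> x /=; rewrite !in_itv/= => /andP[ukx ->]; rewrite andbT.
    by rewrite (le_trans (us k))// ltW.
  have int2 : mu.-integrable `]u k, u k.+1] (EFin \o f).
    by apply: integrableS int1.
  have mulen : mu `]u k, u k.+1]%classic = dl%:E.
    rewrite lebesgue_measure_itv/= lte_fin uS ltrDl.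
    case: ifPn => [_|]; first by rewrite -EFinB addrAC subrr add0r.
    by rewrite -leNgt => dle0; congr (_%:E); apply/eqP; rewrite eq_le dl0 dle0.
  have cstint (c : R) : mu.-integrable `]u k, u k.+1] (EFin \o cst c).
    apply: (@integrableS _ _ _ mu `[u k, u k.+1]%classic) => //.
      by move=> x /=; rewrite !in_itv/= => /andP[/ltW -> ->].
    apply: continuous_segment_integrable => x; exact: cvg_cst.
  have dlE (c : R) : \int[mu]_(x in `]u k, u k.+1]) c = c * dl.
    rewrite Rintegral_cst//; congr (c * _); exact: (congr1 fine mulen).
  rewrite -dlE -RintegralB//.
  apply: le_trans (le_normr_Rintegral _ _) _ => //.
    exact: (integrableB _ int2 (cstint (f (u k)))).
  rewrite -[leRHS]dlE; apply: le_Rintegral => //.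
    apply: (@integrableS _ _ _ mu `[s, u k.+1]%classic) => //.
    apply: continuous_segment_integrable.
    exact: within_continuous_dist.
  exact: (cstint (e / (L + 1))).
  move=> x /=; rewrite in_itv/= => /andP[ux xu].
  apply/ltW/hf.
  - by rewrite (le_trans (us k) (ltW ux))/= (le_trans xu).
  - by rewrite us/= uL// ltnW.
  - rewrite ger0_norm ?subr_ge0 ?(ltW ux)//.
    by rewrite (le_lt_trans _ Lnh)// lerBlDl -uS.
  exact: (cstint (f (u k))).
have telF : \int[mu]_(x in `[s, s + L]) f x = \sum_(k < n.+1) (F (u k.+1) - F (u k)).
  rewrite -(big_mkord xpredT (fun k => F (u k.+1) - F (u k))) telescope_sumr//.
  have -> : F (u 0%N) = 0.
    by rewrite /F /u mul0r addr0 set_itv1 Rintegral_set1.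
  by rewrite subr0 -un.
rewrite telF /rsum -/dl mulr_sumr -sumrB.
apply: le_trans (ler_norm_sum _ _ _) _.
apply: (@le_trans _ _ (\sum_(k < n.+1) (e / (L + 1) * dl))).
  by apply: ler_sum => k _; rewrite mulrC; exact: step.
rewrite sumr_const card_ord -mulr_natl /dl.
have -> : n.+1%:R * (e / (L + 1) * (L / n.+1%:R)) = e * (L / (L + 1)).
  have L1 : L + 1 != 0 by rewrite gt_eqF// ltr_wpDl.
  have n1 : n.+1%:R != 0 :> R by rewrite pnatr_eq0.
  have gen (N : R) : N != 0 -> N * (e / (L + 1) * (L / N)) = e * (L / (L + 1)).
    by move=> N0; field; rewrite N0 L1.
  exact: gen.
rewrite ler_piMr ?(ltW e0)// ler_pdivrMr ?mul1r ?lerDl//.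
by rewrite ltr_wpDl.
Unshelve. all: by end_near. Qed.

End riemann_sums.

(** * One step of the Euler scheme *)

Section path_step.
Context (R : realType).
Local Notation mu := (@lebesgue_measure R).

Lemma rsum_ext (f g : R -> R) (s L : R) n : 0 <= L ->
  (forall u, s <= u <= s + L -> f u = g u) -> rsum f s L n = rsum g s L n.
Proof.
move=> L0 fg; congr (_ * _); apply: eq_bigr => k _; apply: fg.
have dl0 : 0 <= L / n.+1%:R by rewrite divr_ge0.
rewrite lerDl mulr_ge0//= lerD2l -[leRHS](@divfK _ n.+1%:R)// mulrC.
by rewrite ler_wpM2l// ler_nat ltnW.
Qed.

Lemma rsumD (f g : R -> R) (s L : R) n :
  rsum (fun u => f u + g u) s L n = rsum f s L n + rsum g s L n.
Proof. by rewrite /rsum big_split mulrDr. Qed.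

Lemma rsumZ (c : R) (f : R -> R) (s L : R) n :
  rsum (fun u => c * f u) s L n = c * rsum f s L n.
Proof. by rewrite /rsum -mulr_sumr mulrCA. Qed.

Lemma rsum_cst (c s L : R) n : rsum (fun=> c) s L n = L * c.
Proof.
by rewrite /rsum sumr_const card_ord -(mulr_natl c) mulrA divfK// pnatr_eq0.
Qed.

Lemma ler_rsum (f g : R -> R) (s L : R) n : 0 <= L ->
  (forall u, s <= u <= s + L -> f u <= g u) -> rsum f s L n <= rsum g s L n.
Proof.
move=> L0 fg; have dl0 : 0 <= L / n.+1%:R by rewrite divr_ge0.
rewrite ler_wpM2l//; apply: ler_sum => k _; apply: fg.
rewrite lerDl mulr_ge0//= lerD2l -[leRHS](@divfK _ n.+1%:R)// mulrC.
by rewrite ler_wpM2l// ler_nat ltnW.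
Qed.

Lemma ler_norm_rsum (f : R -> R) (s L : R) n : 0 <= L ->
  `|rsum f s L n| <= rsum (fun u => `|f u|) s L n.
Proof.
move=> L0; rewrite normrM ger0_norm ?divr_ge0//.
by rewrite ler_wpM2l ?divr_ge0// ler_norm_sum.
Qed.

Lemma is_riemann_integral_rsum (f : R -> R) (s L v : R) : 0 <= L ->
  is_riemann_integral f s (s + L) v -> rsum f s L n @[n --> \oo] --> v.
Proof.
move=> L0 [_ fv]; apply/cvgrPdist_lt => e e0; have [h h0 hv] := fv e e0.
near=> n.
have nh : L / n.+1%:R < h.
  rewrite ltr_pdivrMr// mulrC -ltr_pdivrMr//.
  near: n; exists (Num.truncn (L / h)) => // n /= hn.
  by apply: (lt_le_trans (truncnS_gt _)); rewrite ler_nat ltnS.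
set dl := L / n.+1%:R in nh.
have dl0 : 0 <= dl by rewrite divr_ge0.
pose u (k : nat) := s + k%:R * dl.
have uS k : u k.+1 - u k = dl by rewrite /u -natr1; ring.
have := hv n.+1 u u.
rewrite {1}/u mul0r addr0 {1}/u /dl mulrC divfK ?pnatr_eq0// => /(_ erefl erefl).
rewrite distrC -/dl.
have -> : \sum_(i < n.+1) f (u i) * (u i.+1 - u i) = rsum f s L n.
  by rewrite /rsum -/dl mulr_sumr; apply: eq_bigr => k _; rewrite uS mulrC.
by apply=> i _; rewrite lexx uS nh -subr_ge0 uS dl0.
Unshelve. all: by end_near. Qed.

Lemma rsum_dist_cvg (x : R -> R) (s L : R) : 0 <= L ->
  {within `[s, s + L], continuous x} ->
  rsum (fun u => `|x u - x s|) s L n @[n --> \oo] -->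
    \int[mu]_(u in `[s, s + L]) `|x u - x s|.
Proof.
by move=> L0 cx; apply: rsum_cvg_Rintegral => //; exact: within_continuous_dist.
Qed.

(** One Euler step. Riemann integrability of m - a x along the path, together
    with continuity of x, forces the Riemann sums of m to converge; call F their
    limit. The error of the step is then a times the integral of x - x(s) over
    the cell. The integral I of |x - x(s)| satisfies I <= L (L (C + a |x(s)|) +
    a I) + sigma beta, where beta is the integrated displacement of b, and
    a L <= 1/2 absorbs I on the right. *)
Lemma path_step (x b m : R -> R) (s L a sigma C : R) :
  0 < L -> 0 <= a -> a * L <= 1 / 2 -> 0 <= sigma -> 0 <= C ->
  {within `[s, s + L], continuous x} -> {within `[s, s + L], continuous b} ->
  (forall u, s <= u <= s + L -> `|m u| <= C) ->
  (forall v, s <= v <= s + L ->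
    is_riemann_integral (fun u => m u - a * x u) s v
      (x v - x s - sigma * (b v - b s))) ->
  exists F beta, [/\ rsum m s L n @[n --> \oo] --> F,
    rsum (fun u => `|b u - b s|) s L n @[n --> \oo] --> beta, 0 <= beta &
    `|x (s + L) - (x s + F - a * L * x s + sigma * (b (s + L) - b s))| <=
      a * (2 * L ^+ 2 * (C + a * `|x s|) + 2 * sigma * beta)].
Proof.
move=> L0 a0 aL sg0 C0 cx cb mC sde.
have L0' := ltW L0.
pose I := \int[mu]_(u in `[s, s + L]) `|x u - x s|.
pose beta := \int[mu]_(u in `[s, s + L]) `|b u - b s|.
have cI := rsum_dist_cvg L0' cx; rewrite -/I in cI.
have cbeta := rsum_dist_cvg L0' cb; rewrite -/beta in cbeta.
pose E := C + a * `|x s|.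
have xsE : s <= s + L <= s + L by rewrite lerDl L0' lexx.
have E0 : 0 <= E by rewrite addr_ge0// mulr_ge0.
have beta0 : 0 <= beta by apply: Rintegral_ge0.
(* increments of the path over part of the cell, in terms of its mean
   displacement I over the whole cell *)
have step v : s <= v <= s + L ->
    `|x v - x s| <= L * E + a * I + sigma * `|b v - b s|.
  move=> /andP[sv vL]; have vL0 : 0 <= v - s by rewrite subr_ge0.
  have svE : v = s + (v - s) by rewrite addrC subrK.
  have cx' : {within `[s, s + (v - s)], continuous x}.
    apply: continuous_subspaceW cx => u /=; rewrite !in_itv/= -svE => /andP[-> /=].
    by move/le_trans; apply.
  have := sde v; rewrite sv vL => /(_ erefl).
  rewrite {1}svE => /(is_riemann_integral_rsum vL0) h.
  have hI := rsum_dist_cvg vL0 cx'.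
  have IvI : \int[mu]_(u in `[s, s + (v - s)]) `|x u - x s| <= I.
    rewrite -svE /I -subr_ge0 Rintegral_itvB ?bnd_simp//.
      exact: Rintegral_ge0.
    apply: continuous_segment_integrable; exact: within_continuous_dist.
  have hv : `|x v - x s - sigma * (b v - b s)| <= L * E + a * I.
    apply: (@le_trans _ _ ((v - s) * E + a * \int[mu]_(u in `[s, s + (v - s)]) `|x u - x s|)); last first.
      by rewrite lerD// ?ler_wpM2r// ?ler_wpM2l// lerBlDl.
    have l1 : `|rsum (fun u => m u - a * x u) s (v - s) n| @[n --> \oo] -->
      `|x v - x s - sigma * (b v - b s)| by exact: cvg_norm.
    have l2 : (v - s) * E + a * rsum (fun u => `|x u - x s|) s (v - s) n
        @[n --> \oo] -->
        (v - s) * E + a * \int[mu]_(u in `[s, s + (v - s)]) `|x u - x s|.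
      by apply: cvgD; [exact: cvg_cst|apply: cvgM => //; exact: cvg_cst].
    apply: (ler_cvg_to l1 l2); near=> n.
    apply: le_trans (ler_norm_rsum _ _ _ vL0) _.
    rewrite -(rsum_cst E s _ n) -rsumZ -rsumD; apply: ler_rsum => // u.
    rewrite -svE => /andP[su uv].
    have mu' : `|m u| <= C by apply: mC; rewrite su (le_trans uv).
    rewrite (_ : m u - a * x u = (m u - a * x s) - a * (x u - x s)); last by ring.
    apply: le_trans (ler_normB _ _) _; rewrite normrM (ger0_norm a0) lerD2r.
    by apply: le_trans (ler_normB _ _) _; rewrite normrM (ger0_norm a0) lerD2r.
  have : `|x v - x s| <= `|x v - x s - sigma * (b v - b s)| + `|sigma * (b v - b s)|.
    by rewrite -[X in `|X| <= _](subrK (sigma * (b v - b s))) ler_normD.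
  by rewrite normrM (ger0_norm sg0); lra.
have I0 : 0 <= I by apply: Rintegral_ge0.
have Ile : I <= L * (L * E + a * I) + sigma * beta.
  have l2 : L * (L * E + a * I) + sigma * rsum (fun u => `|b u - b s|) s L n
      @[n --> \oo] --> L * (L * E + a * I) + sigma * beta.
    by apply: cvgD; [exact: cvg_cst|apply: cvgM => //; exact: cvg_cst].
  apply: (ler_cvg_to cI l2); near=> n.
  by rewrite -(rsum_cst _ s _ n) -rsumZ -rsumD; exact: ler_rsum.
have Ile2 : I <= 2 * L ^+ 2 * E + 2 * sigma * beta.
  have : a * L * I <= 1 / 2 * I by rewrite ler_wpM2r.
  by move: Ile; nra.
pose Y := \int[mu]_(u in `[s, s + L]) (x u - x s).
have cY : rsum (fun u => x u - x s) s L n @[n --> \oo] --> Y.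
  apply: rsum_cvg_Rintegral => //.
  by move=> z; apply: cvgB; [exact: cx|exact: cvg_cst].
have YI : `|Y| <= I.
  apply: ler_cvg_to (cvg_norm cY) cI _; near=> n; exact: ler_norm_rsum.
have := sde _ xsE => /(is_riemann_integral_rsum L0').
set v := _ - sigma * _ => hv.
exists (v + a * Y + L * (a * x s)), beta; split=> //.
  have -> : (fun n => rsum m s L n) =
    (fun n => rsum (fun u => m u - a * x u) s L n +
              a * rsum (fun u => x u - x s) s L n + L * (a * x s)).
    apply/funext => n; rewrite -rsumZ -(rsum_cst (a * x s) s _ n) -!rsumD.
    by apply: rsum_ext => // u _; ring.
  apply: cvgD; last exact: cvg_cst.
  by apply: cvgD => //; apply: cvgM => //; exact: cvg_cst.
rewrite (_ : x (s + L) - _ = - (a * Y)); last by rewrite /v; ring.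
rewrite normrN normrM (ger0_norm a0) ler_wpM2l// (le_trans YI)//.
Unshelve. all: by end_near. Qed.

End path_step.

Lemma sqr_sum_le (R : realType) n (f : nat -> R) :
  (\sum_(k < n) f k) ^+ 2 <= n%:R * \sum_(k < n) f k ^+ 2.
Proof.
elim: n => [|n IH]; first by rewrite !big_ord0 expr0n mulr0.
rewrite !big_ord_recr/= -natr1; set S := \sum_(_ < _) f _; set Q := \sum_(_ < _) _ ^+ 2 in IH *.
have QS : S ^+ 2 <= n%:R * Q by [].
have : 2 * S * f n <= Q + n%:R * f n ^+ 2.
  have -> : n%:R * f n ^+ 2 = \sum_(k < n) f n ^+ 2.
    by rewrite sumr_const card_ord mulr_natl.
  rewrite mulrAC mulr_sumr -big_split/=.
  apply: ler_sum => k _; have := sqr_ge0 (f k - f n); nra.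
by move: QS; nra.
Qed.

Section displacement.
Context d (Omega : measurableType d) (R : realType) (P : probability Omega R).
Variables (B : R -> {RV P >-> R}) (B_BM : brownian_motion B).

(** The square of the integrated displacement of B over a cell, defined as a
    lower limit so as to be measurable. *)
Definition sqr_displacement (s L : R) (w : Omega) : R :=
  fine (limn_einf (fun n => ((rsum (fun u => `|B u w - B s w|) s L n) ^+ 2)%:E)).

Lemma sqr_displacementE s L w (beta : R) :
  rsum (fun u => `|B u w - B s w|) s L n @[n --> \oo] --> beta ->
  sqr_displacement s L w = beta ^+ 2.
Proof.
move=> h; rewrite /sqr_displacement.
suff -> : limn_einf (fun n => ((rsum (fun u => `|B u w - B s w|) s L n) ^+ 2)%:E) =
  (beta ^+ 2)%:E by [].
apply: (cvg_limn_einf_sup _).1; apply: cvg_EFin; first by near=> n.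
by apply: cvgM.
Unshelve. all: by end_near. Qed.

(** The square of a mean displacement is at most the mean square displacement,
    which is O(L); Fatou's lemma passes to the limit. *)
Lemma sqr_displacement_mean s L : 0 <= s -> 0 < L ->
  absmean_le P (sqr_displacement s L) (8 * L ^+ 3).
Proof.
move=> s0 L0.
pose A n w := (rsum (fun u => `|B u w - B s w|) s L n) ^+ 2.
have mA n : measurable_fun setT (A n).
  apply: measurable_funX; apply: measurable_funM => //.
  apply: measurable_sum => k; apply: measurableT_comp => //.
  exact: measurable_bdiff.
have A0 n w : 0 <= A n w by rewrite sqr_ge0.
have mlim : measurable_fun setT (fun w => limn_einf (fun n => (A n w)%:E)).
  rewrite (_ : (fun w => _) = (fun w => - limn_esup (fun n => - (A n w)%:E)))%E//.
  apply: measurableT_comp => //; apply: measurable_fun_limn_esup => n.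
  by apply: measurableT_comp => //; exact/measurable_EFinP.
have lim0 w : (0 <= limn_einf (fun n => (A n w)%:E))%E.
  rewrite limn_einf_lim; apply: lime_ge; first exact: is_cvg_einfs.
  near=> n; apply: le_ereal_inf_tmp => _ [k _ <-]; by rewrite lee_fin.
have bound n : (\int[P]_w (A n w)%:E <= (8 * L ^+ 3)%:E)%E.
  have AC w : `|A n w| <= `|L ^+ 2 / n.+1%:R * \sum_(k < n.+1) (B (s + k%:R * (L / n.+1%:R)) w - B s w) ^+ 2|.
    rewrite [leLHS]ger0_norm ?A0// ger0_norm; last first.
      by rewrite mulr_ge0 ?divr_ge0 ?sqr_ge0// sumr_ge0// => k _; exact: sqr_ge0.
    rewrite /A /rsum exprMn.
    have := sqr_sum_le n.+1 (fun k => `|B (s + k%:R * (L / n.+1%:R)) w - B s w|).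
    have -> : \sum_(k < n.+1) `|B (s + k%:R * (L / n.+1%:R)) w - B s w| ^+ 2 =
        \sum_(k < n.+1) (B (s + k%:R * (L / n.+1%:R)) w - B s w) ^+ 2.
      by apply: eq_bigr => k _; rewrite real_normK// num_real.
    move=> h; apply: le_trans (ler_wpM2l (sqr_ge0 (L / n.+1%:R)) h) _.
    rewrite mulrA ler_wpM2r//; first by rewrite sumr_ge0// => k _; exact: sqr_ge0.
    have gen (N : R) : N != 0 -> (L / N) ^+ 2 * N <= L ^+ 2 / N.
      by move=> N0; rewrite le_eqVlt; apply/orP; left; apply/eqP; field.
    by rewrite gen// pnatr_eq0.
  have b2 (k : 'I_n.+1) : absmean_le P
      (fun w => (B (s + k%:R * (L / n.+1%:R)) w - B s w) ^+ 2) (8 * L).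
    have kL : 0 <= k%:R * (L / n.+1%:R) <= L.
      rewrite mulr_ge0 ?divr_ge0 ?(ltW L0)//= -[leRHS](@divfK _ n.+1%:R)// mulrC.
      by rewrite ler_wpM2l ?divr_ge0 ?(ltW L0)// ler_nat ltnW.
    move/andP: kL => [k0 kL].
    apply: absmean_leW (bdiff_second_moment B_BM s0 _); last by rewrite lerDl.
    by rewrite addrAC subrr add0r ler_wpM2l.
  have := absmean_leZ (L ^+ 2 / n.+1%:R) (absmean_le_sum (index_enum _) b2).
  move=> /(absmean_le_dom (mA n) AC) [_].
  under eq_integral do rewrite ger0_norm ?A0//.
  move/le_trans; apply; rewrite lee_fin sumr_const card_ord.
  rewrite ger0_norm ?divr_ge0 ?sqr_ge0// -(mulr_natl (8 * L)).
  have gen (N : R) : N != 0 -> L ^+ 2 / N * (N * (8 * L)) = 8 * L ^+ 3.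
    by move=> N0; field.
  by rewrite gen// pnatr_eq0.
have total : (\int[P]_w limn_einf (fun n => (A n w)%:E) <= (8 * L ^+ 3)%:E)%E.
  apply: le_trans (fatou P measurableT _ _) _ => //.
  - by move=> n; exact/measurable_EFinP.
  - by move=> n w _; rewrite lee_fin.
  rewrite limn_einf_lim; apply: lime_le; first exact: is_cvg_einfs.
  near=> n; apply: le_trans (bound n); apply: ereal_inf_lbound.
  by exists n => /=.
split.
  by apply: measurableT_comp => //; exact: fine_measurable.
apply: le_trans total; apply: ge0_le_integral => //.
- apply/measurable_EFinP; apply: measurableT_comp => //.
  by apply: measurableT_comp => //; exact: fine_measurable.
- move=> w _; have := lim0 w; rewrite /A /sqr_displacement => l0.
  rewrite ger0_norm ?fine_ge0//; move: l0.
  by case: (limn_einf _) => //= *; rewrite ?leey.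
Unshelve. all: by end_near. Qed.

End displacement.

(** * Averages of a periodic Riemann integrable function *)

Section periodic_averages.
Context (R : realType).
Implicit Types (f : R -> R).

(** The length of the part of [a, a + L] that lies below t. It cuts an arbitrary
    grid into periods: along the grid, the differences of clamp k%:R 1 are the
    lengths that the cells share with the k-th period. *)
Definition clamp (a L t : R) : R := Num.min L (Num.max 0 (t - a)).

(* case analysis on the innermost comparison first, so that the hypotheses
   produced are free of conditionals *)
Ltac split_ifs := repeat match goal with
  |- context [if (?x < ?y)%R then _ else _] =>
    lazymatch constr:((x, y)) with
    | context [if _ then _ else _] => fail
    | _ => case: (ltP x y) => ?
    end
  end.

Ltac clamp_cases := rewrite /clamp /Num.min /Num.max; split_ifs; lra.

Lemma clamp_ge0 a L t : 0 <= L -> 0 <= clamp a L t.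
Proof. by move=> ?; clamp_cases. Qed.

Lemma clamp_leL a L t : clamp a L t <= L.
Proof. by clamp_cases. Qed.

Lemma clamp_homo a L t u : t <= u -> clamp a L t <= clamp a L u.
Proof. by move=> ?; clamp_cases. Qed.

Lemma clamp_lip a L t u : t <= u -> clamp a L u - clamp a L t <= u - t.
Proof. by move=> ?; clamp_cases. Qed.

Lemma clamp0 a L t : 0 <= L -> t <= a -> clamp a L t = 0.
Proof. by move=> ? ?; clamp_cases. Qed.

Lemma clampL a L t : 0 <= L -> a + L <= t -> clamp a L t = L.
Proof. by move=> ? ?; clamp_cases. Qed.

Lemma clamp_mid a L t : a <= t -> t <= a + L -> clamp a L t = t - a.
Proof. by move=> ? ?; clamp_cases. Qed.

Lemma clamp_left_crossing a D t : 0 < D -> D < 1 -> t < a ->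
  clamp a 1 (t + D) - clamp a 1 t <= clamp a D (t + D) - clamp a D t.
Proof.
move=> D0 D1 ta; rewrite (@clamp0 a 1 t) ?(@clamp0 a D t) ?(ltW ta) ?(ltW D0)//.
by rewrite !subr0; clamp_cases.
Qed.

Lemma clamp_right_crossing a D t : 0 < D -> D < 1 -> a + 1 < t + D ->
  clamp a 1 (t + D) - clamp a 1 t <=
  clamp (a + 1 - D) D (t + D) - clamp (a + 1 - D) D t.
Proof.
move=> D0 D1 ta; rewrite (@clampL a 1) ?(ltW ta)// (@clampL _ D); [|lra|lra].
by clamp_cases.
Qed.

Lemma sum_clamp (M : nat) t : 0 <= t -> \sum_(k < M) clamp k%:R 1 t = Num.min M%:R t.
Proof.
move=> t0; elim: M => [|M IH].
  by rewrite big_ord0 /Num.min; case: ltP => ?; lra.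
rewrite big_ord_recr/= IH -natr1; have : 0 <= M%:R :> R by []. move=> ?.
by clamp_cases.
Qed.

(** Compare the sums at the tags with the larger and with the smaller value. *)
Lemma is_riemann_integral_oscillation f a b v : is_riemann_integral f a b v ->
  forall e : R, 0 < e -> exists2 h : R, 0 < h &
    forall (n : nat) (x xi xi' : nat -> R),
      x 0%N = a -> x n = b ->
      (forall i, (i < n)%N -> x i <= xi i <= x i.+1 /\ x i.+1 - x i < h) ->
      (forall i, (i < n)%N -> x i <= xi' i <= x i.+1) ->
      \sum_(i < n) `|f (xi i) - f (xi' i)| * (x i.+1 - x i) < e.
Proof.
move=> [_ fv] e e0; have e2 : 0 < e / 2 by rewrite divr_gt0.
have [h h0 H] := fv _ e2; exists h => // n x xi xi' x0 xn xih xi'h.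
pose hi i := if f (xi' i) <= f (xi i) then xi i else xi' i.
pose lo i := if f (xi' i) <= f (xi i) then xi' i else xi i.
have h1 : `|\sum_(i < n) f (hi i) * (x i.+1 - x i) - v| < e / 2.
  apply: H => // i il; have [h2 h3] := xih i il; have h4 := xi'h i il.
  by rewrite /hi; case: ifP.
have h2 : `|\sum_(i < n) f (lo i) * (x i.+1 - x i) - v| < e / 2.
  apply: H => // i il; have [h2 h3] := xih i il; have h4 := xi'h i il.
  by rewrite /lo; case: ifP.
have -> : \sum_(i < n) `|f (xi i) - f (xi' i)| * (x i.+1 - x i) =
   \sum_(i < n) f (hi i) * (x i.+1 - x i) - \sum_(i < n) f (lo i) * (x i.+1 - x i).
  rewrite -sumrB; apply: eq_bigr => i _; rewrite -mulrBl; congr (_ * _).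
  rewrite /hi /lo; case: ifPn => [h3|]; first by rewrite ger0_norm// subr_ge0.
  by rewrite -ltNge => h3; rewrite ltr0_norm ?opprB// subr_lt0.
by move: h1 h2; rewrite !ltr_norml; lra.
Qed.

Variables (f : R -> R) (v : R).
Hypotheses (f_int : is_riemann_integral f 0 1 v)
           (f_per : forall t, 0 <= t -> f (t + 1) = f t).

Lemma periodic_natr t k : 0 <= t -> f (t + k%:R) = f t.
Proof.
move=> t0; elim: k => [|k IH]; first by rewrite addr0.
by rewrite -natr1 addrA f_per ?IH// addr_ge0.
Qed.

(** Take a partition of the period into n equal cells, fine enough for the total
    oscillation, weighted by 1 / n, to be below 1: over each cell f varies by at
    most n. *)
Lemma riemann_periodic_bounded : exists2 G : R, 0 <= G & forall t, 0 <= t -> `|f t| <= G.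
Proof.
have [h h0 H] := is_riemann_integral_oscillation f_int ltr01.
pose n := (Num.truncn h^-1).+1.
have nh : n%:R^-1 < h.
  by rewrite invf_plt ?posrE// truncnS_gt.
have n0 : 0 < n%:R :> R by rewrite ltr0n.
pose x (i : nat) := i%:R / n%:R : R.
have xS i : x i.+1 - x i = n%:R^-1 by rewrite /x -natr1 mulrDl mul1r addrAC subrr add0r.
pose G := \sum_(i < n) `|f (x i)| + n%:R.
have G01 t : 0 <= t -> t < 1 -> `|f t| <= G.
  move=> t0 t1; pose i := Num.truncn (t * n%:R).
  have tn0 : 0 <= t * n%:R by rewrite mulr_ge0// ltW.
  have := truncn_itv tn0; rewrite -/i => /andP[i1 i2].
  have iltn : (i < n)%N.
    rewrite -(ltr_nat R); apply: le_lt_trans i1 _.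
    by rewrite -[ltRHS]mul1r ltr_pM2r.
  pose xi' j := if j == i then t else x j.
  have := H n x x xi'.
  rewrite {1}/x mul0r {1}/x divff ?gt_eqF// => /(_ erefl erefl).
  have h1 : forall j, (j < n)%N -> x j <= x j <= x j.+1 /\ x j.+1 - x j < h.
    by move=> j _; rewrite lexx xS nh -subr_ge0 xS invr_ge0 ltW.
  have h2 : forall j, (j < n)%N -> x j <= xi' j <= x j.+1.
    move=> j _; rewrite /xi'; case: eqP => [->|_].
      by rewrite /x ler_pdivrMr// i1 ler_pdivlMr// ltW.
    by rewrite lexx -subr_ge0 xS invr_ge0 ltW.
  move=> /(_ h1 h2); rewrite (bigD1 (Ordinal iltn))//= xS {1}/xi' eqxx => h3.
  have h4 : `|f (x i) - f t| / n%:R < 1.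
    apply: le_lt_trans h3; rewrite lerDl sumr_ge0// => j _.
    by rewrite mulr_ge0// xS invr_ge0 ltW.
  rewrite ltr_pdivrMr// mul1r in h4.
  have h5 : `|f (x i)| <= \sum_(i < n) `|f (x i)|.
    by rewrite (bigD1 (Ordinal iltn))//= lerDl sumr_ge0.
  have : `|f t| <= `|f (x i) - f t| + `|f (x i)|.
    by rewrite distrC -[X in `|X| <= _](subrK (f (x i))) ler_normD.
  by rewrite /G; lra.
exists G; first by rewrite addr_ge0// sumr_ge0.
move=> t t0; have /andP[k1 k2] := truncn_itv t0.
set k := Num.truncn t in k1 k2.
rewrite -(subrK k%:R t) periodic_natr ?subr_ge0//.
apply: G01; first by rewrite subr_ge0.
by rewrite ltrBlDr addrC natr1.
Qed.

(** A grid of mesh D need not match the period. On each of the M whole periods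
    before n D the clamped grid is a fine partition, so the sum there is close to
    the integral v; only the cells that straddle the two ends of the period have
    tags outside it, at a cost of at most 4 G D. The incomplete last period costs
    the constant C. The tags are arbitrary in their cells, so that the result also
    controls oscillations and the integrals of f over cells. *)
Lemma periodic_tagged_average : exists2 C : R, 0 <= C &
  forall e : R, 0 < e -> exists2 h : R, 0 < h &
  forall (D : R) (n : nat) (y : nat -> R), 0 < D -> D < h ->
    (forall j, j%:R * D <= y j <= j.+1%:R * D) ->
    `|\sum_(j < n) D * f (y j) - n%:R * D * v| <= n%:R * D * e + C.
Proof.
have [G G0 fG] := riemann_periodic_bounded.
exists (G + `|v|); first by rewrite addr_ge0.
move=> e e0; have e2 : 0 < e / 2 by rewrite divr_gt0.
have [_ fv] := f_int; have [h h0 H] := fv _ e2.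
have g0 : 0 < e / (8 * (G + 1)) by rewrite divr_gt0// mulr_gt0// ltr_wpDl.
exists (Num.min 1 (Num.min h (e / (8 * (G + 1))))).
  by rewrite !lt_min ltr01 h0 g0.
move=> D n y D0; rewrite !lt_min => /and3P[D1 Dh Dg] ytag.
have GD : 4 * G * D <= e / 2.
  have : D * (8 * (G + 1)) < e.
    by rewrite -ltr_pdivlMr// mulr_gt0// ltr_wpDl.
  nra.
pose t (j : nat) := j%:R * D.
have tS j : t j.+1 = t j + D by rewrite /t -natr1; ring.
have t0 j : 0 <= t j by rewrite /t mulr_ge0// ltW.
have tS' j : t j <= t j.+1 by rewrite tS lerDl ltW.
have ty j : t j <= y j by have /andP[] := ytag j.
have yt j : y j <= t j.+1 by have /andP[] := ytag j.
have y0 j : 0 <= y j by exact: le_trans (ty j).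
pose M := Num.truncn (t n).
have /andP[M1 M2] := truncn_itv (t0 n); rewrite -/M in M1 M2.
pose len (k j : nat) := clamp k%:R 1 (t j.+1) - clamp k%:R 1 (t j).
have len0 k j : 0 <= len k j by rewrite subr_ge0 clamp_homo.
have period (k : nat) : (k < M)%N ->
    `|\sum_(j < n) f (y j) * len k j - v| <= e / 2 + 4 * G * D.
  move=> kM.
  have kMR : k%:R + 1 <= t n.
    by apply: le_trans M1; rewrite natr1 ler_nat.
  have h1 := H n (fun j => clamp k%:R 1 (t j)) (fun j => clamp k%:R 1 (y j)).
  have h2 : `|\sum_(j < n) f (clamp k%:R 1 (y j)) * len k j - v| < e / 2.
    apply: h1; [by rewrite clamp0// /t mul0r|by rewrite clampL|].
    move=> j _; rewrite !clamp_homo//; split=> //.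
    by apply: le_lt_trans (clamp_lip _ _ (tS' j)) _; rewrite tS addrAC subrr add0r.
  pose c1 j := clamp k%:R D (t j).
  pose c2 j := clamp (k%:R + 1 - D) D (t j).
  have h3 : `|\sum_(j < n) f (y j) * len k j - \sum_(j < n) f (clamp k%:R 1 (y j)) * len k j|
      <= \sum_(j < n) 2 * G * ((c1 j.+1 - c1 j) + (c2 j.+1 - c2 j)).
    rewrite -sumrB; apply: le_trans (ler_norm_sum _ _ _) _; apply: ler_sum => j _.
    rewrite -mulrBl normrM (ger0_norm (len0 _ _)).
    have c1p : 0 <= c1 j.+1 - c1 j by rewrite subr_ge0 clamp_homo.
    have c2p : 0 <= c2 j.+1 - c2 j by rewrite subr_ge0 clamp_homo.
    have G20 : 0 <= 2 * G by rewrite mulr_ge0.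
    have fle : `|f (y j) - f (clamp k%:R 1 (y j))| <= 2 * G.
      have l1 := fG _ (y0 j); have l2 := fG _ (clamp_ge0 k%:R (y j) ler01).
      by have := ler_normB (f (y j)) (f (clamp k%:R 1 (y j))); lra.
    have t1 := ty j; have t2 := yt j; have t3 := tS j.
    have [yk|ky] := ltP (y j) k%:R.
      apply: ler_pM => //.
      apply: (@le_trans _ _ (c1 j.+1 - c1 j)); last by rewrite lerDl.
      by rewrite /len /c1 t3; apply: clamp_left_crossing => //; apply: le_lt_trans t1 yk.
    have [yk1|yk1] := leP (y j) (k%:R + 1).
      rewrite clamp_mid// -{1}(subrK k%:R (y j)) periodic_natr ?subr_ge0//.
      by rewrite subrr normr0 mul0r mulr_ge0// addr_ge0.
    apply: ler_pM => //.
    apply: (@le_trans _ _ (c2 j.+1 - c2 j)); last by rewrite lerDr.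
    by rewrite /len /c2 t3; apply: clamp_right_crossing => //; rewrite -t3; apply: lt_le_trans yk1 t2.
  have h4 : \sum_(j < n) 2 * G * ((c1 j.+1 - c1 j) + (c2 j.+1 - c2 j)) <= 4 * G * D.
    rewrite -mulr_sumr big_split/=.
    rewrite -(big_mkord xpredT (fun j => c1 j.+1 - c1 j)) telescope_sumr//.
    rewrite -(big_mkord xpredT (fun j => c2 j.+1 - c2 j)) telescope_sumr//.
    have := clamp_leL k%:R D (t n); have := clamp_ge0 k%:R (t 0%N) (ltW D0).
    have := clamp_leL (k%:R + 1 - D) D (t n).
    have := clamp_ge0 (k%:R + 1 - D) (t 0%N) (ltW D0).
    rewrite -/(c1 n) -/(c2 n) -/(c1 0%N) -/(c2 0%N); nra.
  set S1 := \sum_(j < n) _ in h3 *; set S2 := \sum_(j < n) _ in h2 h3.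
  have : `|S1 - v| <= `|S1 - S2| + `|S2 - v|.
    by rewrite (_ : S1 - v = (S1 - S2) + (S2 - v)) ?ler_normD//; ring.
  lra.
have tot : `|\sum_(k < M) (\sum_(j < n) f (y j) * len k j - v)| <= M%:R * e.
  apply: le_trans (ler_norm_sum _ _ _) _.
  apply: (@le_trans _ _ (\sum_(k < M) e)).
    by apply: ler_sum => k _; apply: le_trans (period k (ltn_ord k)) _; lra.
  by rewrite sumr_const card_ord mulr_natl.
rewrite sumrB sumr_const card_ord -(mulr_natl v) exchange_big/= in tot.
pose mn j := Num.min M%:R (t j).
have lenE j : \sum_(k < M) f (y j) * len k j = f (y j) * (mn j.+1 - mn j).
  by rewrite -mulr_sumr sumrB !sum_clamp.
have sumE : \sum_(j < n) \sum_(k < M) f (y j) * len k j =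
    \sum_(j < n) f (y j) * (mn j.+1 - mn j).
  by apply: eq_bigr => j _; exact: lenE.
rewrite sumE in tot.
have rest : `|\sum_(j < n) D * f (y j) - \sum_(j < n) f (y j) * (mn j.+1 - mn j)| <= G.
  rewrite -sumrB; apply: le_trans (ler_norm_sum _ _ _) _.
  apply: (@le_trans _ _ (\sum_(j < n) G * ((t j.+1 - t j) - (mn j.+1 - mn j)))).
    apply: ler_sum => j _.
    rewrite (mulrC D) -mulrBr normrM; apply: ler_pM => //; first exact: fG.
    have := tS j; have := D0; rewrite /mn /Num.min => ? ?.
    by rewrite ger0_norm; split_ifs; lra.
  rewrite -mulr_sumr sumrB.
  rewrite -(big_mkord xpredT (fun j => t j.+1 - t j)) telescope_sumr//.
  rewrite -(big_mkord xpredT (fun j => mn j.+1 - mn j)) telescope_sumr//.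
  have -> : t 0%N = 0 by rewrite /t mul0r.
  have -> : mn 0%N = 0.
    have : 0 <= M%:R :> R by [].
    by rewrite /mn /t mul0r /Num.min => ?; split_ifs; lra.
  have -> : mn n = M%:R by rewrite /mn; apply/min_idPl.
  by rewrite !subr0 ler_piMr// lerBlDr addrC natr1 ltW.
have Mv : `|M%:R * v - t n * v| <= `|v|.
  rewrite -mulrBl normrM ler_piMl// distrC ger0_norm ?subr_ge0//.
  by rewrite lerBlDr addrC natr1 ltW.
rewrite -/(t n).
set S := \sum_(j < n) D * _ in rest *; set S' := \sum_(_ < n) _ in tot rest.
have : `|S - t n * v| <= `|S - S'| + (`|S' - M%:R * v| + `|M%:R * v - t n * v|).
  rewrite (_ : S - t n * v = (S - S') + ((S' - M%:R * v) + (M%:R * v - t n * v))); last by ring.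
  by rewrite (le_trans (ler_normD _ _))// lerD2l ler_normD.
have : M%:R * e <= t n * e by rewrite ler_wpM2r// ltW.
lra.
Qed.

End periodic_averages.

(** * Non-degeneracy of the Gram matrix *)

Section regression_algebra.
Context (R : realType).

Definition avg (n : nat) (f : nat -> R) : R := n%:R^-1 * \sum_(i < n) f i.

Lemma avgD n f g : avg n (fun i => f i + g i) = avg n f + avg n g.
Proof. by rewrite /avg big_split mulrDr. Qed.

Lemma avgZ n c f : avg n (fun i => c * f i) = c * avg n f.
Proof. by rewrite /avg -mulr_sumr mulrCA. Qed.

Lemma avgN n f : avg n (fun i => - f i) = - avg n f.
Proof. by rewrite /avg sumrN mulrN. Qed.

Lemma avg_sum n (I : finType) (f : I -> nat -> R) :
  avg n (fun i => \sum_l f l i) = \sum_l avg n (f l).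
Proof. by rewrite /avg exchange_big/= mulr_sumr. Qed.

Lemma ler_avg n f g : (forall i, (i < n)%N -> f i <= g i) -> avg n f <= avg n g.
Proof.
by move=> fg; rewrite ler_wpM2l ?invr_ge0//; apply: ler_sum => i _; exact: fg.
Qed.

Lemma avg_cst n c : (0 < n)%N -> avg n (fun=> c) = c.
Proof.
move=> n0; rewrite /avg sumr_const card_ord -(mulr_natl c) mulKf//.
by rewrite pnatr_eq0 -lt0n.
Qed.

Lemma avg_ge0 n f : (forall i, 0 <= f i) -> 0 <= avg n f.
Proof. by move=> f0; rewrite mulr_ge0 ?invr_ge0// sumr_ge0. Qed.

Variable p : nat.
Implicit Types (phi : 'I_p -> nat -> R).

Lemma sqr_sum_norm_le (v1 : 'I_p -> R) : (\sum_l `|v1 l|) ^+ 2 <= p%:R * \sum_l v1 l ^+ 2.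
Proof.
rewrite expr2 mulr_suml; under eq_bigr do rewrite mulr_sumr.
apply: (@le_trans _ _ (\sum_l \sum_m (v1 l ^+ 2 + v1 m ^+ 2) / 2)).
  apply: ler_sum => l _; apply: ler_sum => m _.
  rewrite -(real_normK (num_real (v1 l))) -(real_normK (num_real (v1 m))).
  by have := sqr_ge0 (`|v1 l| - `|v1 m|); nra.
rewrite le_eqVlt; apply/orP; left; apply/eqP.
set q := \sum_l v1 l ^+ 2.
have inner l : \sum_(m < p) (v1 l ^+ 2 + v1 m ^+ 2) / 2 = (p%:R * v1 l ^+ 2 + q) / 2.
  by rewrite -mulr_suml big_split/= sumr_const card_ord mulr_natl.
rewrite (eq_bigr _ (fun l _ => inner l)) -mulr_suml big_split/= -mulr_sumr -/q.
rewrite sumr_const card_ord -(mulr_natl q). lra.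
Qed.

(** No combination of the regressors phi and x = h + U + Z is small on average:
    the fluctuation U has non-degenerate energy and is nearly orthogonal to phi
    and to the bounded part h, the phi l are nearly orthonormal, and Z is
    negligible. *)
Lemma gram_lower_bound (H c0 eta : R) : 0 <= H -> 0 < c0 -> 0 < eta ->
  eta <= 1 / 2 -> eta <= c0 -> 8 * eta * H ^+ 2 <= c0 ->
  forall eps : R, 0 <= eps -> eps * p%:R <= 1 / 2 -> 4 * eps <= eta ->
    4 * eps * (p%:R + 4) <= c0 ->
  forall n phi (h U Z : nat -> R) (v1 : 'I_p -> R) (v2 : R), (0 < n)%N ->
    (forall l m, `|avg n (fun i => phi l i * phi m i) - (l == m)%:R| <= eps) ->
    (forall l, `|avg n (fun i => phi l i * U i)| <= eps) ->
    `|avg n (fun i => h i * U i)| <= eps ->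
    c0 <= avg n (fun i => U i ^+ 2) -> avg n (fun i => Z i ^+ 2) <= eps ->
    (forall i, `|h i| <= H) ->
    eta / 8 * (\sum_l v1 l ^+ 2 + v2 ^+ 2) <=
      avg n (fun i => (\sum_l phi l i * v1 l - (h i + U i + Z i) * v2) ^+ 2).
Proof.
move=> H0 c00 eta0 eta2 etac etaH eps eps0 epsp eps_eta eps_c0 n phi h U Z v1 v2 n0.
move=> phiphi phiU hU UU ZZ hH.
pose A i := \sum_l phi l i * v1 l.
set q1 := \sum_l v1 l ^+ 2.
have q10 : 0 <= q1 by apply: sumr_ge0 => l _; exact: sqr_ge0.
have v20 := sqr_ge0 v2.
(* (A - h v2)^2 keeps the fraction eta of A^2 at the cost of (h v2)^2, and the
   cross terms with U average out *)
have pointwise i : 1 / 2 * (eta * A i ^+ 2 - 2 * eta * H ^+ 2 * v2 ^+ 2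
    - 2 * v2 * (A i * U i) + 2 * v2 ^+ 2 * (h i * U i) + v2 ^+ 2 * U i ^+ 2)
    - v2 ^+ 2 * Z i ^+ 2 <= (A i - (h i + U i + Z i) * v2) ^+ 2.
  have h1 : h i ^+ 2 <= H ^+ 2.
    by rewrite -(real_normK (num_real (h i))) lerXn2r ?nnegrE.
  have h2 : eta * A i ^+ 2 - 2 * eta * (h i * v2) ^+ 2 <= (A i - h i * v2) ^+ 2.
    have : 0 <= (1 - eta) * (A i - h i * v2 / (1 - eta)) ^+ 2 by rewrite mulr_ge0 ?sqr_ge0//; lra.
    have e1 : 1 - eta != 0 by rewrite gt_eqF//; lra.
    have -> : (1 - eta) * (A i - h i * v2 / (1 - eta)) ^+ 2 =
      (1 - eta) * A i ^+ 2 - 2 * A i * (h i * v2) + (h i * v2) ^+ 2 / (1 - eta).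
      by field.
    have : (h i * v2) ^+ 2 / (1 - eta) <= (h i * v2) ^+ 2 * (1 + 2 * eta).
      rewrite ler_wpM2l ?sqr_ge0// -[_^-1]mul1r ler_pdivrMr; nra.
    nra.
  have h3 : eta * (h i ^+ 2 * v2 ^+ 2) <= eta * (H ^+ 2 * v2 ^+ 2).
    by rewrite ler_wpM2l ?(ltW eta0)// ler_wpM2r.
  have h4 := sqr_ge0 (A i - h i * v2 - U i * v2 - 2 * (Z i * v2)).
  nra.
have := @ler_avg n _ _ (fun i _ => pointwise i).
have -> : avg n (fun i => 1 / 2 * (eta * A i ^+ 2 - 2 * eta * H ^+ 2 * v2 ^+ 2
    - 2 * v2 * (A i * U i) + 2 * v2 ^+ 2 * (h i * U i) + v2 ^+ 2 * U i ^+ 2)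
    - v2 ^+ 2 * Z i ^+ 2) =
  1 / 2 * (eta * avg n (fun i => A i ^+ 2) - 2 * eta * H ^+ 2 * v2 ^+ 2
    - 2 * v2 * avg n (fun i => A i * U i) + 2 * v2 ^+ 2 * avg n (fun i => h i * U i)
    + v2 ^+ 2 * avg n (fun i => U i ^+ 2)) - v2 ^+ 2 * avg n (fun i => Z i ^+ 2).
  by rewrite avgD avgN !avgZ !avgD !avgN (avg_cst _ n0) !avgZ.
set AA := avg n (fun i => A i ^+ 2); set AU := avg n (fun i => A i * U i).
set HU := avg n (fun i => h i * U i) in hU *.
set UU' := avg n (fun i => U i ^+ 2) in UU *.
set ZZ' := avg n (fun i => Z i ^+ 2) in ZZ *.
pose s1 := \sum_l `|v1 l|.
have s10 : 0 <= s1 by apply: sumr_ge0.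
have s1q : s1 ^+ 2 <= p%:R * q1 := sqr_sum_norm_le v1.
have AAE : q1 - eps * s1 ^+ 2 <= AA.
  have -> : AA = \sum_l \sum_m v1 l * v1 m * avg n (fun i => phi l i * phi m i).
    rewrite /AA; under [RHS]eq_bigr do under eq_bigr do rewrite -avgZ.
    under [RHS]eq_bigr do rewrite -avg_sum.
    rewrite -avg_sum; congr avg; apply/funext => i.
    rewrite /A expr2 mulr_suml; apply: eq_bigr => l _; rewrite mulr_sumr.
    by apply: eq_bigr => m _; ring.
  rewrite lerBlDl.
  have -> : q1 = \sum_l \sum_m v1 l * v1 m * (l == m)%:R.
    apply: eq_bigr => l _; rewrite (bigD1 l)//= eqxx mulr1 big1 ?addr0 ?expr2//.
    by move=> m ml; rewrite eq_sym (negbTE ml) mulr0.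
  rewrite -lerBlDr -sumrB expr2 /s1 mulr_suml mulr_sumr.
  apply: ler_sum => l _; rewrite -sumrB mulr_sumr mulr_sumr; apply: ler_sum => m _.
  rewrite -mulrBr; apply: le_trans (ler_norm _) _.
  rewrite normrM distrC normrM mulrC ler_wpM2r ?mulr_ge0//.
have AUE : `|AU| <= eps * s1.
  have -> : AU = \sum_l v1 l * avg n (fun i => phi l i * U i).
    rewrite /AU; under [RHS]eq_bigr do rewrite -avgZ.
    rewrite -avg_sum; congr avg; apply/funext => i.
    by rewrite /A mulr_suml; apply: eq_bigr => l _; ring.
  apply: le_trans (ler_norm_sum _ _ _) _; rewrite mulr_sumr; apply: ler_sum => l _.
  by rewrite normrM mulrC ler_wpM2r.
have AUv : 2 * v2 * AU <= eps * (p%:R * v2 ^+ 2 + q1).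
  have : 2 * v2 * AU <= 2 * `|v2| * (eps * s1).
    apply: le_trans (ler_norm _) _.
    rewrite (normrM (2 * v2)) (normrM 2) normr_nat.
    by apply: ler_wpM2l => //; apply: mulr_ge0.
  have : 2 * `|v2| * s1 <= p%:R * v2 ^+ 2 + q1.
    have -> : p%:R * v2 ^+ 2 + q1 = \sum_l (v2 ^+ 2 + v1 l ^+ 2).
      by rewrite big_split/= sumr_const card_ord mulr_natl.
    rewrite mulr_sumr; apply: ler_sum => l _.
    rewrite -(real_normK (num_real (v1 l))) -(real_normK (num_real v2)).
    by have := sqr_ge0 (`|v1 l| - `|v2|); nra.
  move=> e1 e2; apply: le_trans e2 _.
  by rewrite mulrCA; apply: ler_wpM2l.
have AA2 : q1 / 2 <= AA.
  have : eps * s1 ^+ 2 <= eps * (p%:R * q1) by rewrite ler_wpM2l.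
  have : eps * p%:R * q1 <= 1 / 2 * q1 by rewrite ler_wpM2r.
  by rewrite mulrA; lra.
move=> main; apply: le_trans main.
have t1 : eta * (q1 / 2) <= eta * AA by rewrite ler_wpM2l// ltW.
have t2 : v2 ^+ 2 * c0 <= v2 ^+ 2 * UU' by rewrite ler_wpM2l.
have t3 : v2 ^+ 2 * ZZ' <= v2 ^+ 2 * eps by rewrite ler_wpM2l.
have t4 : v2 ^+ 2 * - eps <= v2 ^+ 2 * HU.
  by rewrite ler_wpM2l//; move: hU; rewrite ler_norml => /andP[].
have t5 : 8 * eta * H ^+ 2 * v2 ^+ 2 <= c0 * v2 ^+ 2 by rewrite ler_wpM2r.
have t6 : 4 * eps * (p%:R + 4) * v2 ^+ 2 <= c0 * v2 ^+ 2 by rewrite ler_wpM2r.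
have t7 : 4 * eps * q1 <= eta * q1 by rewrite ler_wpM2r.
have t8 : eta * v2 ^+ 2 <= c0 * v2 ^+ 2 by rewrite ler_wpM2r.
have t9 : 0 <= c0 * v2 ^+ 2 by rewrite mulr_ge0// ltW.
lra.
Qed.

End regression_algebra.

(** * The least squares error *)

Section least_squares.
Context (R : realType) (p : nat) (phi : R -> 'cV[R]_p).
Variables (D : R) (D_gt0 : 0 < D) (x : R -> R).
Implicit Types (v : 'cV[R]_(p + 1)).

(** The fitted drift at time t_i. *)
Definition regressor v (i : nat) : R :=
  \sum_l phi (grid D i) l 0 * mu_of v l 0 - x (grid D i) * a_of v.

Definition drift_residual v (i : nat) : R :=
  (x (grid D i.+1) - x (grid D i)) / D - regressor v i.

Lemma Zobs_dot v i :
  ((Zobs phi D x i.+1)^T *m v) 0 0 = Num.sqrt D * regressor v i.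
Proof.
rewrite /Zobs linearZ/= -scalemxAl mxE; congr (_ * _).
rewrite tr_col_mx tr_scalar_mx -[v in LHS]vsubmxK mul_row_col mxE; congr (_ + _).
  by rewrite mxE; apply: eq_bigr => l _; rewrite mxE.
by rewrite mul_scalar_mx mxE mulNr.
Qed.

Lemma Yobs_sub_dot v i :
  Yobs D x i.+1 - ((Zobs phi D x i.+1)^T *m v) 0 0 =
  Num.sqrt D * drift_residual v i.
Proof.
have sD : Num.sqrt D != 0 by rewrite gt_eqF// sqrtr_gt0.
rewrite Zobs_dot /drift_residual [RHS]mulrBr /Yobs; congr (_ + _).
have -> (y : R) : Num.sqrt D * (y / D) = y / Num.sqrt D => //.
rewrite -[X in _ / X](sqr_sqrtr (ltW D_gt0)); field.
by rewrite sD.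
Qed.

Lemma Zmat_mul (N : nat) v (i : 'I_N) : (Zmat phi D x N *m v) i 0 = Num.sqrt D * regressor v i.
Proof.
rewrite -Zobs_dot !mxE; apply: eq_bigr => j _; congr (_ * _).
by rewrite mxE.
Qed.

Definition sqr_norm v : R := \sum_l mu_of v l 0 ^+ 2 + a_of v ^+ 2.

Lemma sqr_norm_eq0 v : sqr_norm v <= 0 -> v = 0.
Proof.
move=> v0.
have s0 : 0 <= \sum_l mu_of v l 0 ^+ 2 by apply: sumr_ge0 => l _; exact: sqr_ge0.
have a0 := sqr_ge0 (a_of v).
have aE : a_of v = 0 by apply/eqP; rewrite -sqrf_eq0; apply/eqP; move: v0; rewrite /sqr_norm; lra.
have sE : \sum_l mu_of v l 0 ^+ 2 == 0 by apply/eqP; move: v0; rewrite /sqr_norm; lra.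
rewrite psumr_eq0 in sE; last by move=> l _; exact: sqr_ge0.
rewrite -[v]vsubmxK; apply/matrixP => i j; rewrite ord1 {j} !mxE.
case: splitP => k _; last by rewrite ord1 -/(a_of v) aE.
by have /allP/(_ k (mem_index_enum _)) := sE; rewrite /= sqrf_eq0 => /eqP.
Qed.

(** By the normal equations, the mean square of the regression function at
    u = theta_hat - theta is its correlation with the drift residuals at theta.
    The left side is at least c |u|^2, and the right side at most
    c/2 |u|^2 + (p + 1) eps^2 / (2 c). *)
Lemma least_squares_error (N : nat) (c eps : R) (theta : 'cV[R]_(p + 1)) :
  (0 < N)%N -> 0 < c -> 0 <= eps ->
  (forall v, c * sqr_norm v <= avg N (fun i => regressor v i ^+ 2)) ->
  (forall l, `|avg N (fun i => phi (grid D i) l 0 * drift_residual theta i)| <= eps) ->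
  `|avg N (fun i => x (grid D i) * drift_residual theta i)| <= eps ->
  sqr_norm (theta_hat phi D x N - theta) <= (p%:R + 1) * eps ^+ 2 / c ^+ 2.
Proof.
move=> N0 c0 eps0 low phie xe.
pose Z := Zmat phi D x N; pose A := Z^T *m Z.
have NR : N%:R != 0 :> R by rewrite pnatr_eq0 -lt0n.
have sD2 : Num.sqrt D ^+ 2 = D by rewrite sqr_sqrtr// ltW.
have quad v : (v^T *m A *m v) 0 0 = D * (N%:R * avg N (fun i => regressor v i ^+ 2)).
  rewrite /A mulmxA -trmx_mul -mulmxA mxE /avg mulVKf// mulr_sumr.
  apply: eq_bigr => i _; rewrite mxE Zmat_mul -{3}sD2; ring.
have Aunit : A \in unitmx.
  rewrite -row_free_unit; apply: inj_row_free => r rA.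
  apply: trmx_inj; rewrite trmx0; apply: sqr_norm_eq0.
  have := low r^T; have := quad r^T; rewrite trmxK rA mul0mx mxE.
  move=> /esym/eqP; rewrite mulf_eq0 gt_eqF//= mulf_eq0 (negbTE NR)/= => /eqP ->.
  by rewrite pmulr_rle0.
set u := theta_hat phi D x N - theta.
have Au : A *m u = Z^T *m (Yvec D x N - Z *m theta).
  by rewrite /u !mulmxBr /theta_hat -/Z -/A !mulmxA mulmxV// mul1mx.
have key : avg N (fun i => regressor u i ^+ 2) =
    avg N (fun i => regressor u i * drift_residual theta i).
  have := quad u; rewrite -mulmxA Au mulmxA -trmx_mul mxE => e.
  apply: (mulfI NR); apply: (mulfI (lt0r_neq0 D_gt0)); rewrite -e.
  rewrite /avg mulVKf// mulr_sumr; apply: eq_bigr => i _.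
  rewrite mxE Zmat_mul.
  have -> : (Yvec D x N - Z *m theta) i 0 = Yobs D x i.+1 - (Z *m theta) i 0.
    by rewrite [LHS]mxE [Yvec D x N i 0]mxE [(- (Z *m theta)) i 0]mxE.
  by rewrite Zmat_mul -(Zobs_dot theta) Yobs_sub_dot mulrACA -expr2 sD2.
have split_avg : avg N (fun i => regressor u i * drift_residual theta i) =
   \sum_l mu_of u l 0 * avg N (fun i => phi (grid D i) l 0 * drift_residual theta i) -
   a_of u * avg N (fun i => x (grid D i) * drift_residual theta i).
  have -> : \sum_l mu_of u l 0 * avg N (fun i => phi (grid D i) l 0 * drift_residual theta i) =
      avg N (fun i => \sum_l mu_of u l 0 * (phi (grid D i) l 0 * drift_residual theta i)).
    rewrite (avg_sum N (fun (l : 'I_p) k =>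
      mu_of u l 0 * (phi (grid D k) l 0 * drift_residual theta k))).
    by apply: eq_bigr => l _; exact: esym (avgZ _ _ _).
  rewrite -avgZ -avgN -avgD; congr avg; apply/funext => k.
  rewrite /regressor mulrBl mulr_suml; congr (_ + _); last by ring.
  by apply: eq_bigr => l _; ring.
have := low u; rewrite key split_avg => h.
have term (b e : R) : `|e| <= eps -> b * e <= c / 2 * b ^+ 2 + eps ^+ 2 / (2 * c).
  move=> ee.
  have : b * e <= `|b| * eps.
    by rewrite (le_trans (ler_norm _))// normrM ler_wpM2l.
  have : `|b| * eps <= c / 2 * b ^+ 2 + eps ^+ 2 / (2 * c).
    have : 0 <= c / 2 * (`|b| - eps / c) ^+ 2 by rewrite mulr_ge0 ?sqr_ge0// ltW// divr_gt0.
    rewrite -(real_normK (num_real b)).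
    have -> : c / 2 * (`|b| - eps / c) ^+ 2 =
      c / 2 * `|b| ^+ 2 - `|b| * eps + eps ^+ 2 / (2 * c) by field; rewrite gt_eqF.
    lra.
  lra.
have h1 : \sum_l mu_of u l 0 * avg N (fun i => phi (grid D i) l 0 * drift_residual theta i)
    <= c / 2 * (\sum_l mu_of u l 0 ^+ 2) + p%:R * (eps ^+ 2 / (2 * c)).
  have -> : c / 2 * (\sum_l mu_of u l 0 ^+ 2) + p%:R * (eps ^+ 2 / (2 * c)) =
     \sum_l (c / 2 * mu_of u l 0 ^+ 2 + eps ^+ 2 / (2 * c)).
    by rewrite big_split/= mulr_sumr sumr_const card_ord (mulr_natl (_ / _)).
  by apply: ler_sum => l _; exact: term.
have h2 : - a_of u * avg N (fun i => x (grid D i) * drift_residual theta i)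
    <= c / 2 * a_of u ^+ 2 + eps ^+ 2 / (2 * c).
  by rewrite mulNr -mulrN; apply: term; rewrite normrN.
have h3 : c / 2 * sqr_norm u <= (p%:R + 1) * (eps ^+ 2 / (2 * c)).
  by move: h h1 h2; rewrite /sqr_norm mulNr; lra.
rewrite -(ler_pM2l (divr_gt0 c0 (ltr0n R 2))).
apply: le_trans h3 _; rewrite le_eqVlt; apply/orP; left; apply/eqP; field.
by rewrite gt_eqF.
Qed.

(** The observations telescope, which leaves a path increment and the fitted
    drift. *)
Lemma sqrt_mesh_Qhat (N K : nat) :
  Num.sqrt D * Qhat phi D x N K =
  x (grid D (N + K)) - x (grid D N) -
  D * \sum_(N <= i < N + K) regressor (theta_hat phi D x N) i.
Proof.
rewrite /Qhat big_add1 succnK mulr_sumr.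
have step i : Num.sqrt D * residual phi D x N i.+1 =
   (x (grid D i.+1) - x (grid D i)) - D * regressor (theta_hat phi D x N) i.
  rewrite /residual Yobs_sub_dot mulrA -expr2 sqr_sqrtr ?(ltW D_gt0)//.
  by rewrite /drift_residual; field; rewrite gt_eqF.
rewrite (eq_bigr _ (fun i _ => step i)).
by rewrite sumrB (telescope_sumr (fun i => x (grid D i))) ?leq_addr// mulr_sumr.
Qed.

End least_squares.

(** * Second moments along the Euler scheme *)

(** [mulr_ge0] is kept for last: unification sees x ^+ 2 as a product. *)
Ltac nonneg := repeat first [ done | exact: sqr_ge0 | exact: normr_ge0
  | (apply: ltW; assumption) | apply: exprn_ge0 | apply: divr_ge0
  | apply: addr_ge0 | apply: mulr_ge0 ].

Lemma absmean_le_sqrD d (T : measurableType d) (R : realType)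
    (P : probability T R) (f g : T -> R) (c e : R) :
  measurable_fun setT f -> measurable_fun setT g ->
  absmean_le P (fun w => f w ^+ 2) c -> absmean_le P (fun w => g w ^+ 2) e ->
  absmean_le P (fun w => (f w + g w) ^+ 2) (2 * c + 2 * e).
Proof.
move=> mf mg fc ge; have := absmean_leD (absmean_leZ 2 fc) (absmean_leZ 2 ge).
rewrite normr_nat; apply: absmean_le_dom.
  by apply: measurable_funX; exact: measurable_funD.
move=> w; rewrite ger0_norm ?sqr_ge0// ger0_norm; last first.
  by rewrite addr_ge0// mulr_ge0// sqr_ge0.
by have := sqr_ge0 (f w - g w); nra.
Qed.

(** The Cauchy-Schwarz inequality in its parametric form |f g| <= l f^2 + g^2 / l. *)
Lemma absmean_le_prod d (T : measurableType d) (R : realType)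
    (P : probability T R) (f g : T -> R) (c e l : R) : 0 < l ->
  measurable_fun setT f -> measurable_fun setT g ->
  absmean_le P (fun w => f w ^+ 2) c -> absmean_le P (fun w => g w ^+ 2) e ->
  absmean_le P (fun w => f w * g w) (l * c + e / l).
Proof.
move=> l0 mf mg fc ge.
have := absmean_leD (absmean_leZ l fc) (absmean_leZ l^-1 ge).
rewrite (gtr0_norm l0) ger0_norm ?invr_ge0 ?(ltW l0)// (mulrC l^-1 e).
apply: absmean_le_dom; first exact: measurable_funM.
have il0 : 0 <= l^-1 by rewrite invr_ge0 ltW.
move=> w; rewrite normrM [leRHS]ger0_norm; last by nonneg.
rewrite -(real_normK (num_real (f w))) -(real_normK (num_real (g w))).
have h : 0 <= l * (`|f w| - `|g w| / (2 * l)) ^+ 2 by nonneg.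
have e1 : l * (`|f w| - `|g w| / (2 * l)) ^+ 2 =
  l * `|f w| ^+ 2 - `|f w| * `|g w| + l^-1 * `|g w| ^+ 2 / 4.
  by field; rewrite gt_eqF.
have h2 : 0 <= l^-1 * `|g w| ^+ 2 by nonneg.
lra.
Qed.

Lemma absmean_le_sum_ord d (T : measurableType d) (R : realType)
    (P : probability T R) n (f : nat -> T -> R) (c : R) :
  (forall i, absmean_le P (f i) c) ->
  absmean_le P (fun w => \sum_(i < n) f i w) (n%:R * c).
Proof.
move=> fc; have := @absmean_le_sum _ _ _ P _ (index_enum 'I_n)
  (fun i : 'I_n => f i) (fun _ => c) (fun i => fc i).
by rewrite sumr_const card_ord (mulr_natl c).
Qed.

Lemma ler_sum_ord (R : realType) n (F : nat -> R) (c : R) :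
  (forall i, (i < n)%N -> F i <= c) -> \sum_(i < n) F i <= n%:R * c.
Proof.
move=> Fc; apply: (@le_trans _ _ (\sum_(i < n) c)).
  by apply: ler_sum => i _; exact: Fc.
by rewrite sumr_const card_ord mulr_natl.
Qed.

Lemma absmean_le_norm d (T : measurableType d) (R : realType)
    (P : probability T R) (f : T -> R) (c : R) :
  absmean_le P f c -> absmean_le P (fun w => `|f w|) c.
Proof.
move=> fc; apply: absmean_le_dom (fc).
  by apply: measurableT_comp => //; case: fc.
by move=> w; rewrite normr_id.
Qed.

Section euler_scheme.
Context d (Omega : measurableType d) (R : realType) (P : probability Omega R).
Variables (B : R -> {RV P >-> R}) (D : R).
Hypotheses (B_BM : brownian_motion B) (D_gt0 : 0 < D) (D_le1 : D <= 1).
Variables (a_ f_ : nat -> R) (sigma am aM C m0 : R).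
Hypotheses (am_gt0 : 0 < am) (a_ge : forall i, am <= a_ i)
  (a_le : forall i, a_ i <= aM) (aMD : aM * D <= 1 / 2)
  (D_small : 64 * aM ^+ 4 * D ^+ 2 <= am ^+ 2)
  (C_ge0 : 0 <= C) (f_le : forall i, `|f_ i| <= D * C).
Variables (X q : nat -> Omega -> R).
Hypotheses (mX : forall i, measurable_fun setT (X i))
  (X0_sqr : absmean_le P (fun w => X 0%N w ^+ 2) m0)
  (q_mean : forall i, absmean_le P (q i) (8 * D ^+ 3)).

Local Notation xi := (bincr B D).

Definition euler_error (i : nat) (w : Omega) : R :=
  X i.+1 w - (X i w + f_ i - a_ i * D * X i w + sigma * xi i w).

Hypothesis error_ae : {ae P, forall w, forall i, euler_error i w ^+ 2 <=
  16 * aM ^+ 2 * D ^+ 4 * (C ^+ 2 + aM ^+ 2 * X i w ^+ 2) +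
  8 * aM ^+ 2 * sigma ^+ 2 * q i w}.

(** The linear scheme splits over its inputs: signal is driven by the drifts f_,
    noise by the Brownian increments, decay carries the initial value, and the
    remainder is driven by the errors of the scheme. *)
Fixpoint signal (i : nat) : R :=
  if i is k.+1 then (1 - a_ k * D) * signal k + f_ k else 0.

Fixpoint noise (i : nat) (w : Omega) : R :=
  if i is k.+1 then (1 - a_ k * D) * noise k w + sigma * xi k w else 0.

Fixpoint decay (i : nat) : R :=
  if i is k.+1 then (1 - a_ k * D) * decay k else 1.

Definition remainder (i : nat) (w : Omega) : R :=
  X i w - signal i - noise i w - decay i * X 0%N w.

Let amD0 : 0 < am * D. Proof. exact: mulr_gt0. Qed.

Let rho_ge0 i : 0 <= 1 - a_ i * D.
Proof.
have : a_ i * D <= aM * D by rewrite ler_wpM2r// ltW.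
by move: aMD; lra.
Qed.

Let rho_le i : 1 - a_ i * D <= 1 - am * D.
Proof. by rewrite lerD2l lerN2 ler_wpM2r// ltW. Qed.

Let amaM : am <= aM. Proof. exact: le_trans (a_ge 0) (a_le 0). Qed.

Let amD1 : am * D <= 1 / 2.
Proof. by apply: le_trans aMD; rewrite ler_wpM2r// ltW. Qed.

Lemma signal_le i : `|signal i| <= C / am.
Proof.
elim: i => [|i IH] /=; first by rewrite normr0 divr_ge0// ltW.
apply: le_trans (ler_normD _ _) _; rewrite normrM ger0_norm//.
apply: (@le_trans _ _ ((1 - am * D) * (C / am) + D * C)).
  by apply: lerD => //; apply: ler_pM.
by rewrite le_eqVlt; apply/orP; left; apply/eqP; field; rewrite gt_eqF.
Qed.

Lemma decay_itv i : 0 <= decay i <= 1.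
Proof.
elim: i => [|i /andP[d0 d1]] /=; first by rewrite ler01 lexx.
rewrite mulr_ge0//= (le_trans (ler_piMr (rho_ge0 i) d1))//.
by rewrite (le_trans (rho_le i))// lerBlDr lerDl ltW.
Qed.

Lemma sum_decay_sqr n : \sum_(i < n) decay i ^+ 2 <= (am * D)^-1.
Proof.
suff h : \sum_(i < n) decay i ^+ 2 <= (1 - decay n ^+ 2) / (am * D).
  apply: le_trans h _; rewrite -[leRHS]mul1r ler_wpM2r ?invr_ge0 ?(ltW amD0)//.
  by rewrite lerBlDr lerDl sqr_ge0.
elim: n => [|n IH]; first by rewrite big_ord0 /= expr1n subrr mul0r.
rewrite big_ord_recr/=; apply: le_trans (lerD IH (lexx _)) _.
rewrite -lerBrDl -mulrBl ler_pdivlMr// exprMn.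
have h : (1 - a_ n * D) ^+ 2 <= 1 - am * D.
  apply: (@le_trans _ _ (1 - a_ n * D)); last exact: rho_le.
  rewrite expr2 ler_piMr//; apply: le_trans (rho_le n) _.
  by rewrite lerBlDr lerDl ltW.
by have := ler_wpM2r (sqr_ge0 (decay n)) h; lra.
Qed.

Lemma measurable_noise i : measurable_fun setT (noise i).
Proof.
elim: i => [|i IH] /=; first exact: measurable_cst.
apply: measurable_funD; first exact: measurable_funM.
by apply: measurable_funM => //; exact: measurable_bincr.
Qed.

Lemma adapted_noise i : adapted xi i (noise i).
Proof.
elim: i => [|i IH] /=; first exact: adapted_cst.
apply: adaptedD.
  by apply: adaptedM; [exact: adapted_cst|exact: adaptedW IH].
by apply: adaptedM; [exact: adapted_cst|exact: adapted_xi].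
Qed.

Lemma measurable_remainder i : measurable_fun setT (remainder i).
Proof.
apply: measurable_funB; last exact: measurable_funM.
by apply: measurable_funB; [exact: measurable_funB|exact: measurable_noise].
Qed.

Lemma measurable_euler_error i : measurable_fun setT (euler_error i).
Proof.
apply: measurable_funB => //; apply: measurable_funD.
  by apply: measurable_funB; [exact: measurable_funD|exact: measurable_funM].
by apply: measurable_funM => //; exact: measurable_bincr.
Qed.

Lemma remainderS i w :
  remainder i.+1 w = (1 - a_ i * D) * remainder i w + euler_error i w.
Proof. by rewrite /remainder /euler_error/=; ring. Qed.

Lemma remainder0 w : remainder 0 w = 0.
Proof. by rewrite /remainder/=; ring. Qed.

Definition noise_var : R := 8 * sigma ^+ 2 / am.

(** The variance obeys v' <= (1 - am D) v + 8 sigma^2 D, with fixed point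
    noise_var. *)
Lemma noise_second_moment i : absmean_le P (fun w => noise i w ^+ 2) noise_var.
Proof.
have nv0 : 0 <= noise_var by rewrite /noise_var; nonneg.
elim: i => [|i IH].
  have := absmean_le_cst P (0 : R); rewrite normr0 => /(absmean_leW nv0).
  rewrite (_ : (fun w => _) = cst 0)//.
  by apply/funext => w; rewrite /= expr0n.
pose M w := (1 - a_ i * D) * noise i w.
have aM' : adapted xi i M by apply: adaptedM; [exact: adapted_cst|exact: adapted_noise].
have indep F : adapted xi i F -> forall A E : set R, measurable A -> measurable E ->
    P (F @^-1` A `&` xi i @^-1` E) = (P (F @^-1` A) * P (xi i @^-1` E))%E.
  move=> aF A E mA mE; apply: (@adapted_indep _ _ _ P xi) => //.
  - exact: measurable_bincr.
  - exact: bincr_indep.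
have := @absmean_le_sqr_step _ _ _ P M (cst sigma) (xi i)
  ((1 - am * D) * noise_var) (sigma ^+ 2) (8 * D).
have -> : (fun w => (M w + cst sigma w * xi i w) ^+ 2) = (fun w => noise i.+1 w ^+ 2) by [].
move=> h; apply: absmean_leW (h _ _ _ _ _ _ _ _ _).
- rewrite /noise_var le_eqVlt; apply/orP; left; apply/eqP; field.
  by rewrite gt_eqF.
- by apply: measurable_funM => //; exact: measurable_noise.
- exact: measurable_cst.
- exact: measurable_bincr.
- by apply: indep; apply: adaptedM => //; exact: adapted_cst.
- by apply: indep; exact: adapted_cst.
- apply: absmean_leW; last first.
    have := absmean_leZ ((1 - a_ i * D) ^+ 2) IH.
    apply: absmean_le_dom.
      by apply: measurable_funX; apply: measurable_funM => //; exact: measurable_noise.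
    by move=> w; rewrite /M exprMn.
  rewrite ger0_norm ?sqr_ge0// ler_wpM2r//.
  rewrite expr2; apply: le_trans (rho_le i); rewrite ler_piMr//.
  by apply: le_trans (rho_le i) _; rewrite lerBlDr lerDl ltW.
- by have := absmean_le_cst P (sigma ^+ 2); rewrite ger0_norm ?sqr_ge0.
- exact: bincr_second_moment.
- exact: bincr_mean0.
Qed.

Definition main_var : R := 4 * (C / am) ^+ 2 + 4 * noise_var + 2 * m0.

Lemma main_second_moment i :
  absmean_le P (fun w => (X i w - remainder i w) ^+ 2) main_var.
Proof.
have h1 : absmean_le P (fun w => signal i ^+ 2) ((C / am) ^+ 2).
  have := absmean_le_cst P (signal i ^+ 2); apply: absmean_leW.
  rewrite ger0_norm ?sqr_ge0// -(real_normK (num_real (signal i))).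
  by rewrite lerXn2r ?nnegrE// ?signal_le// divr_ge0// ltW.
have h2 := absmean_le_sqrD (@measurable_cst _ _ _ _ setT (signal i))
  (measurable_noise i) h1 (noise_second_moment i).
have h3 : absmean_le P (fun w => (decay i * X 0%N w) ^+ 2) m0.
  apply: absmean_le_dom X0_sqr.
    by apply: measurable_funX; exact: measurable_funM.
  move=> w; rewrite exprMn normrM ler_piMl//.
  have /andP[d0 d1] := decay_itv i.
  by rewrite ger0_norm ?sqr_ge0// expr_le1.
have ms : measurable_fun setT (fun w => signal i + noise i w).
  by apply: measurable_funD => //; exact: measurable_noise.
have := absmean_le_sqrD ms _ h2 h3.
have -> : (fun w => (signal i + noise i w + decay i * X 0%N w) ^+ 2) =
          (fun w => (X i w - remainder i w) ^+ 2).
  by apply/funext => w; congr (_ ^+ 2); rewrite /remainder; ring.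
move=> h; apply: absmean_leW (h _).
  by rewrite /main_var; lra.
exact: measurable_funM.
Qed.

Definition remainder_var : R :=
  2 * (16 * aM ^+ 2 * (C ^+ 2 + 2 * aM ^+ 2 * main_var) + 64 * aM ^+ 2 * sigma ^+ 2)
    / am ^+ 2.

(** The error at step i depends on X i, hence on the remainder itself. By
    convexity W'^2 <= (1 - am D) W^2 + e^2 / (am D), and the part of e^2 that is
    quadratic in W, of order D^4 W^2, is absorbed by half of the contraction. *)
Lemma remainder_second_moment i :
  absmean_le P (fun w => remainder i w ^+ 2) (remainder_var * D).
Proof.
have mv0 : 0 <= main_var := absmean_le_ge0 (main_second_moment 0).
set c1 := 16 * aM ^+ 2 * (C ^+ 2 + 2 * aM ^+ 2 * main_var) + 64 * aM ^+ 2 * sigma ^+ 2.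
have c10 : 0 <= c1.
  by rewrite /c1; nonneg.
have rv0 : 0 <= remainder_var * D.
  by rewrite /remainder_var -/c1; nonneg.
elim: i => [|i IH].
  have := absmean_le_cst P (0 : R); rewrite normr0 => /(absmean_leW rv0).
  rewrite (_ : (fun w => _) = cst 0)//.
  by apply/funext => w; rewrite remainder0 expr0n.
have mV := main_second_moment i.
have bracket : absmean_le P (fun w => 16 * aM ^+ 2 * D ^+ 4 *
    (C ^+ 2 + 2 * aM ^+ 2 * (X i w - remainder i w) ^+ 2) +
    8 * aM ^+ 2 * sigma ^+ 2 * q i w) (D ^+ 3 * c1).
  have h1 := absmean_leD (absmean_le_cst P (C ^+ 2)) (absmean_leZ (2 * aM ^+ 2) mV).
  have h2 := absmean_leD (absmean_leZ (16 * aM ^+ 2 * D ^+ 4) h1)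
    (absmean_leZ (8 * aM ^+ 2 * sigma ^+ 2) (q_mean i)).
  apply: absmean_leW h2.
  rewrite !ger0_norm; [|nonneg..].
  have : 16 * aM ^+ 2 * D ^+ 4 * (C ^+ 2 + 2 * aM ^+ 2 * main_var) <=
         16 * aM ^+ 2 * D ^+ 3 * (C ^+ 2 + 2 * aM ^+ 2 * main_var).
    apply: ler_wpM2r; first by nonneg.
    apply: ler_wpM2l; first by nonneg.
    by rewrite (exprS D 3) ler_piMl//; nonneg.
  by rewrite /c1; lra.
have := absmean_leD (absmean_leZ (1 - am * D / 2) IH) (absmean_leZ (am * D)^-1 bracket).
move=> h; apply: absmean_leW (absmean_le_ae _ _ h).
- rewrite ger0_norm; last by move: amD1; lra.
  rewrite ger0_norm ?invr_ge0 ?(ltW amD0)//.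
  rewrite /remainder_var -/c1 le_eqVlt; apply/orP; left; apply/eqP; field.
  by rewrite !gt_eqF.
- by apply: measurable_funX; exact: measurable_remainder.
apply: filterS error_ae => w /(_ i) err.
rewrite ger0_norm ?sqr_ge0//; apply: le_trans (ler_norm _); rewrite remainderS.
set W := remainder i w in err *; set r := euler_error i w in err *.
have convex : ((1 - a_ i * D) * W + r) ^+ 2 <= (1 - am * D) * W ^+ 2 + r ^+ 2 / (am * D).
  have h2 : `|(1 - a_ i * D) * W + r| <= (1 - am * D) * `|W| + `|r|.
    apply: le_trans (ler_normD _ _) _; rewrite lerD2r normrM ler_wpM2r//.
    by rewrite ger0_norm.
  have h3 : ((1 - am * D) * `|W| + `|r|) ^+ 2 <= (1 - am * D) * W ^+ 2 + r ^+ 2 / (am * D).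
    rewrite -(real_normK (num_real W)) -(real_normK (num_real r)).
    have h4 : 0 <= (1 - am * D) / (am * D) * (`|W| * (am * D) - `|r|) ^+ 2.
      apply: mulr_ge0; last exact: sqr_ge0.
      by apply: divr_ge0; [move: amD1; lra|exact: ltW].
    have : (1 - am * D) * `|W| ^+ 2 + `|r| ^+ 2 / (am * D) - ((1 - am * D) * `|W| + `|r|) ^+ 2 =
      (1 - am * D) / (am * D) * (`|W| * (am * D) - `|r|) ^+ 2.
      by field; rewrite !gt_eqF.
    lra.
  apply: le_trans h3; rewrite -(real_normK (num_real (_ + r))).
  by rewrite lerXn2r ?nnegrE// (le_trans _ h2).
apply: le_trans convex _.
have X2 : X i w ^+ 2 <= 2 * (X i w - W) ^+ 2 + 2 * W ^+ 2.
  by have := sqr_ge0 (X i w - 2 * W); nra.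
have err2 : r ^+ 2 <= 32 * aM ^+ 4 * D ^+ 4 * W ^+ 2 +
   (16 * aM ^+ 2 * D ^+ 4 * (C ^+ 2 + 2 * aM ^+ 2 * (X i w - W) ^+ 2) +
    8 * aM ^+ 2 * sigma ^+ 2 * q i w).
  apply: le_trans err _.
  have k0 : 0 <= 16 * aM ^+ 4 * D ^+ 4.
    by nonneg; exact: le_trans (ltW am_gt0) amaM.
  have := ler_wpM2l k0 X2; lra.
set Br := (16 * _ * _ * _ + _) in err2 *.
have h1 : r ^+ 2 / (am * D) <= am * D / 2 * W ^+ 2 + (am * D)^-1 * Br.
  have h2 : 32 * aM ^+ 4 * D ^+ 4 * W ^+ 2 <= am * D / 2 * W ^+ 2 * (am * D).
    have := ler_wpM2r (mulr_ge0 (sqr_ge0 D) (sqr_ge0 W)) D_small; lra.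
  rewrite ler_pdivrMr// mulrDl -(mulrC Br) divfK ?gt_eqF//; lra.
lra.
Qed.

Definition process_var : R := 2 * main_var + 2 * remainder_var.

Lemma process_second_moment i : absmean_le P (fun w => X i w ^+ 2) process_var.
Proof.
have mXW : measurable_fun setT (fun w => X i w - remainder i w).
  by apply: measurable_funB => //; exact: measurable_remainder.
have := absmean_le_sqrD mXW (measurable_remainder i) (main_second_moment i) (remainder_second_moment i).
have -> : (fun w => (X i w - remainder i w + remainder i w) ^+ 2) = (fun w => X i w ^+ 2).
  by apply/funext => w; rewrite subrK.
apply: absmean_leW; rewrite /process_var lerD2l ler_wpM2l//.
have := absmean_le_ge0 (remainder_second_moment 0); rewrite pmulr_lge0// => h.
by rewrite ler_piMr.
Qed.

Definition error_var : R :=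
  16 * aM ^+ 2 * (C ^+ 2 + aM ^+ 2 * process_var) + 64 * aM ^+ 2 * sigma ^+ 2.

Lemma error_second_moment i :
  absmean_le P (fun w => euler_error i w ^+ 2) (error_var * D ^+ 3).
Proof.
have pv0 := absmean_le_ge0 (process_second_moment 0).
have h1 := absmean_leD (absmean_le_cst P (C ^+ 2)) (absmean_leZ (aM ^+ 2) (process_second_moment i)).
have h2 := absmean_leD (absmean_leZ (16 * aM ^+ 2 * D ^+ 4) h1)
    (absmean_leZ (8 * aM ^+ 2 * sigma ^+ 2) (q_mean i)).
apply: absmean_leW (absmean_le_ae _ _ h2).
- rewrite !ger0_norm; [|nonneg..].
  have : 16 * aM ^+ 2 * D ^+ 4 * (C ^+ 2 + aM ^+ 2 * process_var) <=
         16 * aM ^+ 2 * D ^+ 3 * (C ^+ 2 + aM ^+ 2 * process_var).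
    apply: ler_wpM2r; first by nonneg.
    apply: ler_wpM2l; first by nonneg.
    by rewrite (exprS D 3) ler_piMl//; nonneg.
  by rewrite /error_var; lra.
- by apply: measurable_funX; exact: measurable_euler_error.
apply: filterS error_ae => w /(_ i) err.
by rewrite ger0_norm ?sqr_ge0//; apply: le_trans (ler_norm _).
Qed.

(** The weighted sum is a weighted sum of the increments, with coefficients that
    the contraction bounds by b / (am D): the correlations of the noise are
    summable over a time of order 1 / am. *)
Lemma weighted_noise_second_moment (wt : nat -> R) (b : R) n :
  (forall i, `|wt i| <= b) ->
  absmean_le P (fun w => (\sum_(i < n) wt i * noise i w) ^+ 2)
    (n%:R * ((b / (am * D)) ^+ 2 * sigma ^+ 2 * (8 * D))).
Proof.
move=> wtb; have b0 : 0 <= b by exact: le_trans (wtb 0).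
set k := b / (am * D).
have k0 : 0 <= k by rewrite /k; nonneg.
(* backward recursion for the coefficients of the increments; c is the weight
   carried over to the last value of the noise *)
have backward c : `|c| <= k -> exists2 g : nat -> R, forall j, `|g j| <= k &
    forall w, \sum_(i < n) wt i * noise i w + c * noise n w =
              \sum_(j < n) (g j * sigma) * xi j w.
  elim: n c => [|n IH] c ck.
    by exists (fun _ => 0) => [j|w]; rewrite ?normr0// !big_ord0 /= mulr0 addr0.
  have ck' : `|wt n + c * (1 - a_ n * D)| <= k.
    apply: le_trans (ler_normD _ _) _; rewrite normrM (ger0_norm (rho_ge0 n)).
    have h : `|c| * (1 - a_ n * D) <= k * (1 - am * D) by apply: ler_pM.
    have : b + k * (1 - am * D) = k by rewrite /k; field; rewrite !gt_eqF.
    by have := wtb n; lra.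
  have [g gk gE] := IH _ ck'.
  exists (fun j => if j == n then c else g j); first by move=> j; case: eqP.
  move=> w; rewrite !big_ord_recr/= eqxx.
  have -> : \sum_(i < n) (if (i : nat) == n then c else g i) * sigma * xi i w =
            \sum_(i < n) g i * sigma * xi i w.
    by apply: eq_bigr => i _; rewrite ltn_eqF.
  by rewrite -gE; ring.
have [|g gk gE] := backward 0; first by rewrite normr0.
have -> : (fun w => (\sum_(i < n) wt i * noise i w) ^+ 2) =
          (fun w => (\sum_(j < n) (g j * sigma) * xi j w) ^+ 2).
  by apply/funext => w; rewrite -gE mul0r addr0.
apply: absmean_leW (weighted_bincr_second_moment B_BM D_gt0 (fun j => g j * sigma) n).
apply: (ler_sum_ord (F := fun j => (g j * sigma) ^+ 2 * (8 * D))) => j _; rewrite ler_wpM2r//; first by nonneg.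
rewrite exprMn ler_wpM2r ?sqr_ge0// -(real_normK (num_real (g j))).
by rewrite lerXn2r ?nnegrE.
Qed.

Lemma noise_martingale_second_moment n :
  absmean_le P (fun w => (\sum_(i < n) noise i w * xi i w) ^+ 2)
    (n%:R * (noise_var * (8 * D))).
Proof.
have h := @absmean_le_martingale _ _ _ P xi (measurable_bincr B D)
  (bincr_indep B_BM D_gt0) noise (fun x => x) (fun _ => noise_var) (8 * D) n.
have := h (@measurable_id _ _ _) (fun i _ => @adapted_noise i)
  (fun i _ => noise_second_moment i) (fun i _ => bincr_second_moment B_BM D_gt0 i)
  (fun i _ => bincr_mean0 B_BM D_gt0 i).
by rewrite sumr_const card_ord (mulr_natl (noise_var * _)).
Qed.

(** Telescoping the square of the noise expresses its energy by that of the
    Brownian increments. *)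
Lemma noise_energy (a : R) n w : (forall i, (i < n)%N -> a_ i = a) ->
  (2 * a - a ^+ 2 * D) * D * \sum_(i < n) noise i w ^+ 2 =
  2 * (1 - a * D) * sigma * \sum_(i < n) noise i w * xi i w +
  sigma ^+ 2 * \sum_(i < n) xi i w ^+ 2 - noise n w ^+ 2.
Proof.
elim: n => [|n IH] aE; first by rewrite !big_ord0 /=; ring.
rewrite !big_ord_recr/= mulrDr IH ?aE//; first by ring.
by move=> i lin; apply: aE; exact: leqW.
Qed.

Let s := Num.sqrt D.
Let s_gt0 : 0 < s. Proof. by rewrite sqrtr_gt0. Qed.
Let s2 : D = s ^+ 2. Proof. by rewrite sqr_sqrtr// ltW. Qed.

Lemma error_abs_mean i :
  absmean_le P (euler_error i) ((error_var + 1) * D * s).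
Proof.
have a1 : absmean_le P (fun w => (cst 1 w : R) ^+ 2) 1.
  by have := absmean_le_cst P (1 : R); rewrite normr1; congr absmean_le; apply/funext => w; rewrite /= expr1n.
have l0 : 0 < (D * s)^-1 by rewrite invr_gt0 mulr_gt0.
have := absmean_le_prod l0 (measurable_euler_error i) (@measurable_cst _ _ _ _ setT (1 : R))
  (error_second_moment i) a1.
have -> : (fun w => euler_error i w * cst 1 w) = euler_error i.
  by apply/funext => w; rewrite /= mulr1.
apply: absmean_leW; rewrite le_eqVlt; apply/orP; left; apply/eqP.
by rewrite s2; field; rewrite gt_eqF.
Qed.

Lemma process_error_abs_mean i :
  absmean_le P (fun w => X i w * euler_error i w) ((process_var + error_var) * D * s).
Proof.
have l0 : 0 < D * s by rewrite mulr_gt0.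
have := absmean_le_prod l0 (mX i) (measurable_euler_error i)
  (process_second_moment i) (error_second_moment i).
apply: absmean_leW; rewrite le_eqVlt; apply/orP; left; apply/eqP.
by rewrite s2; field; rewrite gt_eqF.
Qed.

Lemma process_abs_mean i : absmean_le P (X i) (process_var + 1).
Proof.
have a1 : absmean_le P (fun w => (cst 1 w : R) ^+ 2) 1.
  by have := absmean_le_cst P (1 : R); rewrite normr1; congr absmean_le; apply/funext => w; rewrite /= expr1n.
have := absmean_le_prod ltr01 (mX i) (@measurable_cst _ _ _ _ setT (1 : R))
  (process_second_moment i) a1.
have -> : (fun w => X i w * cst 1 w) = X i.
  by apply/funext => w; rewrite /= mulr1.
by rewrite !mul1r invr1.
Qed.

Lemma transient_energy n :
  absmean_le P (fun w => \sum_(i < n) (decay i * X 0%N w + remainder i w) ^+ 2)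
    (2 * (m0 / (am * D)) + n%:R * (2 * remainder_var * D)).
Proof.
have h1 : absmean_le P (fun w => 2 * ((\sum_(i < n) decay i ^+ 2) * X 0%N w ^+ 2)) (2 * (m0 / (am * D))).
  have := absmean_leZ (2 * \sum_(i < n) decay i ^+ 2) X0_sqr.
  have m00 := absmean_le_ge0 X0_sqr.
  have sd0 : 0 <= \sum_(i < n) decay i ^+ 2 by apply: sumr_ge0 => i _; exact: sqr_ge0.
  rewrite ger0_norm; last by nonneg.
  under eq_fun do rewrite -mulrA.
  apply: absmean_leW; rewrite -mulrA ler_wpM2l// mulrC ler_wpM2l//.
  exact: sum_decay_sqr.
have h2 : absmean_le P (fun w => \sum_(i < n) 2 * remainder i w ^+ 2)
    (n%:R * (2 * remainder_var * D)).
  apply: (@absmean_le_sum_ord _ _ _ P n (fun i w => 2 * remainder i w ^+ 2)) => i.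
  by have := absmean_leZ 2 (remainder_second_moment i); rewrite normr_nat mulrA.
apply: absmean_le_dom (absmean_leD h1 h2).
  apply: measurable_sum => i; apply: measurable_funX; apply: measurable_funD.
    exact: measurable_funM.
  exact: measurable_remainder.
move=> w; rewrite ger0_norm; last by apply: sumr_ge0 => i _; exact: sqr_ge0.
apply: le_trans (ler_norm _); rewrite mulr_suml mulr_sumr -big_split/=.
apply: ler_sum => i _; rewrite -exprMn.
by have := sqr_ge0 (decay i * X 0%N w - remainder i w); nra.
Qed.

Lemma signal_noise_second_moment n :
  absmean_le P (fun w => (\sum_(i < n) signal i * xi i w) ^+ 2)
    (n%:R * ((C / am) ^+ 2 * (8 * D))).
Proof.
apply: absmean_leW (weighted_bincr_second_moment B_BM D_gt0 signal n).
apply: (ler_sum_ord (F := fun j => signal j ^+ 2 * (8 * D))) => j _; rewrite ler_wpM2r//; first by nonneg.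
rewrite -(real_normK (num_real (signal j))) lerXn2r ?nnegrE// ?signal_le//.
by nonneg.
Qed.

Lemma transient_noise_abs_mean n :
  absmean_le P (fun w => X 0%N w * \sum_(i < n) decay i * xi i w) (m0 + 8 / am).
Proof.
have h := weighted_bincr_second_moment B_BM D_gt0 decay n.
have mS : measurable_fun setT (fun w => \sum_(i < n) decay i * xi i w).
  by apply: measurable_sum => i; apply: measurable_funM => //; exact: measurable_bincr.
have := absmean_le_prod ltr01 (mX 0) mS X0_sqr h.
apply: absmean_leW; rewrite mul1r invr1 mulr1 lerD2l -mulr_suml.
have D80 : 0 <= 8 * D by nonneg.
have := ler_wpM2r D80 (sum_decay_sqr n) => /le_trans; apply.
by rewrite le_eqVlt; apply/orP; left; apply/eqP; field; rewrite !gt_eqF.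
Qed.

Definition remainder_step_var : R := 2 * (aM ^+ 2 * remainder_var) + 2 * error_var.

(** The remainder is not adapted to the increments alone, so its stochastic sum
    is bounded through a summation by parts; kap balances the two factors. *)
Lemma remainder_noise_abs_mean n (kap : R) : 0 < kap ->
  absmean_le P (fun w => \sum_(i < n) remainder i w * xi i w)
    (remainder_var * s + 8 * (n%:R * D) * s + kap * remainder_step_var * (n%:R * D)
     + 8 * (n%:R * D) ^+ 2 * D / kap).
Proof.
move=> kap0.
pose b i w := B (grid D i) w - B (grid D 0) w.
have mb i : measurable_fun setT (b i) by exact: measurable_bdiff.
have b2 i : (i <= n)%N -> absmean_le P (fun w => b i w ^+ 2) (8 * (n%:R * D)).
  move=> lin; have g0i : grid D 0 <= grid D i by exact: grid_le.
  apply: absmean_leW (bdiff_second_moment B_BM (grid_ge0 D_gt0 0) g0i).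
  by rewrite ler_wpM2l// /grid mul0r subr0 ler_wpM2r ?(ltW D_gt0)// ler_nat.
have parts k w : \sum_(i < k) remainder i w * xi i w =
    remainder k w * b k w - \sum_(i < k) (remainder i.+1 w - remainder i w) * b i.+1 w.
  elim: k => [|k IH]; first by rewrite !big_ord0 remainder0; ring.
  by rewrite !big_ord_recr/= IH /b /bincr; ring.
have step2 i : absmean_le P (fun w => (remainder i.+1 w - remainder i w) ^+ 2)
    (remainder_step_var * D ^+ 3).
  have m1 : measurable_fun setT (fun w => - (a_ i * D) * remainder i w).
    by apply: measurable_funM => //; exact: measurable_remainder.
  have h1 : absmean_le P (fun w => (- (a_ i * D) * remainder i w) ^+ 2)
      ((aM * D) ^+ 2 * (remainder_var * D)).
    have := absmean_leZ ((a_ i * D) ^+ 2) (remainder_second_moment i).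
    have rv := absmean_le_ge0 (remainder_second_moment i).
    move=> h; apply: absmean_leW (absmean_le_dom _ _ h).
    - rewrite ger0_norm ?sqr_ge0// ler_wpM2r// lerXn2r ?nnegrE//.
      + by rewrite mulr_ge0 ?(ltW D_gt0)// (le_trans (ltW am_gt0)).
      + by rewrite mulr_ge0 ?(ltW D_gt0)// (le_trans (ltW am_gt0)).
      + by rewrite ler_wpM2r// ltW.
    - exact: measurable_funX.
    - by move=> w; rewrite exprMn sqrrN.
  have := absmean_le_sqrD m1 (measurable_euler_error i) h1 (error_second_moment i).
  have -> : (fun w => (- (a_ i * D) * remainder i w + euler_error i w) ^+ 2) =
    (fun w => (remainder i.+1 w - remainder i w) ^+ 2).
    by apply/funext => w; rewrite remainderS; congr (_ ^+ 2); ring.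
  apply: absmean_leW; rewrite /remainder_step_var le_eqVlt; apply/orP; left; apply/eqP.
  ring.
have l1 : 0 < s^-1 by rewrite invr_gt0.
have first_term := absmean_le_prod l1 (measurable_remainder n) (mb n)
  (remainder_second_moment n) (b2 n (leqnn n)).
have l2 : 0 < kap / D ^+ 2 by rewrite divr_gt0// exprn_gt0.
have mstep i : measurable_fun setT (fun w => remainder i.+1 w - remainder i w).
  by apply: measurable_funB; exact: measurable_remainder.
have terms (i : 'I_n) := absmean_le_prod l2 (mstep i) (mb i.+1) (step2 i) (b2 i.+1 (ltn_ord i)).
have := absmean_leD first_term (absmean_leZ (-1) (absmean_le_sum (index_enum 'I_n) terms)).
have -> : (fun w => remainder n w * b n w + -1 *
   \sum_(i < n) (remainder i.+1 w - remainder i w) * b i.+1 w) =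
   (fun w => \sum_(i < n) remainder i w * xi i w).
  by apply/funext => w; rewrite parts; ring.
apply: absmean_leW; rewrite normrN normr1 mul1r sumr_const card_ord -(mulr_natl (_ + _ / _)).
rewrite le_eqVlt; apply/orP; left; apply/eqP.
have sn0 : s != 0 by rewrite gt_eqF.
have kn0 : kap != 0 by rewrite gt_eqF.
by rewrite s2; field; rewrite sn0 kn0.
Qed.

End euler_scheme.

(** * The random errors *)

Section path_error.
Context (R : realType) (p : nat).
Variables (D : R) (N K K1 : nat) (phi : 'I_p -> nat -> R).
Variables (h U J W xi x e r : nat -> R).

(** The random quantities that must be small. Those that are centred sums enter
    through their squares, the others through absolute values, so that the mean
    of the total is bounded by second moments alone. In the notation x = h + U +
    J + W, the letters stand for signal, noise, transient and remainder; xi are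
    the Brownian increments, e the errors of the scheme, and r the difference
    between the drift integrals over the cells and their left-point values. *)
Definition gram_error : R :=
  \sum_l avg N (fun i => phi l i * U i) ^+ 2 + avg N (fun i => h i * U i) ^+ 2 +
  avg N (fun i => (J i + W i) ^+ 2).

Definition energy_error : R :=
  ((N%:R * D)^-1 * \sum_(i < N) U i * xi i) ^+ 2 +
  (N%:R^-1 * \sum_(i < N) (big_step D (xi i) - big_step_prob D)) ^+ 2 +
  (N%:R * D)^-1 * U N ^+ 2.

Definition phi_noise_error : R :=
  \sum_l ((N%:R * D)^-1 * \sum_(i < N) phi l i * xi i) ^+ 2 +
  (N%:R * D)^-1 * \sum_(i < N) `|e i|.

Definition process_noise_error : R :=
  (N%:R * D)^-1 * \sum_(i < N) `|x i * e i| +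
  (N%:R * D)^-1 * \sum_(i < N) `|r i| * `|x i| +
  ((N%:R * D)^-1 * \sum_(i < N) h i * xi i) ^+ 2 +
  (N%:R * D)^-1 * `|\sum_(i < N) J i * xi i| +
  (N%:R * D)^-1 * `|\sum_(i < N) W i * xi i|.

Definition monitoring_error : R :=
  (K%:R * D)^-1 * (`|x (N + K)%N| + `|x N| + `|x (N + K1)%N|) +
  K%:R^-1 * \sum_(N <= i < N + K1) `|x i| +
  ((K%:R * D)^-1 * \sum_(N + K1 <= i < N + K) xi i) ^+ 2 +
  (K%:R * D)^-1 * \sum_(i < N + K) `|e i|.

Definition path_error : R :=
  gram_error + energy_error + phi_noise_error + process_noise_error + monitoring_error.

Hypothesis D_ge0 : 0 <= D.

Let ND0 : 0 <= (N%:R * D)^-1. Proof. by rewrite invr_ge0 mulr_ge0. Qed.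
Let KD0 : 0 <= (K%:R * D)^-1. Proof. by rewrite invr_ge0 mulr_ge0. Qed.

Let sum_sqr_ge0 (I : finType) (F : I -> R) : 0 <= \sum_l F l ^+ 2.
Proof. by apply: sumr_ge0 => l _; exact: sqr_ge0. Qed.

Let sum_norm_ge0 n (F : nat -> R) : 0 <= \sum_(i < n) `|F i|.
Proof. exact: sumr_ge0. Qed.

Lemma gram_error_ge0 : 0 <= gram_error.
Proof.
rewrite /gram_error; apply: addr_ge0; last by apply: avg_ge0 => i; exact: sqr_ge0.
by apply: addr_ge0; [exact: sum_sqr_ge0|exact: sqr_ge0].
Qed.

Lemma energy_error_ge0 : 0 <= energy_error.
Proof. by rewrite /energy_error; nonneg. Qed.

Lemma phi_noise_error_ge0 : 0 <= phi_noise_error.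
Proof. by rewrite /phi_noise_error; apply: addr_ge0; [exact: sum_sqr_ge0|exact: mulr_ge0]. Qed.

Lemma process_noise_error_ge0 : 0 <= process_noise_error.
Proof.
rewrite /process_noise_error; nonneg; first exact: (sum_norm_ge0 _ (fun i => x i * e i)).
by apply: sumr_ge0 => i _; exact: mulr_ge0.
Qed.

Lemma monitoring_error_ge0 : 0 <= monitoring_error.
Proof.
have h1 : 0 <= (K%:R * D)^-1 * (`|x (N + K)%N| + `|x N| + `|x (N + K1)%N|) by nonneg.
have h2 : 0 <= K%:R^-1 * \sum_(N <= i < N + K1) `|x i|.
  by rewrite mulr_ge0 ?invr_ge0//; apply: sumr_ge0.
have h3 := sqr_ge0 ((K%:R * D)^-1 * \sum_(N + K1 <= i < N + K) xi i).
have h4 : 0 <= (K%:R * D)^-1 * \sum_(i < N + K) `|e i| by nonneg.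
rewrite /monitoring_error; lra.
Qed.

Variables (eps : R) (eps_ge0 : 0 <= eps) (eps_le1 : eps <= 1).
Hypothesis small : path_error <= eps ^+ 2.

Let parts_small : [/\ gram_error <= eps ^+ 2, energy_error <= eps ^+ 2,
  phi_noise_error <= eps ^+ 2, process_noise_error <= eps ^+ 2 &
  monitoring_error <= eps ^+ 2].
Proof.
move: small; rewrite /path_error; have := gram_error_ge0; have := energy_error_ge0.
have := phi_noise_error_ge0; have := process_noise_error_ge0.
have := monitoring_error_ge0; move=> *; split; lra.
Qed.

Let sqr_le (y : R) : y ^+ 2 <= eps ^+ 2 -> `|y| <= eps.
Proof.
move=> y2; rewrite -(ler_pXn2r (n := 2)) ?nnegrE//.
by rewrite real_normK// num_real.
Qed.

Let eps2_le : eps ^+ 2 <= eps.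
Proof. by rewrite expr2 ler_piMr. Qed.

Lemma gram_error_small : [/\ forall l, `|avg N (fun i => phi l i * U i)| <= eps,
  `|avg N (fun i => h i * U i)| <= eps &
  avg N (fun i => (J i + W i) ^+ 2) <= eps].
Proof.
have [+ _ _ _ _] := parts_small; rewrite /gram_error => H.
have h1 := sum_sqr_ge0 (fun l => avg N (fun i => phi l i * U i)).
have h2 := sqr_ge0 (avg N (fun i => h i * U i)).
have h3 : 0 <= avg N (fun i => (J i + W i) ^+ 2) by apply: avg_ge0 => i; exact: sqr_ge0.
split; [|apply: sqr_le; lra|by have := eps2_le; lra].
move=> l; apply: sqr_le.
have : avg N (fun i => phi l i * U i) ^+ 2 <= \sum_l avg N (fun i => phi l i * U i) ^+ 2.
  by rewrite (bigD1 l)//= lerDl; apply: sumr_ge0 => k _; exact: sqr_ge0.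
lra.
Qed.

Lemma energy_error_small : [/\ `|(N%:R * D)^-1 * \sum_(i < N) U i * xi i| <= eps,
  `|N%:R^-1 * \sum_(i < N) (big_step D (xi i) - big_step_prob D)| <= eps &
  (N%:R * D)^-1 * U N ^+ 2 <= eps].
Proof.
have [_ + _ _ _] := parts_small; rewrite /energy_error => H.
have h1 := sqr_ge0 ((N%:R * D)^-1 * \sum_(i < N) U i * xi i).
have h2 := sqr_ge0 (N%:R^-1 * \sum_(i < N) (big_step D (xi i) - big_step_prob D)).
have h3 : 0 <= (N%:R * D)^-1 * U N ^+ 2 by nonneg.
by split; [apply: sqr_le; lra|apply: sqr_le; lra|have := eps2_le; lra].
Qed.

Lemma phi_noise_error_small :
  (forall l, `|(N%:R * D)^-1 * \sum_(i < N) phi l i * xi i| <= eps) /\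
  (N%:R * D)^-1 * \sum_(i < N) `|e i| <= eps.
Proof.
have [_ _ + _ _] := parts_small; rewrite /phi_noise_error => H.
have h1 := sum_sqr_ge0 (fun l => (N%:R * D)^-1 * \sum_(i < N) phi l i * xi i).
have h2 : 0 <= (N%:R * D)^-1 * \sum_(i < N) `|e i| by nonneg.
split; last by have := eps2_le; lra.
move=> l; apply: sqr_le.
have : ((N%:R * D)^-1 * \sum_(i < N) phi l i * xi i) ^+ 2 <=
       \sum_l ((N%:R * D)^-1 * \sum_(i < N) phi l i * xi i) ^+ 2.
  by rewrite (bigD1 l)//= lerDl; apply: sumr_ge0 => k _; exact: sqr_ge0.
lra.
Qed.

Lemma process_noise_error_small :
  [/\ (N%:R * D)^-1 * \sum_(i < N) `|x i * e i| <= eps,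
   (N%:R * D)^-1 * \sum_(i < N) `|r i| * `|x i| <= eps &
   `|(N%:R * D)^-1 * \sum_(i < N) (h i + J i + W i) * xi i| <= 3 * eps].
Proof.
have [_ _ _ + _] := parts_small; rewrite /process_noise_error => H.
have h1 : 0 <= (N%:R * D)^-1 * \sum_(i < N) `|x i * e i|.
  by apply: mulr_ge0 => //; exact: (sum_norm_ge0 _ (fun i => x i * e i)).
have h2 : 0 <= (N%:R * D)^-1 * \sum_(i < N) `|r i| * `|x i|.
  by apply: mulr_ge0 => //; apply: sumr_ge0 => i _; exact: mulr_ge0.
have h3 := sqr_ge0 ((N%:R * D)^-1 * \sum_(i < N) h i * xi i).
have h4 : 0 <= (N%:R * D)^-1 * `|\sum_(i < N) J i * xi i| by nonneg.
have h5 : 0 <= (N%:R * D)^-1 * `|\sum_(i < N) W i * xi i| by nonneg.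
have e2 := eps2_le.
split; [lra|lra|].
have -> : \sum_(i < N) (h i + J i + W i) * xi i =
  \sum_(i < N) h i * xi i + \sum_(i < N) J i * xi i + \sum_(i < N) W i * xi i.
  by rewrite -!big_split; apply: eq_bigr => i _ /=; ring.
rewrite 2!mulrDr; apply: le_trans (ler_normD _ _) _.
have g1 := ler_normD ((N%:R * D)^-1 * \sum_(i < N) h i * xi i) ((N%:R * D)^-1 * \sum_(i < N) J i * xi i).
have g2 : `|(N%:R * D)^-1 * \sum_(i < N) h i * xi i| <= eps by apply: sqr_le; lra.
move: g1; rewrite (normrM _ (\sum_(i < N) J i * xi i)) (normrM _ (\sum_(i < N) W i * xi i)).
rewrite (ger0_norm ND0); lra.
Qed.

Lemma monitoring_error_small :
  [/\ (K%:R * D)^-1 * (`|x (N + K)%N| + `|x N| + `|x (N + K1)%N|) <= eps,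
    K%:R^-1 * \sum_(N <= i < N + K1) `|x i| <= eps,
    `|(K%:R * D)^-1 * \sum_(N + K1 <= i < N + K) xi i| <= eps &
    (K%:R * D)^-1 * \sum_(i < N + K) `|e i| <= eps].
Proof.
have [_ _ _ _ +] := parts_small; rewrite /monitoring_error => H.
have h1 : 0 <= (K%:R * D)^-1 * (`|x (N + K)%N| + `|x N| + `|x (N + K1)%N|) by nonneg.
have h2 : 0 <= K%:R^-1 * \sum_(N <= i < N + K1) `|x i|.
  by rewrite mulr_ge0 ?invr_ge0//; apply: sumr_ge0.
have h3 := sqr_ge0 ((K%:R * D)^-1 * \sum_(N + K1 <= i < N + K) xi i).
have h4 : 0 <= (K%:R * D)^-1 * \sum_(i < N + K) `|e i| by nonneg.
have e2 := eps2_le.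
by split; [lra|lra|apply: sqr_le; lra|lra].
Qed.

End path_error.

(** * Detection on a path with small errors *)

Section detection.
Context (R : realType) (p : nat) (hp : (0 < p)%N).
Variables (phi : R -> 'cV[R]_p) (D : R) (N K K1 : nat) (x : R -> R).
Variables (h U J W xi f e : nat -> R).
Variables (theta0 thetas : 'cV[R]_(p + 1)) (G H sigma : R).
Hypotheses (D_gt0 : 0 < D) (N_gt0 : (0 < N)%N) (K1K : (K1 < K)%N).
Hypotheses (sigma_gt0 : 0 < sigma) (G_ge0 : 0 <= G) (H_ge0 : 0 <= H).
Hypotheses (a0_gt0 : 0 < a_of theta0) (as_gt0 : 0 < a_of thetas)
  (a0D : a_of theta0 * D <= 1 / 2).

Let t := grid D.
Let phit l i := phi (t i) l 0.
Let xt i := x (t i).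
Let drift0 i := D * \sum_l phit l i * mu_of theta0 l 0.
Let r i := f i - drift0 i.
Let coef i := if (i < N + K1)%N then a_of theta0 else a_of thetas.

Hypotheses (phi_le : forall i l, `|phit l i| <= G) (h_le : forall i, `|h i| <= H)
  (xE : forall i, xt i = h i + U i + (J i + W i))
  (eE : forall i, e i = xt i.+1 - (xt i + f i - coef i * D * xt i + sigma * xi i))
  (energy : (2 * a_of theta0 - a_of theta0 ^+ 2 * D) * D * \sum_(i < N) U i ^+ 2 =
     2 * (1 - a_of theta0 * D) * sigma * \sum_(i < N) U i * xi i +
     sigma ^+ 2 * \sum_(i < N) xi i ^+ 2 - U N ^+ 2).

Variable eps : R.
Hypotheses (eps_ge0 : 0 <= eps) (eps_le1 : eps <= 1).
Hypothesis small :
  path_error D N K K1 phit h U J W xi xt e r <= eps ^+ 2.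

Let D_ge0 : 0 <= D := ltW D_gt0.
Let NR : 0 < N%:R :> R. Proof. by rewrite ltr0n. Qed.
Let KR : 0 < K%:R :> R. Proof. by rewrite ltr0n (leq_ltn_trans _ K1K). Qed.
Let ND_gt0 : 0 < (N%:R * D)^-1. Proof. by rewrite invr_gt0 mulr_gt0. Qed.
Let KD_gt0 : 0 < (K%:R * D)^-1. Proof. by rewrite invr_gt0 mulr_gt0. Qed.

(** The energy identity turns the lower bound on the quadratic variation, given
    by the frequency of the big steps, into a lower bound on the energy of the
    noise; the stochastic integral of U and the boundary term are small. *)
Lemma energy_lower_bound : eps <= 1 / 4 -> eps * (2 * sigma + 1) <= sigma ^+ 2 / 64 ->
  sigma ^+ 2 / (128 * a_of theta0) <= avg N (fun i => U i ^+ 2).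
Proof.
move=> e4 esig; have [UX cnt UN] := energy_error_small D_ge0 eps_ge0 eps_le1 small.
have Sxi : 1 / 32 <= (N%:R * D)^-1 * \sum_(i < N) xi i ^+ 2.
  have h1 : D / 16 * \sum_(i < N) big_step D (xi i) <= \sum_(i < N) xi i ^+ 2.
    by rewrite mulr_sumr; apply: ler_sum => i _; exact: sqr_ge_big_step.
  have h2 : N%:R / 2 <= \sum_(i < N) big_step D (xi i).
    have p0 := big_step_prob_ge D_gt0.
    move: cnt; rewrite sumrB sumr_const card_ord -(mulr_natl (big_step_prob D)).
    rewrite ler_norml => /andP[+ _]; rewrite mulrBr mulKf ?gt_eqF// => h3.
    have h4 : 1 / 2 <= (\sum_(i < N) big_step D (xi i)) / N%:R.
      by rewrite (mulrC (\sum_(i < N) _)); lra.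
    by rewrite ler_pdivlMr// in h4; lra.
  rewrite (mulrC _^-1) ler_pdivlMr ?mulr_gt0//.
  have D16 : 0 <= D / 16 by rewrite divr_ge0.
  have := ler_wpM2l D16 h2; lra.
set M := (N%:R * D)^-1 * \sum_(i < N) U i * xi i in UX.
set V := (N%:R * D)^-1 * U N ^+ 2 in UN.
set Q := (N%:R * D)^-1 * \sum_(i < N) xi i ^+ 2 in Sxi.
set a := a_of theta0.
have a0 : 0 < a := a0_gt0; have aD : a * D <= 1 / 2 := a0D.
have main : (2 * a - a ^+ 2 * D) * avg N (fun i => U i ^+ 2) =
    2 * (1 - a * D) * sigma * M + sigma ^+ 2 * Q - V.
  apply: (mulfI (lt0r_neq0 (mulr_gt0 NR D_gt0))).
  transitivity ((2 * a - a ^+ 2 * D) * D * \sum_(i < N) U i ^+ 2).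
    by rewrite /avg; field; rewrite gt_eqF.
  rewrite {1}/a energy -/a /M /Q /V; field.
  by rewrite !gt_eqF.
have A0 : 0 <= avg N (fun i => U i ^+ 2) by apply: avg_ge0 => i; exact: sqr_ge0.
have aD0 : 0 <= a * D by rewrite mulr_ge0// ltW.
have h1 : (2 * a - a ^+ 2 * D) * avg N (fun i => U i ^+ 2) <= 2 * a * avg N (fun i => U i ^+ 2).
  by rewrite ler_wpM2r// lerBlDr lerDl mulr_ge0// sqr_ge0.
have h2 : - (2 * sigma * eps) <= 2 * (1 - a * D) * sigma * M.
  have : `|2 * (1 - a * D) * sigma * M| <= 2 * sigma * eps.
    rewrite normrM ger0_norm; last first.
      by rewrite !mulr_ge0// ?(ltW sigma_gt0)//; lra.
    apply: ler_pM => //; first by rewrite !mulr_ge0// ?(ltW sigma_gt0)//; lra.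
    rewrite ler_wpM2r ?(ltW sigma_gt0)//; lra.
  by rewrite ler_norml => /andP[].
have h3 : sigma ^+ 2 * (1 / 32) <= sigma ^+ 2 * Q by rewrite ler_wpM2l// sqr_ge0.
rewrite ler_pdivrMr ?mulr_gt0//; lra.
Qed.

Let residualE i : (i < N)%N -> drift_residual phi D x theta0 i =
  D^-1 * (r i + sigma * xi i + e i).
Proof.
move=> iN; rewrite /drift_residual /regressor -/(xt i) eE /coef ltn_addr//.
rewrite -/(xt i.+1) /r /drift0 /phit; field; rewrite gt_eqF//.
Qed.

Let avg_residual (F : nat -> R) :
  avg N (fun i => F i * drift_residual phi D x theta0 i) =
  (N%:R * D)^-1 * \sum_(i < N) F i * r i +
  sigma * ((N%:R * D)^-1 * \sum_(i < N) F i * xi i) +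
  (N%:R * D)^-1 * \sum_(i < N) F i * e i.
Proof.
have -> : avg N (fun i => F i * drift_residual phi D x theta0 i) =
  N%:R^-1 * (D^-1 * (\sum_(i < N) F i * r i + sigma * \sum_(i < N) F i * xi i +
    \sum_(i < N) F i * e i)).
  congr (_ * _); rewrite mulr_sumr -!big_split mulr_sumr; apply: eq_bigr => i _ /=.
  by rewrite residualE//; ring.
by rewrite invfM; ring.
Qed.

(** The drift residual at the true parameter is the sum of the scheme error, the
    increment and r, each nearly orthogonal to the regressors. *)
Lemma noise_bounds : (N%:R * D)^-1 * \sum_(i < N) `|r i| <= eps ->
  (forall l, `|avg N (fun i => phi (grid D i) l 0 * drift_residual phi D x theta0 i)|
     <= (4 * sigma + 2 * G + 2) * eps) /\
  `|avg N (fun i => x (grid D i) * drift_residual phi D x theta0 i)|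
     <= (4 * sigma + 2 * G + 2) * eps.
Proof.
move=> reps.
have [phixi esum] := phi_noise_error_small D_ge0 eps_ge0 eps_le1 small.
have [xe xr hJWxi] := process_noise_error_small D_ge0 eps_ge0 eps_le1 small.
have [Uxi _ _] := energy_error_small D_ge0 eps_ge0 eps_le1 small.
have tri (u v w : R) : `|u + v + w| <= `|u| + `|v| + `|w|.
  by rewrite (le_trans (ler_normD _ _))// lerD2r ler_normD.
have s0 := ltW sigma_gt0.
have Ge : 0 <= G * eps by exact: mulr_ge0.
have se : 0 <= sigma * eps by exact: mulr_ge0.
have dom (F g : nat -> R) c : 0 <= c -> (forall i, `|F i| <= c) ->
    (N%:R * D)^-1 * \sum_(i < N) `|g i| <= eps ->
    `|(N%:R * D)^-1 * \sum_(i < N) F i * g i| <= c * eps.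
  move=> c0 Fc ge; rewrite normrM (ger0_norm (ltW ND_gt0)).
  apply: le_trans (ler_wpM2l c0 ge); rewrite mulrCA ler_wpM2l ?(ltW ND_gt0)//.
  rewrite mulr_sumr; apply: le_trans (ler_norm_sum _ _ _) _; apply: ler_sum => i _.
  by rewrite normrM ler_wpM2r.
split=> [l|].
  rewrite (avg_residual (phit l)); apply: le_trans (tri _ _ _) _.
  have b1 := dom (phit l) r _ G_ge0 (fun i => phi_le i l) reps.
  have b2 := dom (phit l) e _ G_ge0 (fun i => phi_le i l) esum.
  have b3 : `|sigma * ((N%:R * D)^-1 * \sum_(i < N) phit l i * xi i)| <= sigma * eps.
    by rewrite normrM (ger0_norm s0) ler_wpM2l//; exact: phixi.
  have cE : (4 * sigma + 2 * G + 2) * eps =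
    G * eps + sigma * eps + G * eps + (3 * (sigma * eps) + 2 * eps) by ring.
  rewrite cE -[leLHS]addr0; apply: lerD; first by apply: lerD => //; exact: lerD.
  by rewrite addr_ge0// mulr_ge0.
rewrite (avg_residual xt); apply: le_trans (tri _ _ _) _.
have absS (g : nat -> R) : (N%:R * D)^-1 * \sum_(i < N) `|xt i * g i| <= eps ->
    `|(N%:R * D)^-1 * \sum_(i < N) xt i * g i| <= eps.
  move=> ge; rewrite normrM (ger0_norm (ltW ND_gt0)); apply: le_trans ge.
  by rewrite ler_wpM2l ?(ltW ND_gt0)// ler_norm_sum.
have b1 : `|(N%:R * D)^-1 * \sum_(i < N) xt i * r i| <= eps.
  apply: absS; rewrite (eq_bigr (fun i : 'I_N => `|r i| * `|xt i|))//.
  by move=> i _; rewrite normrM mulrC.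
have b2 := absS _ xe.
have b3 : `|sigma * ((N%:R * D)^-1 * \sum_(i < N) xt i * xi i)| <= sigma * (4 * eps).
  rewrite normrM (ger0_norm s0) ler_wpM2l//.
  have -> : \sum_(i < N) xt i * xi i =
      \sum_(i < N) (h i + J i + W i) * xi i + \sum_(i < N) U i * xi i.
    by rewrite -big_split; apply: eq_bigr => i _; rewrite xE /=; ring.
  by rewrite mulrDr; apply: le_trans (ler_normD _ _) _; lra.
have cE : (4 * sigma + 2 * G + 2) * eps =
  eps + sigma * (4 * eps) + eps + 2 * (G * eps) by ring.
rewrite cE; lra.
Qed.

Let K1K' : (N + K1 <= N + K)%N. Proof. by rewrite leq_add2l ltnW. Qed.

(** After the change the drift averages out, which locates the mean of the
    process. *)
Lemma post_change_mean :
  `|(K%:R * D)^-1 * \sum_(N + K1 <= i < N + K) f i - mu_of thetas (Ordinal hp) 0| <= eps ->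
  `|K%:R^-1 * \sum_(N <= i < N + K) xt i -
    mu_of thetas (Ordinal hp) 0 / a_of thetas| <= ((3 + sigma) / a_of thetas + 1) * eps.
Proof.
move=> feps.
have [xs xpre xipost epost] := monitoring_error_small D_ge0 eps_ge0 eps_le1 small.
set as_ := a_of thetas; have as0 : 0 < as_ := as_gt0.
set mus := mu_of thetas _ _ in feps *.
set S := \sum_(N + K1 <= i < N + K) xt i.
have dyn : xt (N + K)%N - xt (N + K1)%N =
    \sum_(N + K1 <= i < N + K) f i - as_ * D * S +
    sigma * \sum_(N + K1 <= i < N + K) xi i + \sum_(N + K1 <= i < N + K) e i.
  rewrite -(telescope_sumr xt K1K') /S !mulr_sumr -sumrB -!big_split/=.
  apply: eq_big_nat => i /andP[i1 i2].
  by rewrite eE /coef ltnNge i1 /= -/as_; ring.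
have edom : `|(K%:R * D)^-1 * \sum_(N + K1 <= i < N + K) e i| <= eps.
  rewrite normrM (ger0_norm (ltW KD_gt0)); apply: le_trans epost.
  rewrite ler_wpM2l ?(ltW KD_gt0)//; apply: le_trans (ler_norm_sum _ _ _) _.
  rewrite -(big_mkord xpredT (fun i => `|e i|)) (big_cat_nat (leq0n (N + K1)) K1K')//= lerDr.
  exact: sumr_ge0.
have xdom : `|(K%:R * D)^-1 * (xt (N + K)%N - xt (N + K1)%N)| <= eps.
  rewrite normrM (ger0_norm (ltW KD_gt0)); apply: le_trans xs.
  rewrite ler_wpM2l ?(ltW KD_gt0)//; apply: le_trans (ler_normB _ _) _.
  by rewrite lerD2r lerDl.
have post : `|K%:R^-1 * S - mus / as_| <= (3 + sigma) / as_ * eps.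
  have -> : K%:R^-1 * S - mus / as_ = as_^-1 *
     (((K%:R * D)^-1 * \sum_(N + K1 <= i < N + K) f i - mus) +
      sigma * ((K%:R * D)^-1 * \sum_(N + K1 <= i < N + K) xi i) +
      (K%:R * D)^-1 * \sum_(N + K1 <= i < N + K) e i -
      (K%:R * D)^-1 * (xt (N + K)%N - xt (N + K1)%N)).
    by rewrite dyn; field; rewrite !gt_eqF.
  rewrite normrM (ger0_norm (ltW (_ : 0 < as_^-1))) ?invr_gt0//.
  rewrite [leRHS](_ : _ = as_^-1 * ((3 + sigma) * eps)); last by ring.
  rewrite ler_wpM2l ?invr_ge0 ?(ltW as0)//.
  apply: le_trans (ler_normB _ _) _.
  have g1 := ler_normD (((K%:R * D)^-1 * \sum_(N + K1 <= i < N + K) f i - mus) +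
      sigma * ((K%:R * D)^-1 * \sum_(N + K1 <= i < N + K) xi i))
      ((K%:R * D)^-1 * \sum_(N + K1 <= i < N + K) e i).
  have g2 := ler_normD ((K%:R * D)^-1 * \sum_(N + K1 <= i < N + K) f i - mus)
      (sigma * ((K%:R * D)^-1 * \sum_(N + K1 <= i < N + K) xi i)).
  have g3 : `|sigma * ((K%:R * D)^-1 * \sum_(N + K1 <= i < N + K) xi i)| <= sigma * eps.
    by rewrite normrM (ger0_norm (ltW sigma_gt0)) ler_wpM2l// ltW.
  lra.
have pre : `|K%:R^-1 * \sum_(N <= i < N + K1) xt i| <= eps.
  rewrite normrM ger0_norm ?invr_ge0//; apply: le_trans xpre.
  by rewrite ler_wpM2l ?invr_ge0// ler_norm_sum.
rewrite (big_cat_nat (leq_addr K1 N) K1K')//= -/S mulrDr -addrA.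
by apply: le_trans (ler_normD _ _) _; lra.
Qed.

End detection.

Lemma mulr_inv_le1 (R : realType) (m M : R) : 0 < M -> m <= M -> m * M^-1 <= 1.
Proof. by move=> M0 mM; rewrite ler_pdivrMr// mul1r. Qed.

(** Closeness of the deterministic averages to their limits: orthonormality of the
    regressors, discretisation of the drift before the change, mean drift after
    it, and mean of the regressors over the monitoring window. *)
Definition averages_close (R : realType) (p : nat) (hp : (0 < p)%N)
    (phi : R -> 'cV[R]_p) (theta0 thetas : 'cV[R]_(p + 1)) (D : R) (N K K1 : nat)
    (f0 fs : nat -> R) (e : R) : Prop :=
  [/\ forall l m, `|avg N (fun i => phi (grid D i) l 0 * phi (grid D i) m 0) -
        (l == m)%:R| <= e,
      (N%:R * D)^-1 * \sum_(i < N)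
        `|f0 i - D * \sum_l phi (grid D i) l 0 * mu_of theta0 l 0| <= e,
      `|(K%:R * D)^-1 * \sum_(N + K1 <= i < N + K) fs i -
        mu_of thetas (Ordinal hp) 0| <= e &
      forall l, `|K%:R^-1 * \sum_(N <= i < N + K) phi (grid D i) l 0 -
        (l == Ordinal hp)%:R| <= e].

(** A level eps below which small errors guarantee detection on a single path,
    whatever the horizon. *)
Definition detection_level (R : realType) (p : nat) (hp : (0 < p)%N)
    (theta0 thetas : 'cV[R]_(p + 1)) (G H sigma eps : R) : Prop :=
  forall (phi : R -> 'cV[R]_p) (D : R) (N K K1 : nat) (x : R -> R)
    (h U J W xi f e : nat -> R),
  0 < D -> (0 < N)%N -> (K1 < K)%N -> a_of theta0 * D <= 1 / 2 ->
  (forall i l, `|phi (grid D i) l 0| <= G) -> (forall i, `|h i| <= H) ->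
  (forall i, x (grid D i) = h i + U i + (J i + W i)) ->
  (forall i, e i = x (grid D i.+1) - (x (grid D i) + f i -
     (if (i < N + K1)%N then a_of theta0 else a_of thetas) * D * x (grid D i) +
     sigma * xi i)) ->
  (2 * a_of theta0 - a_of theta0 ^+ 2 * D) * D * \sum_(i < N) U i ^+ 2 =
     2 * (1 - a_of theta0 * D) * sigma * \sum_(i < N) U i * xi i +
     sigma ^+ 2 * \sum_(i < N) xi i ^+ 2 - U N ^+ 2 ->
  averages_close hp phi theta0 thetas D N K K1 f f eps ->
  path_error D N K K1 (fun l i => phi (grid D i) l 0) h U J W xi
    (fun i => x (grid D i)) e
    (fun i => f i - D * \sum_l phi (grid D i) l 0 * mu_of theta0 l 0) <= eps ^+ 2 ->
  `|kappaQ hp theta0 thetas| / 2 * (K%:R * D) <=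
    Num.sqrt D * `|Qhat phi D x N K|.

(** Divide sqrt D * Qhat by K D. The path increment vanishes; the averages of phi l
    tend to the indicator of the constant regressor; the average of the process
    tends to xs = mu_1* / a_*. With theta_hat close to theta0 the limit is
    a xs - mu_1 = kappa, up to Ctot eps. The constraints on eps make the Gram
    matrix non-degenerate and the last error at most |kappa| / 2. *)
Lemma detection_threshold (R : realType) (p : nat) (hp : (0 < p)%N)
    (theta0 thetas : 'cV[R]_(p + 1)) (G H sigma : R) :
  0 < sigma -> 0 <= G -> 0 <= H -> 0 < a_of theta0 -> 0 < a_of thetas ->
  kappaQ hp theta0 thetas != 0 ->
  exists eps : R, [/\ 0 < eps, eps <= 1 & detection_level hp theta0 thetas G H sigma eps].
Proof.
rewrite /detection_level => sigma0 G0 H0 a0 as0 kap0; set kap := kappaQ _ _ _ in kap0 *.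
set a := a_of theta0 in a0 *; set as_ := a_of thetas in as0 *.
pose mu l := mu_of theta0 l 0; pose xs := mu_of thetas (Ordinal hp) 0 / as_.
have kapE : kap = a * xs - mu (Ordinal hp).
  rewrite /kap /kappaQ -/a -/as_ -/xs mulrBr; congr (_ - _).
  by rewrite mulrCA divff ?mulr1// gt_eqF.
pose c0 := sigma ^+ 2 / (128 * a).
have c00 : 0 < c0 by rewrite divr_gt0 ?exprn_gt0 ?mulr_gt0.
have H1 : 0 < 8 * (H ^+ 2 + 1) by rewrite mulr_gt0// ltr_wpDl ?sqr_ge0.
(* eta is the share of the quadratic form given to the regressors; it must leave
   the energy c0 of the noise larger than the cost 8 eta H^2 of the signal *)
pose eta := Num.min (1 / 2) (Num.min c0 (c0 / (8 * (H ^+ 2 + 1)))).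
have eta0 : 0 < eta by rewrite !lt_min divr_gt0//= c00 divr_gt0.
have eta2 : eta <= 1 / 2 by rewrite ge_min lexx.
have etac : eta <= c0 by rewrite !ge_min lexx orbT.
have etaH : 8 * eta * H ^+ 2 <= c0.
  have : eta <= c0 / (8 * (H ^+ 2 + 1)) by rewrite !ge_min lexx !orbT.
  by rewrite ler_pdivlMr//; have := sqr_ge0 H; nra.
pose c := eta / 8; have cpos : 0 < c by rewrite divr_gt0.
pose c1 := 4 * sigma + 2 * G + 2.
have c10 : 0 <= c1 by rewrite /c1; have := ltW sigma0; lra.
pose c2 := (3 + sigma) / as_ + 1.
have c20 : 0 <= c2 by rewrite /c2 addr_ge0// divr_ge0 ?(ltW as0)// addr_ge0// ltW.
pose c3 := (p%:R + 1) * c1 / c.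
have c30 : 0 <= c3 by rewrite /c3 divr_ge0 ?(ltW cpos)// mulr_ge0// addr_ge0.
pose Ctot := 1 + 2 * p%:R * c3 + \sum_l `|mu l| + c3 * (`|xs| + c2) + a * c2.
have smu0 : 0 <= \sum_l `|mu l| by exact: sumr_ge0.
have Ctot0 : 0 <= Ctot by rewrite /Ctot; nonneg.
have kap_gt0 : 0 < `|kap| by rewrite normr_gt0.
(* m eps <= 1, for each of these m, is one of the constraints on eps *)
pose m1 := 4 / eta; pose m2 := 4 * (p%:R + 4) / c0.
pose m3 := 64 * (2 * sigma + 1) / sigma ^+ 2; pose m4 := 2 * Ctot / `|kap|.
have m10 : 0 <= m1 by rewrite /m1; nonneg.
have m20 : 0 <= m2 by rewrite /m2; nonneg.
have m30 : 0 <= m3 by rewrite /m3; nonneg.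
have m40 : 0 <= m4 by rewrite /m4; nonneg.
have p0 : 0 <= p%:R :> R by [].
pose M := 4 + 2 * p%:R + m1 + m2 + m3 + m4.
have M0 : 0 < M by rewrite /M; lra.
pose eps := M^-1.
have eps0 : 0 < eps by rewrite invr_gt0.
have eps_4 : 4 * eps <= 1 by apply: mulr_inv_le1 => //; rewrite /M; lra.
have eps_p : 2 * p%:R * eps <= 1 by apply: mulr_inv_le1 => //; rewrite /M; lra.
have eps_1 : m1 * eps <= 1 by apply: mulr_inv_le1 => //; rewrite /M; lra.
have eps_2 : m2 * eps <= 1 by apply: mulr_inv_le1 => //; rewrite /M; lra.
have eps_3 : m3 * eps <= 1 by apply: mulr_inv_le1 => //; rewrite /M; lra.
have eps_5 : m4 * eps <= 1 by apply: mulr_inv_le1 => //; rewrite /M; lra.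
have eps_eta : 4 * eps <= eta.
  by move: eps_1; rewrite /m1 mulrAC ler_pdivrMr// mul1r.
have eps_c0 : 4 * eps * (p%:R + 4) <= c0.
  by move: eps_2; rewrite /m2 mulrAC ler_pdivrMr// mul1r mulrAC.
have eps_sig : eps * (2 * sigma + 1) <= sigma ^+ 2 / 64.
  move: eps_3; rewrite /m3 mulrAC ler_pdivrMr ?exprn_gt0// mul1r.
  rewrite ler_pdivlMr//; by clear; lra.
have eps_kap : Ctot * eps <= `|kap| / 2.
  by move: eps_5; rewrite /m4 mulrAC ler_pdivrMr// mul1r ler_pdivlMr//; clear; lra.
have eps_le1 : eps <= 1 by clear -eps_4 eps0; lra.
exists eps; split=> // phi D N K K1 x h U J W xi f e D0 N0 K1K aD phiG hH xE eE energy.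
move=> [gram reps feps meps] small.
have K0 : 0 < K%:R :> R by rewrite ltr0n (leq_ltn_trans _ K1K).
have e4 : eps <= 1 / 4 by clear -eps_4; lra.
have eps0' := ltW eps0.
have low := energy_lower_bound D0 N0 sigma0 a0 aD energy eps0' eps_le1 small e4 eps_sig.
rewrite -/a -/c0 in low.
have [gU ghU gZ] := gram_error_small (ltW D0) eps0' eps_le1 small.
have gramlow v : c * sqr_norm v <= avg N (fun i => regressor phi D x v i ^+ 2).
  have epsp : eps * p%:R <= 1 / 2 by clear -eps_p; lra.
  have := gram_lower_bound H0 c00 eta0 eta2 etac etaH eps0' epsp eps_eta eps_c0
    (fun l => mu_of v l 0) (a_of v) N0 gram gU ghU low gZ hH.
  rewrite -/c /sqr_norm => /le_trans; apply; rewrite le_eqVlt; apply/orP; left.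
  apply/eqP; congr avg; apply/funext => i; rewrite /regressor xE; congr (_ ^+ 2).
have [noise_phi noise_x] := noise_bounds D0 N0 sigma0 G0 phiG xE eE eps0' eps_le1 small reps.
have c1e0 : 0 <= c1 * eps by exact: mulr_ge0.
have err := least_squares_error D0 N0 cpos c1e0 gramlow noise_phi noise_x.
set th := theta_hat phi D x N in err.
have comp (b : R) : b ^+ 2 <= sqr_norm (th - theta0) -> `|b| <= c3 * eps.
  move=> hb; rewrite -(ler_pXn2r (n := 2)) ?nnegrE//; last exact: mulr_ge0.
  rewrite real_normK ?num_real//; apply: le_trans hb (le_trans err _).
  have -> : (c3 * eps) ^+ 2 = (p%:R + 1) ^+ 2 * (c1 * eps) ^+ 2 / c ^+ 2.
    by rewrite /c3; field; rewrite gt_eqF.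
  rewrite ler_wpM2r ?invr_ge0 ?sqr_ge0// ler_wpM2r ?sqr_ge0//.
  by rewrite expr2 ler_peMr ?lerDr// addr_ge0.
have sq0 : 0 <= \sum_l mu_of (th - theta0) l 0 ^+ 2.
  by apply: sumr_ge0 => l _; exact: sqr_ge0.
have err_mu l : `|mu_of th l 0 - mu l| <= c3 * eps.
  have -> : mu_of th l 0 - mu l = mu_of (th - theta0) l 0 by rewrite /mu /mu_of !mxE.
  apply: comp; rewrite /sqr_norm (bigD1 l)//= -addrA lerDl addr_ge0 ?sqr_ge0//.
  by apply: sumr_ge0 => k _; exact: sqr_ge0.
have err_a : `|a_of th - a| <= c3 * eps.
  have -> : a_of th - a = a_of (th - theta0) by rewrite /a /a_of !mxE.
  by apply: comp; rewrite /sqr_norm lerDr.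
have meanX := post_change_mean D0 K1K sigma0 as0 eE eps0' eps_le1 small feps.
rewrite -/as_ -/xs -/c2 in meanX.
set A := K%:R^-1 * _ in meanX.
pose m l := K%:R^-1 * \sum_(N <= i < N + K) phi (grid D i) l 0.
have [xbd _ _ _] := monitoring_error_small (ltW D0) eps0' eps_le1 small.
pose b := (K%:R * D)^-1 * (x (grid D (N + K)) - x (grid D N)).
have KD0 : 0 < (K%:R * D)^-1 by rewrite invr_gt0 mulr_gt0.
have bE : `|b| <= eps.
  rewrite normrM (ger0_norm (ltW KD0)); apply: le_trans xbd.
  rewrite ler_wpM2l ?(ltW KD0)//; apply: le_trans (ler_normB _ _) _.
  by rewrite lerDl.
have SE : (K%:R * D)^-1 * (Num.sqrt D * Qhat phi D x N K) =
    b - \sum_l mu_of th l 0 * m l + a_of th * A.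
  rewrite sqrt_mesh_Qhat// mulrBr -/b -addrA; congr (_ + _).
  rewrite /regressor sumrB exchange_big/= -/th.
  have -> : \sum_l mu_of th l 0 * m l =
     K%:R^-1 * \sum_l \sum_(N <= i < N + K) phi (grid D i) l 0 * mu_of th l 0.
    rewrite mulr_sumr; apply: eq_bigr => l _; rewrite /m -mulr_suml; ring.
  have -> : a_of th * A = K%:R^-1 * \sum_(N <= i < N + K) x (grid D i) * a_of th.
    by rewrite /A -mulr_suml; ring.
  by field; rewrite !gt_eqF.
have diff : `|(K%:R * D)^-1 * (Num.sqrt D * Qhat phi D x N K) - kap| <= Ctot * eps.
  have -> : (K%:R * D)^-1 * (Num.sqrt D * Qhat phi D x N K) - kap =
     b - \sum_l (mu_of th l 0 * m l - mu l * (l == Ordinal hp)%:R) +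
     ((a_of th - a) * A + a * (A - xs)).
    have -> : \sum_l (mu_of th l 0 * m l - mu l * (l == Ordinal hp)%:R) =
       \sum_l mu_of th l 0 * m l - mu (Ordinal hp).
      rewrite sumrB; congr (_ - _); rewrite (bigD1 (Ordinal hp))// eqxx mulr1.
      by rewrite big1 /= ?addr0// => l /negbTE ->; rewrite mulr0.
    by rewrite SE kapE; ring.
  have t1 : `|\sum_l (mu_of th l 0 * m l - mu l * (l == Ordinal hp)%:R)| <=
      2 * p%:R * (c3 * eps) + (\sum_l `|mu l|) * eps.
    apply: le_trans (ler_norm_sum _ _ _) _.
    have -> : 2 * p%:R * (c3 * eps) + (\sum_l `|mu l|) * eps =
       \sum_l (2 * (c3 * eps) + `|mu l| * eps).
      by rewrite big_split/= sumr_const card_ord -(mulr_natl (2 * _)) mulr_suml; congr (_ + _); ring.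
    apply: ler_sum => l _.
    have -> : mu_of th l 0 * m l - mu l * (l == Ordinal hp)%:R =
      (mu_of th l 0 - mu l) * m l + mu l * (m l - (l == Ordinal hp)%:R) by ring.
    have ml : `|m l| <= 2.
      have := ler_normD (m l - (l == Ordinal hp)%:R) (l == Ordinal hp)%:R.
      rewrite subrK => /le_trans; apply.
      have b1 : `|(l == Ordinal hp)%:R| <= 1 :> R.
        by rewrite normr_nat lern1 leq_b1.
      have := meps l; rewrite -/(m l); clear -b1 eps_le1; lra.
    apply: le_trans (ler_normD _ _) _; rewrite (normrM (mu_of th l 0 - mu l)) (normrM (mu l)); apply: lerD.
      by rewrite mulrC; apply: ler_pM => //; exact: err_mu.
    by rewrite ler_wpM2l//; exact: meps.
  have t2 : `|(a_of th - a) * A| <= c3 * (`|xs| + c2) * eps.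
    have Ab : `|A| <= `|xs| + c2.
      have := ler_normD (A - xs) xs; rewrite subrK.
      have : c2 * eps <= c2 by rewrite ler_piMr.
      by move: meanX; clear; lra.
    rewrite normrM mulrAC; apply: ler_pM => //.
  have t3 : `|a * (A - xs)| <= a * c2 * eps.
    by rewrite normrM (ger0_norm (ltW a0)) -mulrA ler_wpM2l// ltW.
  apply: le_trans (ler_normD _ _) _.
  have t4 := ler_normB b (\sum_l (mu_of th l 0 * m l - mu l * (l == Ordinal hp)%:R)).
  have t5 := ler_normD ((a_of th - a) * A) (a * (A - xs)).
  have -> : Ctot * eps = eps + (2 * p%:R * (c3 * eps) + (\sum_l `|mu l|) * eps) +
     (c3 * (`|xs| + c2) * eps + a * c2 * eps) by rewrite /Ctot; ring.
  by move: t1 t2 t3 t4 t5 bE; clear; lra.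
have sD : 0 <= Num.sqrt D by rewrite sqrtr_ge0.
have low2 : `|kap| / 2 <= (K%:R * D)^-1 * (Num.sqrt D * `|Qhat phi D x N K|).
  have -> : (K%:R * D)^-1 * (Num.sqrt D * `|Qhat phi D x N K|) =
     `|(K%:R * D)^-1 * (Num.sqrt D * Qhat phi D x N K)|.
    by rewrite !normrM (ger0_norm (ltW KD0)) (ger0_norm sD).
  set S := (K%:R * D)^-1 * _ in diff *.
  have := ler_normB S (S - kap); rewrite opprB addrC subrK; by move: diff eps_kap; clear; lra.
move: low2; rewrite (mulrC _^-1) ler_pdivlMr ?mulr_gt0//.
Qed.

(** * The mean of the random errors *)

Lemma absmean_le_sqrZ d (T : measurableType d) (R : realType)
    (P : probability T R) (k : R) (f : T -> R) (c : R) :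
  absmean_le P (fun w => f w ^+ 2) c ->
  absmean_le P (fun w => (k * f w) ^+ 2) (k ^+ 2 * c).
Proof.
move=> /(absmean_leZ (k ^+ 2)); rewrite ger0_norm ?sqr_ge0//.
by under eq_fun do rewrite -exprMn.
Qed.

Lemma absmean_leZ_ge0 d (T : measurableType d) (R : realType)
    (P : probability T R) (k : R) (f : T -> R) (c : R) : 0 <= k ->
  absmean_le P f c -> absmean_le P (fun w => k * f w) (k * c).
Proof. by move=> k0 /(absmean_leZ k); rewrite ger0_norm. Qed.

Section path_error_mean.
Context d (Omega : measurableType d) (R : realType) (P : probability Omega R).
Variables (B : R -> {RV P >-> R}) (D : R).
Hypotheses (B_BM : brownian_motion B) (D_gt0 : 0 < D) (D_le1 : D <= 1).
Variables (a_ f_ : nat -> R) (sigma am aM C m0 : R).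
Hypotheses (am_gt0 : 0 < am) (a_ge : forall i, am <= a_ i)
  (a_le : forall i, a_ i <= aM) (aMD : aM * D <= 1 / 2)
  (D_small : 64 * aM ^+ 4 * D ^+ 2 <= am ^+ 2)
  (C_ge0 : 0 <= C) (f_le : forall i, `|f_ i| <= D * C).
Variables (X q : nat -> Omega -> R).
Hypotheses (mX : forall i, measurable_fun setT (X i))
  (X0_sqr : absmean_le P (fun w => X 0%N w ^+ 2) m0)
  (q_mean : forall i, absmean_le P (q i) (8 * D ^+ 3)).
Let err := euler_error B D a_ f_ sigma X.
Hypothesis error_ae : {ae P, forall w, forall i, err i w ^+ 2 <=
  16 * aM ^+ 2 * D ^+ 4 * (C ^+ 2 + aM ^+ 2 * X i w ^+ 2) +
  8 * aM ^+ 2 * sigma ^+ 2 * q i w}.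
Variables (p N K K1 : nat) (phi : 'I_p -> nat -> R) (G : R).
Hypotheses (N_gt0 : (0 < N)%N) (ND_ge1 : 1 <= N%:R * D)
  (NK : (N <= K)%N) (K1K : (K1 * N <= K)%N) (G_ge0 : 0 <= G)
  (phi_le : forall l i, `|phi l i| <= G).
Variable r : nat -> R.

Let xi := bincr B D.
Let h := signal D a_ f_.
Let U := noise B D a_ sigma.
Let J i w := decay D a_ i * X 0%N w.
Let W := remainder B D a_ f_ sigma X.
Let nv := noise_var sigma am.
Let rv := remainder_var sigma am aM C m0.
Let pv := process_var sigma am aM C m0.
Let ev := error_var sigma am aM C m0.
Let sv := remainder_step_var sigma am aM C m0.
Let T := N%:R * D.
Let s := Num.sqrt D.
Let kap := Num.sqrt (T * D).

(** Means over the horizon have variance of order 1 / T; the errors of the scheme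
    cost sqrt D, and the sum of the remainders against the increments, bounded
    through a summation by parts, sqrt (T D), which dominates as T >= 1. *)
Definition mesh_rate : R := T^-1 + kap.

Let NR : 0 < N%:R :> R. Proof. by rewrite ltr0n. Qed.
Let KN : N%:R <= K%:R :> R. Proof. by rewrite ler_nat. Qed.
Let KR : 0 < K%:R :> R. Proof. exact: lt_le_trans NR KN. Qed.
Let T0 : 0 < T. Proof. exact: mulr_gt0. Qed.
Let s0 : 0 < s. Proof. by rewrite sqrtr_gt0. Qed.
Let kap0 : 0 < kap. Proof. by rewrite sqrtr_gt0 mulr_gt0. Qed.
Let s2 : s ^+ 2 = D. Proof. by rewrite sqr_sqrtr// ltW. Qed.
Let kap2 : kap ^+ 2 = T * D. Proof. by rewrite sqr_sqrtr// ltW// mulr_gt0. Qed.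
Let Ti0 : 0 < T^-1. Proof. by rewrite invr_gt0. Qed.
Let skap : s <= kap.
Proof. by rewrite ler_wsqrtr// ler_peMl// ltW. Qed.
Let Dkap : D <= kap.
Proof.
apply: le_trans skap; rewrite -s2 expr2 ler_piMl ?(ltW s0)//.
by rewrite -(@expr_le1 _ 2) ?s2 ?(ltW s0).
Qed.
Let rate1 : T^-1 <= mesh_rate. Proof. by rewrite lerDl ltW. Qed.
Let rate2 : kap <= mesh_rate. Proof. by rewrite lerDr ltW. Qed.
Let rate3 : s <= mesh_rate. Proof. exact: le_trans skap rate2. Qed.
Let rate4 : D <= mesh_rate. Proof. exact: le_trans Dkap rate2. Qed.
Let rate0 : 0 < mesh_rate. Proof. exact: addr_gt0. Qed.

Let nv0 : 0 <= nv.
Proof. exact: absmean_le_ge0 (noise_second_moment B_BM D_gt0 sigma am_gt0 a_ge a_le aMD 0). Qed.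
Let pv0 : 0 <= pv.
Proof. exact: absmean_le_ge0 (process_second_moment B_BM D_gt0 D_le1 am_gt0 a_ge a_le aMD D_small C_ge0 f_le mX X0_sqr q_mean error_ae 0). Qed.

Let noise2 i : absmean_le P (fun w => U i w ^+ 2) nv :=
  noise_second_moment B_BM D_gt0 sigma am_gt0 a_ge a_le aMD i.
Let wnoise2 wt b := @weighted_noise_second_moment _ _ _ _ _ _ B_BM D_gt0 _ sigma
  _ _ am_gt0 a_ge a_le aMD wt b N.
Let mart2 := noise_martingale_second_moment B_BM D_gt0 sigma am_gt0 a_ge a_le aMD N.
Let rem2 i : absmean_le P (fun w => W i w ^+ 2) (rv * D) :=
  remainder_second_moment B_BM D_gt0 D_le1 am_gt0 a_ge a_le aMD D_small C_ge0 f_le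
    mX X0_sqr q_mean error_ae i.
Let err2 i : absmean_le P (fun w => err i w ^+ 2) (ev * D ^+ 3) :=
  error_second_moment B_BM D_gt0 D_le1 am_gt0 a_ge a_le aMD D_small C_ge0 f_le
    mX X0_sqr q_mean error_ae i.
Let err1 i : absmean_le P (err i) ((ev + 1) * D * s) :=
  error_abs_mean B_BM D_gt0 D_le1 am_gt0 a_ge a_le aMD D_small C_ge0 f_le
    mX X0_sqr q_mean error_ae i.
Let Xerr1 i : absmean_le P (fun w => X i w * err i w) ((pv + ev) * D * s) :=
  process_error_abs_mean B_BM D_gt0 D_le1 am_gt0 a_ge a_le aMD D_small C_ge0 f_le
    mX X0_sqr q_mean error_ae i.
Let X1 i : absmean_le P (X i) (pv + 1) :=
  process_abs_mean B_BM D_gt0 D_le1 am_gt0 a_ge a_le aMD D_small C_ge0 f_le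
    mX X0_sqr q_mean error_ae i.
Let trans2 := transient_energy B_BM D_gt0 D_le1 am_gt0 a_ge a_le aMD D_small C_ge0 f_le
    mX X0_sqr q_mean error_ae N.
Let sig2 := signal_noise_second_moment B_BM D_gt0 am_gt0 a_ge a_le aMD C_ge0 f_le N.
Let trans1 := transient_noise_abs_mean B_BM D_gt0 am_gt0 a_ge a_le aMD mX X0_sqr N.
Let remxi1 := remainder_noise_abs_mean B_BM D_gt0 D_le1 am_gt0 a_ge a_le aMD D_small
  C_ge0 f_le mX X0_sqr q_mean error_ae N kap0.
Let h_le i : `|h i| <= C / am := signal_le D_gt0 am_gt0 a_ge a_le aMD C_ge0 f_le i.

Let m00 : 0 <= m0. Proof. exact: absmean_le_ge0 X0_sqr. Qed.
Let rv0 : 0 <= rv.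
Proof. by have := absmean_le_ge0 (rem2 0); rewrite pmulr_lge0. Qed.
Let ev0 : 0 <= ev.
Proof. by have := absmean_le_ge0 (err2 0); rewrite pmulr_lge0// exprn_gt0. Qed.
Let sv0 : 0 <= sv.
Proof. by rewrite /sv /remainder_step_var -/rv -/ev; nonneg. Qed.
Let Dn0 : D != 0. Proof. by rewrite gt_eqF. Qed.
Let Nn0 : N%:R != 0 :> R. Proof. by rewrite gt_eqF. Qed.
Let an0 : am != 0. Proof. by rewrite gt_eqF. Qed.
Let Kn0 : K%:R != 0 :> R. Proof. by rewrite gt_eqF. Qed.

(* a bound k * u with u dominated by the rate *)
Let toRate (f : Omega -> R) (k u c : R) : 0 <= k -> u <= mesh_rate -> c = k * u ->
  absmean_le P f c -> absmean_le P f (k * mesh_rate).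
Proof. by move=> k0 ur ->; apply: absmean_leW; rewrite ler_wpM2l. Qed.

Let avgU (wt : nat -> R) b : (forall i, `|wt i| <= b) ->
  absmean_le P (fun w => avg N (fun i => wt i * U i w) ^+ 2)
    (8 * b ^+ 2 * sigma ^+ 2 / am ^+ 2 * mesh_rate).
Proof.
move=> wb; have := absmean_le_sqrZ N%:R^-1 (wnoise2 wb).
apply: (@toRate _ _ T^-1) => //; first by nonneg.
by rewrite /T; field; rewrite Dn0 Nn0 an0.
Qed.

Definition gram_const : R :=
  p%:R * (8 * G ^+ 2 * sigma ^+ 2 / am ^+ 2) +
  8 * (C / am) ^+ 2 * sigma ^+ 2 / am ^+ 2 + (2 * m0 / am + 2 * rv).

Lemma gram_error_mean :
  absmean_le P (fun w => gram_error N phi h (U ^~ w) (J ^~ w) (W ^~ w))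
    (gram_const * mesh_rate).
Proof.
have -> : gram_const * mesh_rate =
  p%:R * (8 * G ^+ 2 * sigma ^+ 2 / am ^+ 2 * mesh_rate) +
  8 * (C / am) ^+ 2 * sigma ^+ 2 / am ^+ 2 * mesh_rate +
  (2 * m0 / am * mesh_rate + 2 * rv * mesh_rate) by rewrite /gram_const; ring.
rewrite /gram_error; apply: absmean_leD; first apply: absmean_leD.
- have := absmean_le_sum (index_enum 'I_p) (fun l => avgU (phi_le l)).
  by rewrite sumr_const card_ord -(mulr_natl (_ * mesh_rate)).
- exact: avgU h_le.
- have iN : 0 <= N%:R^-1 :> R by rewrite invr_ge0.
  have := absmean_leZ_ge0 iN trans2; apply: absmean_leW; rewrite -/rv.
  have -> : N%:R^-1 * (2 * (m0 / (am * D)) + N%:R * (2 * rv * D)) =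
     2 * m0 / am * T^-1 + 2 * rv * D by rewrite /T; field; rewrite Dn0 Nn0 an0.
  by apply: lerD; apply: ler_wpM2l => //; nonneg.
Qed.

Definition energy_const : R := 8 * nv + 1 + nv.

Lemma energy_error_mean :
  absmean_le P (fun w => energy_error D N (U ^~ w) (xi ^~ w)) (energy_const * mesh_rate).
Proof.
have -> : energy_const * mesh_rate =
  8 * nv * mesh_rate + 1 * mesh_rate + nv * mesh_rate by rewrite /energy_const; ring.
rewrite /energy_error -/T; apply: absmean_leD; first apply: absmean_leD.
- have := absmean_le_sqrZ T^-1 mart2.
  apply: (@toRate _ _ T^-1) => //; first by nonneg.
  by rewrite -/nv /T; field; rewrite Dn0 Nn0.
- have := absmean_le_sqrZ N%:R^-1 (big_step_count_second_moment B_BM D_gt0 N).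
  move=> h1; apply: (@toRate _ _ N%:R^-1 _ ler01 _ _ h1).
    apply: le_trans rate1; rewrite lef_pV2 ?posrE// /T ler_piMr//.
  by field.
- have := absmean_leZ_ge0 (ltW Ti0) (noise2 N).
  by apply: (@toRate _ _ T^-1) => //; rewrite mulrC.
Qed.

Definition phi_noise_const : R := p%:R * (8 * G ^+ 2) + (ev + 1).

Let mean_err n c : 0 <= c ->
  absmean_le P (fun w => c * \sum_(i < n) `|err i w|) (c * (n%:R * ((ev + 1) * D * s))).
Proof.
move=> c0; apply: absmean_leZ_ge0 => //.
apply: (@absmean_le_sum_ord _ _ _ P n (fun i w => `|err i w|)) => i.
exact: absmean_le_norm.
Qed.

Lemma phi_noise_error_mean :
  absmean_le P (fun w => phi_noise_error D N phi (xi ^~ w) (err ^~ w))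
    (phi_noise_const * mesh_rate).
Proof.
have -> : phi_noise_const * mesh_rate =
  p%:R * (8 * G ^+ 2 * mesh_rate) + (ev + 1) * mesh_rate by rewrite /phi_noise_const; ring.
rewrite /phi_noise_error -/T; apply: absmean_leD.
- have one l : absmean_le P (fun w => (T^-1 * \sum_(i < N) phi l i * xi i w) ^+ 2)
      (8 * G ^+ 2 * mesh_rate).
    have := absmean_le_sqrZ T^-1 (weighted_bincr_second_moment B_BM D_gt0 (phi l) N).
    move=> h1; apply: absmean_leW h1.
    apply: (@le_trans _ _ (T^-1 ^+ 2 * (N%:R * (G ^+ 2 * (8 * D))))).
      rewrite ler_wpM2l ?sqr_ge0//.
      apply: (ler_sum_ord (F := fun i => phi l i ^+ 2 * (8 * D))) => i _.
      rewrite ler_wpM2r//; first by nonneg.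
      by rewrite -(real_normK (num_real (phi l i))) lerXn2r ?nnegrE.
    have -> : T^-1 ^+ 2 * (N%:R * (G ^+ 2 * (8 * D))) = 8 * G ^+ 2 * T^-1.
      by rewrite /T; field; rewrite Dn0 Nn0.
    by rewrite ler_wpM2l//; nonneg.
  have := absmean_le_sum (index_enum 'I_p) one.
  by rewrite sumr_const card_ord -(mulr_natl (_ * mesh_rate)).
- have := mean_err N (ltW Ti0); apply: (@toRate _ _ s) => //; first by nonneg.
  by rewrite /T; field; rewrite Dn0 Nn0.
Qed.

Definition process_noise_const : R :=
  (pv + ev) + 8 * (C / am) ^+ 2 + (m0 + 8 / am) + (rv + 8 + sv + 8).

Lemma process_noise_error_mean :
  absmean_le P (fun w => process_noise_error D N h (J ^~ w) (W ^~ w) (xi ^~ w)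
      (X ^~ w) (err ^~ w) r)
    (process_noise_const * mesh_rate + (pv + 1) * (T^-1 * \sum_(i < N) `|r i|)).
Proof.
have -> : process_noise_const * mesh_rate + (pv + 1) * (T^-1 * \sum_(i < N) `|r i|) =
  (pv + ev) * mesh_rate + (pv + 1) * (T^-1 * \sum_(i < N) `|r i|) +
  8 * (C / am) ^+ 2 * mesh_rate + (m0 + 8 / am) * mesh_rate +
  (rv + 8 + sv + 8) * mesh_rate by rewrite /process_noise_const; ring.
rewrite /process_noise_error -/T.
apply: absmean_leD; first apply: absmean_leD; first apply: absmean_leD; first apply: absmean_leD.
- have : absmean_le P (fun w => T^-1 * \sum_(i < N) `|X i w * err i w|)
      (T^-1 * (N%:R * ((pv + ev) * D * s))).
    apply: absmean_leZ_ge0; first exact: ltW.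
    apply: (@absmean_le_sum_ord _ _ _ P N (fun i w => `|X i w * err i w|)) => i.
    exact: absmean_le_norm.
  apply: (@toRate _ _ s) => //; first by nonneg.
  by rewrite /T; field; rewrite Dn0 Nn0.
- rewrite mulrCA; apply: absmean_leZ_ge0; first exact: ltW.
  have one (i : 'I_N) : absmean_le P (fun w => `|r i| * `|X i w|) (`|r i| * (pv + 1)).
    by apply: absmean_leZ_ge0 => //; exact: absmean_le_norm.
  have := absmean_le_sum (index_enum 'I_N) one.
  by rewrite -mulr_suml (mulrC _ (pv + 1)).
- have := absmean_le_sqrZ T^-1 sig2.
  apply: (@toRate _ _ T^-1) => //; first by nonneg.
  by rewrite /T; field; rewrite Dn0 Nn0 an0.
- have -> : (fun w => T^-1 * `|\sum_(i < N) J i w * xi i w|) =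
     (fun w => T^-1 * `|X 0%N w * \sum_(i < N) decay D a_ i * xi i w|).
    apply/funext => w; congr (_ * `|_|); rewrite mulr_sumr; apply: eq_bigr => i _.
    by rewrite /J; ring.
  have := absmean_leZ_ge0 (ltW Ti0) (absmean_le_norm trans1).
  by apply: (@toRate _ _ T^-1) => //; [nonneg|rewrite mulrC].
- have := absmean_leZ_ge0 (ltW Ti0) (absmean_le_norm remxi1).
  rewrite -/rv -/sv -/T -/s; apply: absmean_leW.
  have -> : T^-1 * (rv * s + 8 * T * s + kap * sv * T + 8 * T ^+ 2 * D / kap) =
     T^-1 * (rv * s) + 8 * s + sv * kap + 8 * kap.
    have -> : 8 * T ^+ 2 * D / kap = 8 * T * kap.
      have -> : 8 * T ^+ 2 * D = 8 * T * kap ^+ 2 by rewrite kap2; ring.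
      by field; rewrite gt_eqF.
    by field; rewrite gt_eqF.
  have Ti1 : T^-1 <= 1 by rewrite invf_le1.
  have h1 : T^-1 * (rv * s) <= rv * mesh_rate.
    apply: (@le_trans _ _ (rv * s)); last by rewrite ler_wpM2l.
    by rewrite ler_piMl//; nonneg.
  have h2 : sv * kap <= sv * mesh_rate by rewrite ler_wpM2l.
  have -> : (rv + 8 + sv + 8) * mesh_rate =
    rv * mesh_rate + 8 * mesh_rate + sv * mesh_rate + 8 * mesh_rate by ring.
  have := rate2; have := rate3.
  lra.
Qed.

Definition monitoring_const : R := 3 * (pv + 1) + (pv + 1) + 8 + 2 * (ev + 1).

Lemma monitoring_error_mean :
  absmean_le P (fun w => monitoring_error D N K K1 (xi ^~ w) (X ^~ w) (err ^~ w))
    (monitoring_const * mesh_rate).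
Proof.
have KD0 : 0 < (K%:R * D)^-1 by rewrite invr_gt0 mulr_gt0.
have KDT : (K%:R * D)^-1 <= T^-1.
  by rewrite lef_pV2 ?posrE ?mulr_gt0// ler_wpM2r// ltW.
have KDr : (K%:R * D)^-1 <= mesh_rate by exact: le_trans rate1.
have K1K' : (N + K1 <= N + K)%N.
  by rewrite leq_add2l (leq_trans _ K1K)// leq_pmulr.
have -> : monitoring_const * mesh_rate = 3 * (pv + 1) * mesh_rate + (pv + 1) * mesh_rate +
  8 * mesh_rate + 2 * (ev + 1) * mesh_rate by rewrite /monitoring_const; ring.
rewrite /monitoring_error; apply: absmean_leD; first apply: absmean_leD; first apply: absmean_leD.
- have := absmean_leZ_ge0 (ltW KD0) (absmean_leD (absmean_leD
    (absmean_le_norm (X1 (N + K)%N)) (absmean_le_norm (X1 N))) (absmean_le_norm (X1 (N + K1)%N))).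
  by apply: (@toRate _ _ (K%:R * D)^-1) => //; [nonneg|ring].
- have iK : 0 <= K%:R^-1 :> R by rewrite invr_ge0.
  have : absmean_le P (fun w => K%:R^-1 * \sum_(N <= i < N + K1) `|X i w|)
     (K%:R^-1 * (K1%:R * (pv + 1))).
    apply: absmean_leZ_ge0 => //.
    have := absmean_le_sum (index_iota N (N + K1)) (fun i => absmean_le_norm (X1 i)).
    by rewrite sumr_const_nat addKn (mulr_natl (pv + 1)).
  apply: absmean_leW.
  have -> : K%:R^-1 * (K1%:R * (pv + 1)) = (pv + 1) * (K1%:R / K%:R) by ring.
  apply: ler_wpM2l; first by nonneg.
  apply: (@le_trans _ _ N%:R^-1).
    rewrite ler_pdivrMr// mulrC ler_pdivlMr// -natrM ler_nat//.
  apply: le_trans rate1; rewrite lef_pV2 ?posrE// /T ler_piMr//.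
- have incr w : \sum_(N + K1 <= i < N + K) xi i w =
     B (grid D (N + K)) w - B (grid D (N + K1)) w.
    by rewrite -(telescope_sumr (fun i => B (grid D i) w)).
  have g0 : grid D (N + K1) <= grid D (N + K) by exact: grid_le.
  have := absmean_le_sqrZ (K%:R * D)^-1 (bdiff_second_moment B_BM (grid_ge0 D_gt0 _) g0).
  have -> : (fun w => ((K%:R * D)^-1 * (B (grid D (N + K)) w - B (grid D (N + K1)) w)) ^+ 2) =
     (fun w => ((K%:R * D)^-1 * \sum_(N + K1 <= i < N + K) xi i w) ^+ 2).
    by apply/funext => w; rewrite incr.
  apply: absmean_leW; apply: (@le_trans _ _ (8 * (K%:R * D)^-1)); last by rewrite ler_wpM2l.
  have -> : 8 * (K%:R * D)^-1 = (K%:R * D)^-1 ^+ 2 * (8 * (K%:R * D)).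
    by field; rewrite Dn0 Kn0.
  rewrite ler_wpM2l ?sqr_ge0// ler_wpM2l// /grid -mulrBl ler_wpM2r ?(ltW D_gt0)//.
  by rewrite !natrD; have : 0 <= K1%:R :> R by []; lra.
- have := mean_err (N + K) (ltW KD0); apply: absmean_leW.
  apply: (@le_trans _ _ (2 * (ev + 1) * s)).
    have -> : (K%:R * D)^-1 * ((N + K)%:R * ((ev + 1) * D * s)) =
      (N + K)%:R / K%:R * ((ev + 1) * s) by field; rewrite Dn0 Kn0.
    have -> : 2 * (ev + 1) * s = 2 * ((ev + 1) * s) by ring.
    rewrite ler_wpM2r//; first by nonneg.
    by rewrite ler_pdivrMr// natrD; have := KN; lra.
  by apply: ler_wpM2l => //; nonneg.
Qed.

Definition path_error_const : R :=
  gram_const + energy_const + phi_noise_const + process_noise_const + monitoring_const + (pv + 1).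

(** Every part of the path error is within a constant of the rate, but for the
    discretisation of the drift, kept apart as it has no rate. The constant does
    not depend on the horizon. *)
Lemma path_error_mean :
  absmean_le P (fun w => path_error D N K K1 phi h (U ^~ w) (J ^~ w) (W ^~ w)
      (xi ^~ w) (X ^~ w) (err ^~ w) r)
    (path_error_const * (mesh_rate + T^-1 * \sum_(i < N) `|r i|)).
Proof.
have := absmean_leD (absmean_leD (absmean_leD (absmean_leD gram_error_mean
  energy_error_mean) phi_noise_error_mean) process_noise_error_mean) monitoring_error_mean.
apply: absmean_leW; rewrite /path_error_const.
have r0 : 0 <= T^-1 * \sum_(i < N) `|r i|.
  by apply: mulr_ge0; [exact: ltW|exact: sumr_ge0].
have c1 : 0 <= gram_const by rewrite /gram_const; nonneg.
have c2 : 0 <= energy_const by rewrite /energy_const; nonneg.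
have c3 : 0 <= phi_noise_const by rewrite /phi_noise_const; nonneg.
have c4 : 0 <= process_noise_const by rewrite /process_noise_const; nonneg.
have c5 : 0 <= monitoring_const by rewrite /monitoring_const; nonneg.
have r1 := ltW rate0.
set rr := T^-1 * _ in r0 *.
have e1 : 0 <= (gram_const + energy_const + phi_noise_const + process_noise_const + monitoring_const) * rr.
  by nonneg.
have e2 : 0 <= (pv + 1) * mesh_rate by nonneg.
lra.
Qed.

End path_error_mean.

(** * Averages of the periodic regressors *)

Section tagged_sums.
Context (R : realType).
Implicit Types (A : R -> nat -> (nat -> R) -> R).

Definition cell_tags (D : R) (y : nat -> R) : Prop :=
  forall j, j%:R * D <= y j <= j.+1%:R * D.

(** A sum over n cells that is o(n D) as D tends to 0, up to an additive constant:
    after division by n D it vanishes when the mesh is small and the horizon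
    long. *)
Definition negligible_sum A : Prop := exists2 C : R, 0 <= C &
  forall e : R, 0 < e -> exists2 h : R, 0 < h &
  forall (D : R) (n : nat) (y : nat -> R), 0 < D -> D < h -> cell_tags D y ->
    A D n y <= n%:R * D * e + C.

Lemma negligible_sumD A A' : negligible_sum A -> negligible_sum A' ->
  negligible_sum (fun D n y => A D n y + A' D n y).
Proof.
move=> [C C0 HA] [C' C'0 HA']; exists (C + C'); first exact: addr_ge0.
move=> e e0; have e2 : 0 < e / 2 by rewrite divr_gt0.
have [h h0 H] := HA _ e2; have [h' h'0 H'] := HA' _ e2.
exists (Num.min h h'); first by rewrite lt_min h0.
move=> D n y D0; rewrite lt_min => /andP[Dh Dh'] ty.
have := H D n y D0 Dh ty; have := H' D n y D0 Dh' ty.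
have -> : n%:R * D * e + (C + C') = n%:R * D * (e / 2) + C + (n%:R * D * (e / 2) + C').
  by field.
by move=> h1 h2; apply: lerD.
Qed.

Lemma negligible_sum0 : negligible_sum (fun _ _ _ => 0).
Proof.
exists 0 => // e e0; exists 1 => // D n y D0 _ _.
by rewrite addr0 !mulr_ge0// ltW.
Qed.

Lemma negligible_sum_le A A' : (forall D n y, 0 < D -> cell_tags D y -> A D n y <= A' D n y) ->
  negligible_sum A' -> negligible_sum A.
Proof.
move=> AA' [C C0 HA]; exists C => // e e0; have [h h0 H] := HA e e0.
exists h => // D n y D0 Dh ty; exact: le_trans (AA' D n y D0 ty) (H D n y D0 Dh ty).
Qed.

Lemma negligible_sum_bigsum (I : finType) (A : I -> R -> nat -> (nat -> R) -> R) :
  (forall i, negligible_sum (A i)) ->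
  negligible_sum (fun D n y => \sum_i A i D n y).
Proof.
move=> HA; elim: (index_enum I) => [|i s IH].
  by apply: negligible_sum_le negligible_sum0 => D n y _ _; rewrite big_nil.
apply: negligible_sum_le (negligible_sumD (HA i) IH) => D n y _ _.
by rewrite big_cons.
Qed.

Section one_function.
Variables (f : R -> R) (v : R).
Hypotheses (f_int : is_riemann_integral f 0 1 v)
  (f_per : forall t, 0 <= t -> f (t + 1) = f t).

Lemma negligible_average :
  negligible_sum (fun D n y => `|\sum_(i < n) D * f (y i) - n%:R * D * v|).
Proof. exact: periodic_tagged_average f_int f_per. Qed.

(** At each cell the larger and the smaller of the two values define two systems
    of tags, whose sums have the same limit. *)
Lemma negligible_oscillation :
  negligible_sum (fun D n y => \sum_(i < n) D * `|f (y i) - f (i%:R * D)|).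
Proof.
have [C C0 HA] := negligible_average; exists (C + C); first exact: addr_ge0.
move=> e e0; have e2 : 0 < e / 2 by rewrite divr_gt0.
have [h h0 H] := HA _ e2; exists h => // D n y D0 Dh ty.
pose left (j : nat) := j%:R * D.
pose hi j := if f (left j) <= f (y j) then y j else left j.
pose lo j := if f (left j) <= f (y j) then left j else y j.
have tl : cell_tags D left.
  by move=> j; rewrite lexx /left ler_wpM2r ?(ltW D0)// ler_nat.
have thi : cell_tags D hi by move=> j; rewrite /hi; case: ifP.
have tlo : cell_tags D lo by move=> j; rewrite /lo; case: ifP.
have := H D n hi D0 Dh thi; have := H D n lo D0 Dh tlo.
have -> : \sum_(i < n) D * `|f (y i) - f (i%:R * D)| =
    (\sum_(i < n) D * f (hi i) - n%:R * D * v) -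
    (\sum_(i < n) D * f (lo i) - n%:R * D * v).
  rewrite opprB addrA subrK -sumrB; apply: eq_bigr => i _.
  rewrite -mulrBr /hi /lo -/(left i); case: leP => h1; congr (_ * _).
    by rewrite ger0_norm// subr_ge0.
  by rewrite ltr0_norm ?subr_lt0// opprB.
move=> h1 h2; apply: le_trans (ler_norm _) _; apply: le_trans (ler_normB _ _) _.
have -> : n%:R * D * e + (C + C) = n%:R * D * (e / 2) + C + (n%:R * D * (e / 2) + C).
  by field.
exact: lerD.
Qed.

End one_function.

(** The limit F of the Riemann sums of g over a cell is within one oscillation of
    the left-point value; the point y serves as a tag of that cell. *)
Lemma rsum_limit_oscillation (g : R -> R) (s L F e : R) : 0 < L -> 0 < e ->
  rsum g s L n @[n --> \oo] --> F ->
  exists2 y : R, s <= y <= s + L & `|F - L * g s| <= L * `|g y - g s| + e.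
Proof.
move=> L0 e0 /cvgrPdist_lt/(_ _ e0)[n _ /(_ n (leqnn n)) /= Fn].
pose u (k : 'I_n.+1) := s + k%:R * (L / n.+1%:R).
have [k kmax] : exists k, forall j, `|g (u j) - g s| <= `|g (u k) - g s|.
  pose k0 : 'I_n.+1 := [arg max_(k > ord0 | true) `|g (u k) - g s|]%O.
  by exists k0 => j; rewrite /k0; case: arg_maxP => // i _; apply.
have n0 : 0 < n.+1%:R :> R by [].
exists (u k).
  have Ln : 0 <= L / n.+1%:R by rewrite divr_ge0 ?(ltW L0).
  rewrite /u lerDl mulr_ge0//= lerD2l mulrCA ler_piMr ?(ltW L0)//.
  by rewrite ler_pdivrMr// mul1r ler_nat ltnW.
have dif : `|rsum g s L n - L * g s| <= L * `|g (u k) - g s|.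
  have -> : rsum g s L n - L * g s = L / n.+1%:R * \sum_(j < n.+1) (g (u j) - g s).
    rewrite sumrB sumr_const card_ord -(mulr_natl (g s)) mulrBr /rsum; congr (_ - _).
    by rewrite mulrA divfK ?gt_eqF.
  rewrite normrM ger0_norm ?divr_ge0 ?(ltW L0)// -mulrA ler_wpM2l ?(ltW L0)//.
  rewrite mulrC ler_pdivrMr//; apply: le_trans (ler_norm_sum _ _ _) _.
  have : \sum_(j < n.+1) `|g (u j) - g s| <= \sum_(j < n.+1) `|g (u k) - g s|.
    by apply: ler_sum => j _.
  by rewrite sumr_const card_ord -(mulr_natl `|_|) mulrC.
have := ler_normD (F - rsum g s L n) (rsum g s L n - L * g s).
by rewrite addrA subrK; lra.
Qed.

End tagged_sums.

Section regressor_averages.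
Context (R : realType) (p : nat) (hp : (0 < p)%N) (phi : R -> 'cV[R]_p).
Hypotheses (phi1 : forall t : R, 0 <= t -> phi t (Ordinal hp) 0 = 1)
  (phi_per : forall t : R, 0 <= t -> phi (t + 1) = phi t)
  (phi_orth : forall j k : 'I_p,
     is_riemann_integral (fun t => (phi t *m (phi t)^T) j k) 0 1
       ((1%:M : 'M[R]_p) j k)).

Let gramE t j k : (phi t *m (phi t)^T) j k = phi t j 0 * phi t k 0.
Proof. by rewrite mxE big_ord1 mxE. Qed.

Let gram1 t j : 0 <= t -> (phi t *m (phi t)^T) j (Ordinal hp) = phi t j 0.
Proof. by move=> t0; rewrite gramE phi1// mulr1. Qed.

Let gram_per j k t : 0 <= t ->
  (phi (t + 1) *m (phi (t + 1))^T) j k = (phi t *m (phi t)^T) j k.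
Proof. by move=> t0; rewrite phi_per. Qed.

Lemma regressor_bounded : exists2 G : R, 0 <= G & forall t l, 0 <= t -> `|phi t l 0| <= G.
Proof.
have H l : exists G, 0 <= G /\ forall t, 0 <= t -> `|phi t l 0| <= G.
  have [G G0 HG] := riemann_periodic_bounded (phi_orth l (Ordinal hp)) (@gram_per _ _).
  by exists G; split=> // t t0; rewrite -gram1// HG.
have [G HG] := choice H; exists (\sum_l G l); first by apply: sumr_ge0 => l _; case: (HG l).
move=> t l t0; rewrite (bigD1 l)//=; have [G0 Gl] := HG l.
apply: le_trans (Gl t t0) _; rewrite lerDl; apply: sumr_ge0 => k _; by case: (HG k).
Qed.

Definition gram_deviation (D : R) (n : nat) (y : nat -> R) : R :=
  \sum_l \sum_m `|\sum_(i < n) D * (phi (y i) *m (phi (y i))^T) l m -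
                  n%:R * D * (l == m)%:R|.

Definition regressor_oscillation (D : R) (n : nat) (y : nat -> R) : R :=
  \sum_l \sum_(i < n) D * `|phi (y i) l 0 - phi (i%:R * D) l 0|.

Lemma negligible_gram_deviation : negligible_sum gram_deviation.
Proof.
apply: negligible_sum_bigsum => l; apply: negligible_sum_bigsum => m.
by have := negligible_average (phi_orth l m) (@gram_per _ _); rewrite mxE.
Qed.

Lemma negligible_regressor_oscillation : negligible_sum regressor_oscillation.
Proof.
apply: negligible_sum_bigsum => l.
apply: negligible_sum_le (negligible_oscillation (phi_orth l (Ordinal hp)) (@gram_per _ _)).
move=> D n y D0 ty; rewrite le_eqVlt; apply/orP; left; apply/eqP.
apply: eq_bigr => i _; rewrite !gram1//; first by rewrite mulr_ge0// ltW.
by have /andP[+ _] := ty i; apply: le_trans; rewrite mulr_ge0// ltW.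
Qed.

Definition mean_level (theta : 'cV[R]_(p + 1)) (t : R) : R :=
  ((mu_of theta)^T *m phi t) 0 0.

Lemma mean_levelE theta t : mean_level theta t = \sum_l phi t l 0 * mu_of theta l 0.
Proof. by rewrite /mean_level mxE; apply: eq_bigr => l _; rewrite mxE mulrC. Qed.

(** The integrals of the drift over the cells, given as limits of Riemann sums. The
    alternative lets F be completed by left-point values on the cells where the
    other parameter rules the process. *)
Definition cell_integral (theta : 'cV[R]_(p + 1)) (D : R) (F : nat -> R) : Prop :=
  forall i, rsum (mean_level theta) (grid D i) D n @[n --> \oo] --> F i \/
    F i = D * mean_level theta (grid D i).

Lemma drift_sum_error theta : exists2 C : R, 0 <= C & forall e : R, 0 < e ->
  exists2 h : R, 0 < h & forall D n (F : nat -> R), 0 < D -> D < h ->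
  cell_integral theta D F ->
  \sum_(i < n) `|F i - D * \sum_l phi (grid D i) l 0 * mu_of theta l 0| <= n%:R * D * e + C.
Proof.
have [C C0 HC] := negligible_regressor_oscillation.
pose M := \sum_l `|mu_of theta l 0| + 1.
have M0 : 0 < M by rewrite ltr_wpDl//; exact: sumr_ge0.
have muM l : `|mu_of theta l 0| <= M.
  rewrite /M (bigD1 l)//= -addrA lerDl addr_ge0//; exact: sumr_ge0.
exists (M * C); first by rewrite mulr_ge0// ltW.
move=> e e0; have e2 : 0 < e / (2 * M) by rewrite divr_gt0// mulr_gt0.
have [h h0 H] := HC _ e2; exists h => // D n F D0 Dh cF.
have /choice[y Hy] i : exists y, grid D i <= y <= grid D i + D /\
    `|F i - D * mean_level theta (grid D i)| <=
    D * `|mean_level theta y - mean_level theta (grid D i)| + D * (e / 2).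
  have De : 0 < D * (e / 2) by rewrite mulr_gt0// divr_gt0.
  case: (cF i) => [lim|->]; first by have [y yi yF] := rsum_limit_oscillation D0 De lim; exists y.
  by exists (grid D i); rewrite !subrr normr0 mulr0 add0r lexx lerDl !ltW.
have ty : cell_tags D y.
  by move=> j; have [+ _] := Hy j; rewrite /grid -natr1 mulrDl mul1r.
have := H D n y D0 Dh ty => hosc.
have one i : `|F i - D * \sum_l phi (grid D i) l 0 * mu_of theta l 0| <=
    M * \sum_l D * `|phi (y i) l 0 - phi (i%:R * D) l 0| + D * (e / 2).
  rewrite -mean_levelE; apply: le_trans (Hy i).2 _; rewrite lerD2r.
  rewrite -mulr_sumr mulrCA ler_wpM2l ?(ltW D0)// !mean_levelE -sumrB mulr_sumr.
  apply: le_trans (ler_norm_sum _ _ _) _; apply: ler_sum => l _.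
  by rewrite -mulrBl normrM mulrC ler_wpM2r.
have : \sum_(i < n) `|F i - D * \sum_l phi (grid D i) l 0 * mu_of theta l 0| <=
    M * regressor_oscillation D n y + n%:R * (D * (e / 2)).
  apply: le_trans (ler_sum _ (fun (i : 'I_n) _ => one i)) _.
  rewrite big_split/= sumr_const card_ord -(mulr_natl (D * _)) lerD2r.
  by rewrite -mulr_sumr /regressor_oscillation exchange_big.
move=> /le_trans; apply.
have -> : n%:R * D * e + M * C = M * (n%:R * D * (e / (2 * M)) + C) + n%:R * (D * (e / 2)).
  by field; rewrite gt_eqF.
by rewrite lerD2r ler_wpM2l// ltW.
Qed.

Lemma negligible_left A : @negligible_sum R A ->
  negligible_sum (fun D n _ => A D n (fun i => grid D i)).
Proof.
move=> [C C0 HA]; exists C => // e e0; have [h h0 H] := HA e e0.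
exists h => // D n y D0 Dh _; apply: H => // j.
by rewrite lexx /grid ler_wpM2r ?(ltW D0)// ler_nat.
Qed.

Lemma gram_prefix_le D n l m : 0 < D ->
  `|\sum_(i < n) D * (phi (grid D i) l 0 * phi (grid D i) m 0) - n%:R * D * (l == m)%:R| <=
  gram_deviation D n (fun i => grid D i).
Proof.
move=> D0; rewrite /gram_deviation (bigD1 l)//= (bigD1 m)//= -!addrA.
under eq_bigr do rewrite -gramE.
rewrite lerDl addr_ge0//; first exact: sumr_ge0.
by apply: sumr_ge0 => k _; exact: sumr_ge0.
Qed.

Lemma regressor_prefix_le D n l : 0 < D ->
  `|\sum_(i < n) D * phi (grid D i) l 0 - n%:R * D * (l == Ordinal hp)%:R| <=
  gram_deviation D n (fun i => grid D i).
Proof.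
move=> D0; apply: le_trans (gram_prefix_le n l (Ordinal hp) D0).
rewrite le_eqVlt; apply/orP; left; apply/eqP; congr `|_ - _|.
by apply: eq_bigr => i _; rewrite phi1 ?mulr1// mulr_ge0// ltW.
Qed.

Lemma drift_prefix_error theta : exists2 C : R, 0 <= C & forall e : R, 0 < e ->
  exists2 h : R, 0 < h & forall D n (F : nat -> R), 0 < D -> D < h ->
  cell_integral theta D F ->
  `|\sum_(i < n) F i - n%:R * D * mu_of theta (Ordinal hp) 0| <= n%:R * D * e + C.
Proof.
have [C C0 HC] := drift_sum_error theta.
have [C' C'0 HC'] := negligible_left negligible_gram_deviation.
pose M := \sum_l `|mu_of theta l 0| + 1.
have M0 : 0 < M by rewrite ltr_wpDl//; exact: sumr_ge0.
exists (C + M * C'); first by rewrite addr_ge0// mulr_ge0// ltW.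
move=> e e0; have e2 : 0 < e / 2 by rewrite divr_gt0.
have eM : 0 < e / (2 * M) by rewrite divr_gt0// mulr_gt0.
have [h h0 H] := HC _ e2; have [h' h'0 H'] := HC' _ eM.
exists (Num.min h h'); first by rewrite lt_min h0.
move=> D n F D0; rewrite lt_min => /andP[Dh Dh'] cF.
have b1 := H D n F D0 Dh cF.
have tl : cell_tags D (fun i => grid D i).
  by move=> j; rewrite lexx /grid ler_wpM2r ?(ltW D0)// ler_nat.
have b2 := H' D n _ D0 Dh' tl.
have -> : \sum_(i < n) F i - n%:R * D * mu_of theta (Ordinal hp) 0 =
  \sum_(i < n) (F i - D * \sum_l phi (grid D i) l 0 * mu_of theta l 0) +
  \sum_l mu_of theta l 0 *
    (\sum_(i < n) D * phi (grid D i) l 0 - n%:R * D * (l == Ordinal hp)%:R).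
  have -> : \sum_l mu_of theta l 0 *
      (\sum_(i < n) D * phi (grid D i) l 0 - n%:R * D * (l == Ordinal hp)%:R) =
    \sum_l mu_of theta l 0 * (\sum_(i < n) D * phi (grid D i) l 0) -
    n%:R * D * mu_of theta (Ordinal hp) 0.
    under eq_bigr do rewrite mulrBr.
    rewrite sumrB; congr (_ - _); rewrite (bigD1 (Ordinal hp))// eqxx mulr1 big1 /= ?addr0.
      by rewrite mulrC.
    by move=> l /negbTE ->; rewrite !mulr0.
  rewrite sumrB addrA; congr (_ - _); rewrite -[LHS](subrK (\sum_(i < n)
    D * \sum_l phi (grid D i) l 0 * mu_of theta l 0)); congr (_ + _).
  under [RHS]eq_bigr do rewrite mulr_sumr.
  rewrite exchange_big/=; apply: eq_bigr => i _; rewrite mulr_sumr.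
  by apply: eq_bigr => l _; ring.
apply: le_trans (ler_normD _ _) _.
have -> : n%:R * D * e + (C + M * C') =
  n%:R * D * (e / 2) + C + M * (n%:R * D * (e / (2 * M)) + C').
  by field; rewrite gt_eqF.
apply: lerD; first by apply: le_trans (ler_norm_sum _ _ _) b1.
apply: le_trans (ler_norm_sum _ _ _) _.
apply: (@le_trans _ _ (M * gram_deviation D n (fun i => grid D i))); last first.
  by rewrite ler_wpM2l// ltW.
apply: (@le_trans _ _ (\sum_l `|mu_of theta l 0| * gram_deviation D n (fun i => grid D i))).
  by apply: ler_sum => l _; rewrite normrM ler_wpM2l// regressor_prefix_le.
rewrite -mulr_suml ler_wpM2r ?lerDl//.
by apply: sumr_ge0 => l _; exact: sumr_ge0.
Qed.

End regressor_averages.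

(** Differences of prefix sums; the K1 indices cut off the window cost a fraction
    K1 / K <= 1 / N = D / T. *)
Lemma window_average (R : realType) (f : nat -> R) (D v e C : R) (N K K1 : nat) :
  0 < D -> (0 < N)%N -> (N <= K)%N -> (K1 * N <= K)%N -> 0 <= e -> 0 <= C ->
  (forall n, `|\sum_(i < n) f i - n%:R * D * v| <= n%:R * D * e + C) ->
  `|(K%:R * D)^-1 * \sum_(N + K1 <= i < N + K) f i - v| <=
    4 * e + (2 * C + `|v| * D) / (N%:R * D).
Proof.
move=> D0 N0 NK K1K e0 C0 H.
have NR : 0 < N%:R :> R by rewrite ltr0n.
have KR : 0 < K%:R :> R by rewrite ltr0n (leq_trans N0).
have NKR : N%:R <= K%:R :> R by rewrite ler_nat.
have K1K' : (K1 <= K)%N by rewrite (leq_trans _ K1K)// leq_pmulr.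
have K1KR : K1%:R <= K%:R :> R by rewrite ler_nat.
have K1N : K1%:R * N%:R <= K%:R :> R by rewrite -natrM ler_nat.
have K10 : 0 <= K1%:R :> R by [].
have win : \sum_(N + K1 <= i < N + K) f i = \sum_(i < N + K) f i - \sum_(i < N + K1) f i.
  rewrite -!(big_mkord predT f) (@big_cat_nat _ _ _ (N + K1)%N 0%N (N + K)%N)//= ?leq_add2l//.
  by rewrite addrAC subrr add0r.
have H1 := H (N + K)%N; have H2 := H (N + K1)%N.
have KD : 0 < K%:R * D by rewrite mulr_gt0.
have ND : 0 < N%:R * D by rewrite mulr_gt0.
rewrite -(ler_pM2l KD) -{1}(ger0_norm (ltW KD)) -normrM mulrBr mulrA mulfV ?gt_eqF// mul1r win.
rewrite natrD in H1; rewrite natrD in H2.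
set S1 := \sum_(i < N + K) f i in H1 *; set S2 := \sum_(i < N + K1) f i in H2 *.
have -> : S1 - S2 - K%:R * D * v =
  (S1 - (N%:R + K%:R) * D * v) - (S2 - (N%:R + K1%:R) * D * v) - K1%:R * D * v by ring.
apply: le_trans (ler_normB _ _) _.
have h1 := ler_normB (S1 - (N%:R + K%:R) * D * v) (S2 - (N%:R + K1%:R) * D * v).
have h2 : `|K1%:R * D * v| <= K%:R * D * (`|v| / N%:R).
  rewrite normrM ger0_norm; last by rewrite mulr_ge0// ltW.
  have -> : K%:R * D * (`|v| / N%:R) = K%:R / N%:R * D * `|v| by ring.
  by rewrite ler_wpM2r// ler_wpM2r ?(ltW D0)// ler_pdivlMr.
have -> : K%:R * D * (4 * e + (2 * C + `|v| * D) / (N%:R * D)) =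
  4 * (K%:R * D * e) + K%:R / N%:R * (2 * C) + K%:R * D * (`|v| / N%:R).
  by field; rewrite !gt_eqF.
have De : 0 <= D * e by rewrite mulr_ge0// ltW.
have h3 : (N%:R + K%:R) * D * e + (N%:R + K1%:R) * D * e <= 4 * (K%:R * D * e) by nra.
have h4 : 2 * C <= K%:R / N%:R * (2 * C).
  by rewrite ler_peMl ?mulr_ge0// ler_pdivlMr// mul1r.
lra.
Qed.

Lemma regressor_averages (R : realType) (p : nat) (hp : (0 < p)%N) (phi : R -> 'cV[R]_p)
    (theta0 thetas : 'cV[R]_(p + 1)) :
  (forall t : R, 0 <= t -> phi t (Ordinal hp) 0 = 1) ->
  (forall t : R, 0 <= t -> phi (t + 1) = phi t) ->
  (forall j k : 'I_p,
     is_riemann_integral (fun t => (phi t *m (phi t)^T) j k) 0 1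
       ((1%:M : 'M[R]_p) j k)) ->
  forall e : R, 0 < e -> exists2 h : R, 0 < h & exists T0 : R,
  forall (D : R) (N K K1 : nat) (F0 Fs : nat -> R),
  0 < D -> D < h -> (0 < N)%N -> T0 <= N%:R * D -> (N <= K)%N -> (K1 * N <= K)%N ->
  cell_integral phi theta0 D F0 -> cell_integral phi thetas D Fs ->
  averages_close hp phi theta0 thetas D N K K1 F0 Fs e.
Proof.
move=> phi1 phi_per phi_orth e e0.
have e8 : 0 < e / 8 by rewrite divr_gt0.
have [Cg Cg0 HCg] := negligible_left (negligible_gram_deviation phi_per phi_orth).
have [hg hg0 Hg] := HCg _ e8.
have [C1 C10 HC1] := drift_sum_error phi1 phi_per phi_orth theta0.
have [h1 h10 H1] := HC1 _ e8.
have [C2 C20 HC2] := drift_prefix_error phi1 phi_per phi_orth thetas.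
have [h2 h20 H2] := HC2 _ e8.
pose mu := `|mu_of thetas (Ordinal hp) 0|.
have mu0 : 0 <= mu by exact: normr_ge0.
pose S := C1 + (2 * C2 + mu) + (2 * Cg + 1).
have S0 : 0 < S by rewrite /S; lra.
exists (Num.min 1 (Num.min hg (Num.min h1 h2))).
  by rewrite !lt_min ltr01 hg0 h10.
exists (2 * S / e) => D N K K1 F0 Fs D0.
rewrite !lt_min => /andP[D1 /andP[Dg /andP[Dh1 Dh2]]] N0 T0 NK K1K cF0 cFs.
have NR : 0 < N%:R :> R by rewrite ltr0n.
have KR : 0 < K%:R :> R by rewrite ltr0n (leq_trans N0).
have ND : 0 < N%:R * D by rewrite mulr_gt0.
have ST : S / (N%:R * D) <= e / 2.
  rewrite ler_pdivrMr//; move: T0; rewrite ler_pdivrMr//; lra.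
have leST c : c <= S -> c / (N%:R * D) <= e / 2.
  by move=> cS; apply: le_trans ST; rewrite ler_wpM2r// invr_ge0 ltW.
have tl : cell_tags D (fun i => grid D i).
  by move=> j; rewrite lexx /grid ler_wpM2r ?(ltW D0)// ler_nat.
have dev n := Hg D n _ D0 Dg tl.
split.
- move=> l m; have b1 := gram_prefix_le phi N l m D0.
  have b2 := le_trans b1 (dev N).
  rewrite -(ler_pM2l ND) -{1}(ger0_norm (ltW ND)) -normrM mulrBr.
  have -> : N%:R * D * avg N (fun i => phi (grid D i) l 0 * phi (grid D i) m 0) =
      \sum_(i < N) D * (phi (grid D i) l 0 * phi (grid D i) m 0).
    by rewrite /avg -mulr_sumr; field; rewrite gt_eqF.
  apply: le_trans b2 _; have := leST Cg; rewrite ler_pdivrMr//.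
  have -> : N%:R * D * e = N%:R * D * (e / 8) + 3 * (N%:R * D * (e / 8)) + e / 2 * (N%:R * D) by field.
  have : 0 <= N%:R * D * (e / 8) by rewrite mulr_ge0// ltW.
  by move=> h3 /(_ _)/wrap[]; [rewrite /S; lra|lra].
- have b1 := H1 D N F0 D0 Dh1 cF0.
  rewrite mulrC ler_pdivrMr//; apply: le_trans b1 _.
  have := leST C1; rewrite ler_pdivrMr//.
  have -> : e * (N%:R * D) = N%:R * D * (e / 8) + 3 * (N%:R * D * (e / 8)) + e / 2 * (N%:R * D) by field.
  have : 0 <= N%:R * D * (e / 8) by rewrite mulr_ge0// ltW.
  by move=> h3 /(_ _)/wrap[]; [rewrite /S; lra|lra].
- apply: le_trans (window_average D0 N0 NK K1K (ltW e8) C20 (fun n => H2 D n Fs D0 Dh2 cFs)) _.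
  have : mu * D <= mu by rewrite ler_piMr// ltW.
  move=> muD; have := leST (2 * C2 + mu * D); rewrite -/mu.
  by move=> /(_ _)/wrap[]; [rewrite /S; lra|lra].
- move=> l; have K0 : (0 * N <= K)%N by [].
  have pre n : `|\sum_(i < n) D * phi (grid D i) l 0 - n%:R * D * (l == Ordinal hp)%:R| <=
      n%:R * D * (e / 8) + Cg by exact: le_trans (regressor_prefix_le phi1 n l D0) (dev n).
  have := window_average (f := fun i => D * phi (grid D i) l 0) D0 N0 NK K0 (ltW e8) Cg0 pre.
  rewrite addn0.
  have -> : (K%:R * D)^-1 * \sum_(N <= i < N + K) D * phi (grid D i) l 0 =
     K%:R^-1 * \sum_(N <= i < N + K) phi (grid D i) l 0.
    by rewrite -mulr_sumr; field; rewrite !gt_eqF.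
  move=> /le_trans; apply.
  have dl : `|(l == Ordinal hp)%:R : R| * D <= 1.
    by rewrite normr_nat; case: (l == _); rewrite ?mul1r ?mul0r ?(ltW D1).
  have := leST (2 * Cg + `|(l == Ordinal hp)%:R| * D).
  by move=> /(_ _)/wrap[]; [rewrite /S; lra|lra].
Qed.

(** * Measurability of the detector *)

Section detector_measurable.
Context d (Omega : measurableType d) (R : realType).

Definition mx_measurable m n (A : Omega -> 'M[R]_(m, n)) : Prop :=
  forall i j, measurable_fun setT (fun w => A w i j).

Lemma mx_measurable_mul m n k (A : Omega -> 'M[R]_(m, n)) (A' : Omega -> 'M[R]_(n, k)) :
  mx_measurable A -> mx_measurable A' -> mx_measurable (fun w => A w *m A' w).
Proof.
move=> mA mA' i j; under eq_fun do rewrite mxE.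
by apply: measurable_sum => l; apply: measurable_funM.
Qed.

Lemma mx_measurable_tr m n (A : Omega -> 'M[R]_(m, n)) :
  mx_measurable A -> mx_measurable (fun w => (A w)^T).
Proof. by move=> mA i j; under eq_fun do rewrite mxE; exact: mA. Qed.

Lemma measurable_det n (A : Omega -> 'M[R]_n) :
  mx_measurable A -> measurable_fun setT (fun w => \det (A w)).
Proof.
move=> mA; rewrite /determinant; apply: measurable_sum => s.
apply: measurable_funM => //; apply: measurable_prod => i _; exact: mA.
Qed.

Lemma mx_measurable_adj n (A : Omega -> 'M[R]_n) :
  mx_measurable A -> mx_measurable (fun w => \adj (A w)).
Proof.
move=> mA i j; under eq_fun do rewrite mxE.
apply: measurable_funM => //; apply: measurable_det => k l.
by under eq_fun do rewrite !mxE; exact: mA.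
Qed.

(** x^-1 = x (x^2)^-1, where the inverse of x^2 is its real power of exponent -1;
    at x = 0 both sides vanish. *)
Lemma measurable_funV (f : Omega -> R) :
  measurable_fun setT f -> measurable_fun setT (fun w => (f w)^-1).
Proof.
move=> mf; have -> : (fun w => (f w)^-1) = (fun w => f w * ((f w ^+ 2) `^ (-1))).
  apply/funext => w; rewrite powR_inv1 ?sqr_ge0//.
  have [->|f0] := eqVneq (f w) 0; first by rewrite invr0 mul0r.
  by field.
apply: measurable_funM => //.
by apply: (measurableT_comp (measurable_powR _)); exact: measurable_funX.
Qed.

(** Cramer's rule off the singular set, the identity on it. *)
Lemma mx_measurable_inv n (A : Omega -> 'M[R]_n) :
  mx_measurable A -> mx_measurable (fun w => invmx (A w)).
Proof.
move=> mA i j.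
have -> : (fun w => invmx (A w) i j) =
    (fun w => if \det (A w) == 0 then A w i j else (\det (A w))^-1 * \adj (A w) i j).
  apply/funext => w; rewrite /invmx unitmxE unitfE.
  by case: eqP => //= _; rewrite mxE.
have mdet := measurable_det mA.
apply: measurable_fun_ifT.
- by apply: measurable_fun_eqr.
- exact: mA.
- apply: measurable_funM; last exact: mx_measurable_adj.
  exact: measurable_funV.
Qed.

Variables (p : nat) (phi : R -> 'cV[R]_p) (D : R) (X : R -> Omega -> R).
Hypothesis mX : forall t, measurable_fun setT (X t).

Let path w (t : R) := X t w.

Lemma measurable_Yobs i : measurable_fun setT (fun w => Yobs D (path w) i).
Proof. by apply: measurable_funM => //; exact: (measurable_funB (mX _) (mX _)). Qed.

Lemma mx_measurable_Zobs i : mx_measurable (fun w => Zobs phi D (path w) i).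
Proof.
move=> k l; under eq_fun do rewrite mxE; apply: measurable_funM => //.
under eq_fun do rewrite mxE; case: (fintype.split k) => k'; first exact: measurable_cst.
under eq_fun do rewrite mxE.
case: (k' == l); last exact: measurable_cst.
by under eq_fun do rewrite mulr1n; exact: (measurable_funN (mX _)).
Qed.

Lemma mx_measurable_theta_hat N : mx_measurable (fun w => theta_hat phi D (path w) N).
Proof.
have mZ : mx_measurable (fun w => Zmat phi D (path w) N).
  by move=> i j; under eq_fun do rewrite mxE mxE; exact: mx_measurable_Zobs.
have mZT := mx_measurable_tr mZ.
apply: mx_measurable_mul; last first.
  by move=> i j; under eq_fun do rewrite mxE; exact: measurable_Yobs.
apply: mx_measurable_mul => //; apply: mx_measurable_inv; exact: mx_measurable_mul.
Qed.

Lemma measurable_Qhat N K : measurable_fun setT (fun w => Qhat phi D (path w) N K).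
Proof.
apply: measurable_sum => i; apply: measurable_funB; first exact: measurable_Yobs.
have := mx_measurable_mul (mx_measurable_tr (mx_measurable_Zobs i))
  (mx_measurable_theta_hat N).
exact.
Qed.

End detector_measurable.

Section boundary.
Context (R : realType) (gamma : R) (N K : nat).
Hypotheses (gamma_ge0 : 0 <= gamma) (N_gt0 : (0 < N)%N) (K_gt0 : (0 < K)%N).

Let NR : 0 < N%:R :> R. Proof. by rewrite ltr0n. Qed.
Let KR : 0 < K%:R :> R. Proof. by rewrite ltr0n. Qed.
Let KN : 0 < K%:R / N%:R :> R. Proof. exact: divr_gt0. Qed.

Lemma g1_gt0 : 0 < g1 gamma N K.
Proof.
rewrite /g1 !mulr_gt0 ?sqrtr_gt0 ?addr_gt0// /ell powR_gt0// divr_gt0// addr_gt0//.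
Qed.

(** The factor ell is at most 1 as gamma >= 0. *)
Lemma g1_le : g1 gamma N K <= (N%:R + K%:R) / Num.sqrt N%:R.
Proof.
have sN : 0 < Num.sqrt N%:R :> R by rewrite sqrtr_gt0.
have ell1 : ell gamma (K%:R / N%:R) <= 1.
  have p1 : 1 `^ gamma = 1 :> R by rewrite powR1.
  rewrite /ell -[leRHS]p1; apply: ge0_ler_powR; rewrite ?nnegrE//.
  by rewrite ler_pdivrMr ?addr_gt0// mul1r lerDr.
have -> : (N%:R + K%:R) / Num.sqrt N%:R = Num.sqrt N%:R * (1 + K%:R / N%:R) :> R.
  move: (sqr_sqrtr (ltW NR)) sN; move: (Num.sqrt _) => s <- s0.
  by field; rewrite gt_eqF.
by rewrite /g1 ler_piMr// mulr_ge0 ?(ltW sN)// addr_ge0// ltW.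
Qed.

End boundary.

Section detector_events.
Context d (Omega : measurableType d) (R : realType) (p : nat) (phi : R -> 'cV[R]_p).
Variables (D gamma c sigma : R) (N : nat) (X : R -> Omega -> R).
Hypothesis mX : forall t, measurable_fun setT (X t).

Lemma supQ_gtP (x : R -> R) (M : R) :
  (M%:E < supQ phi D x gamma N)%E <->
  exists2 K : nat, (1 <= K)%N & M < `|Qhat phi D x N K| / g1 gamma N K.
Proof.
split=> [/ereal_sup_gt[_ [K K1 <-]]|[K K1 MK]]; first by rewrite lte_fin; exists K.
apply: lt_le_trans (ereal_sup_ubound _); last by exists K.
by rewrite lte_fin.
Qed.

Lemma tauQ_ltyP (x : R -> R) :
  (tauQ phi D x c sigma gamma N < +oo)%E <->
  exists2 K : nat, (1 <= K)%N & gbound c sigma gamma N K <= `|Qhat phi D x N K|.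
Proof.
split=> [/ereal_inf_lt[_ [K [K1 KQ] <-] _]|[K K1 KQ]]; first by exists K.
apply: le_lt_trans (ereal_inf_lbound _) (ltry K%:R).
by exists K.
Qed.

Lemma measurable_supQ_gt M :
  measurable [set w | (M%:E < supQ phi D (fun t => X t w) gamma N)%E].
Proof.
have -> : [set w | (M%:E < supQ phi D (fun t => X t w) gamma N)%E] =
    \bigcup_(K in [set K | (1 <= K)%N])
      [set w | M < `|Qhat phi D (fun t => X t w) N K| / g1 gamma N K].
  by apply/seteqP; split=> w; [move=> /supQ_gtP[K ? ?]|move=> [K ? ?]; apply/supQ_gtP];
    exists K.
apply: bigcup_measurable => K _.
rewrite -[X in measurable X]setTI; apply: measurable_fun_ltr => //.
apply: measurable_funM => //; apply: measurableT_comp => //.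
exact: (measurable_Qhat phi D mX N K).
Qed.

Lemma measurable_tauQ_lty :
  measurable [set w | (tauQ phi D (fun t => X t w) c sigma gamma N < +oo)%E].
Proof.
have -> : [set w | (tauQ phi D (fun t => X t w) c sigma gamma N < +oo)%E] =
    \bigcup_(K in [set K | (1 <= K)%N])
      [set w | gbound c sigma gamma N K <= `|Qhat phi D (fun t => X t w) N K|].
  by apply/seteqP; split=> w; [move=> /tauQ_ltyP[K ? ?]|move=> [K ? ?]; apply/tauQ_ltyP];
    exists K.
apply: bigcup_measurable => K _.
rewrite -[X in measurable X]setTI; apply: measurable_fun_ler => //.
apply: measurableT_comp => //; exact: (measurable_Qhat phi D mX N K).
Qed.

Lemma supQ_gt_tauQ_lty (x : R -> R) : (0 < N)%N ->
  ((c * sigma)%:E < supQ phi D x gamma N)%E -> (tauQ phi D x c sigma gamma N < +oo)%E.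
Proof.
move=> N0 /supQ_gtP[K K1 MK]; apply/tauQ_ltyP; exists K => //.
by rewrite /gbound -ler_pdivlMr ?g1_gt0// ltW.
Qed.

End detector_events.

(** * The Euler scheme satisfied by the observed process *)

Section regimes.
Context (R : realType) (p : nat) (phi : R -> 'cV[R]_p).
Variables (theta0 thetas : 'cV[R]_(p + 1)) (tau : nat) (D : R).

Definition regime (i : nat) : 'cV[R]_(p + 1) :=
  if (i < tau)%N then theta0 else thetas.

Definition cell_drift (i : nat) : R :=
  limn (rsum (mean_level phi (regime i)) (grid D i) D).

Variables (sigma C : R).
Hypotheses (D_gt0 : 0 < D) (sigma_ge0 : 0 <= sigma) (C_ge0 : 0 <= C)
  (a0_gt0 : 0 < a_of theta0) (as_gt0 : 0 < a_of thetas)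
  (a0D : a_of theta0 * D <= 1 / 2) (asD : a_of thetas * D <= 1 / 2)
  (level0_le : forall u, 0 <= u -> `|mean_level phi theta0 u| <= C)
  (levels_le : forall u, 0 <= u -> `|mean_level phi thetas u| <= C).

Lemma observed_step (x b : R -> R) (i : nat) :
  {within `[0, +oo[, continuous x} -> {within `[0, +oo[, continuous b} ->
  solves_sde phi sigma theta0 `[0, grid D tau] x b ->
  solves_sde phi sigma thetas `[grid D tau, +oo[ x b ->
  exists beta, [/\
    rsum (mean_level phi (regime i)) (grid D i) D n @[n --> \oo] --> cell_drift i,
    rsum (fun u => `|b u - b (grid D i)|) (grid D i) D n @[n --> \oo] --> beta,
    0 <= beta &
    `|x (grid D i.+1) - (x (grid D i) + cell_drift i -
        a_of (regime i) * D * x (grid D i) +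
        sigma * (b (grid D i.+1) - b (grid D i)))| <=
      a_of (regime i) * (2 * D ^+ 2 * (C + a_of (regime i) * `|x (grid D i)|) +
        2 * sigma * beta)].
Proof.
move=> cx cb sde0 sdes.
have g0 := grid_ge0 D_gt0 i.
have sub : `[grid D i, grid D i + D] `<=` (`[0, +oo[ : set R).
  by move=> u /=; rewrite !in_itv/= andbT => /andP[+ _]; exact: le_trans.
have cx' := continuous_subspaceW sub cx; have cb' := continuous_subspaceW sub cb.
have a_gt0 : 0 < a_of (regime i) by rewrite /regime; case: ifP.
have aD : a_of (regime i) * D <= 1 / 2 by rewrite /regime; case: ifP.
have level_le u : grid D i <= u <= grid D i + D -> `|mean_level phi (regime i) u| <= C.
  move=> /andP[u0 _]; have u0' := le_trans g0 u0.
  by rewrite /regime; case: ifP => _; [exact: level0_le|exact: levels_le].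
have sde v : grid D i <= v <= grid D i + D ->
    is_riemann_integral (fun u => mean_level phi (regime i) u - a_of (regime i) * x u)
      (grid D i) v (x v - x (grid D i) - sigma * (b v - b (grid D i))).
  move=> /andP[v1 v2]; rewrite /regime; case: ltnP => itau.
    have it := grid_le D_gt0 itau; rewrite gridS in it.
    apply: (sde0 (grid D i) v) => //=; rewrite in_itv/=.
      by rewrite g0 (le_trans v1 (le_trans v2 it)).
    by rewrite (le_trans g0 v1) (le_trans v2 it).
  have it := grid_le D_gt0 itau.
  by apply: (sdes (grid D i) v) => //=; rewrite in_itv/= ?it// (le_trans it v1).
have [F [beta [cF cb2 beta0 err]]] :=
  path_step D_gt0 (ltW a_gt0) aD sigma_ge0 C_ge0 cx' cb' level_le sde.
have FE : cell_drift i = F by exact: cvg_lim.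
by exists beta; rewrite FE gridS.
Qed.

Lemma cell_drift_le i :
  rsum (mean_level phi (regime i)) (grid D i) D n @[n --> \oo] --> cell_drift i ->
  `|cell_drift i| <= D * C.
Proof.
move=> /cvg_norm cF; have D0 := ltW D_gt0; have g0 := grid_ge0 D_gt0 i.
apply: (cvgr_to_le cF); near=> n.
apply: le_trans (ler_norm_rsum _ _ _ D0) _; rewrite -(rsum_cst C (grid D i) D n).
apply: ler_rsum => // u /andP[u0 _]; have u0' := le_trans g0 u0.
by rewrite /regime; case: ifP => _; [exact: level0_le|exact: levels_le].
Unshelve. all: by end_near. Qed.

End regimes.

Lemma sqr_step_error (R : realType) (a aM D C sigma x beta e : R) :
  0 <= a -> a <= aM -> 0 <= D -> 0 <= C -> 0 <= sigma -> 0 <= beta ->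
  `|e| <= a * (2 * D ^+ 2 * (C + a * `|x|) + 2 * sigma * beta) ->
  e ^+ 2 <= 16 * aM ^+ 2 * D ^+ 4 * (C ^+ 2 + aM ^+ 2 * x ^+ 2) +
    8 * aM ^+ 2 * sigma ^+ 2 * beta ^+ 2.
Proof.
move=> a0 aaM D0 C0 s0 b0 he; have aM0 := le_trans a0 aaM.
have x0 := normr_ge0 x.
have he' : `|e| <= aM * (2 * D ^+ 2 * (C + aM * `|x|) + 2 * sigma * beta).
  apply: le_trans he _; apply: ler_pM => //; first by nonneg.
  rewrite lerD2r; apply: ler_wpM2l; first by nonneg.
  by rewrite lerD2l; apply: ler_wpM2r.
have -> : e ^+ 2 = `|e| ^+ 2 by rewrite real_normK ?num_real.
have -> : x ^+ 2 = `|x| ^+ 2 by rewrite real_normK ?num_real.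
apply: (@le_trans _ _ ((aM * (2 * D ^+ 2 * (C + aM * `|x|) + 2 * sigma * beta)) ^+ 2)).
  by rewrite lerXn2r ?nnegrE//; nonneg.
move: `|x| x0 => y y0.
have sq2 (u v : R) : (u + v) ^+ 2 <= 2 * u ^+ 2 + 2 * v ^+ 2.
  by have := sqr_ge0 (u - v); rewrite sqrrB sqrrD; lra.
have h1 := sq2 (2 * D ^+ 2 * (C + aM * y)) (2 * sigma * beta).
have h2 := sq2 C (aM * y).
have aM2 := sqr_ge0 aM; have D4 : 0 <= D ^+ 4 by nonneg.
apply: (@le_trans _ _ (aM ^+ 2 * (8 * D ^+ 4 * (2 * C ^+ 2 + 2 * (aM * y) ^+ 2) +
   8 * sigma ^+ 2 * beta ^+ 2))).
  rewrite exprMn ler_wpM2l//; apply: le_trans h1 _.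
  have -> : 2 * (2 * D ^+ 2 * (C + aM * y)) ^+ 2 = 8 * D ^+ 4 * (C + aM * y) ^+ 2 by ring.
  have -> : 2 * (2 * sigma * beta) ^+ 2 = 8 * sigma ^+ 2 * beta ^+ 2 by ring.
  by rewrite lerD2r; apply: ler_wpM2l => //; nonneg.
rewrite le_eqVlt; apply/orP; left; apply/eqP; ring.
Qed.

Lemma ae_exists d (Omega : measurableType d) (R : realType) (P : probability Omega R)
  (Q : Omega -> Prop) : {ae P, forall w, Q w} -> exists w, Q w.
Proof.
move=> [A [mA PA0 QA]]; apply: contrapT => noQ.
have AT : A = setT by apply/seteqP; split=> // w _; apply: QA => Qw; apply: noQ; exists w.
by move: PA0; rewrite AT probability_setT => /eqP; rewrite onee_eq0.
Qed.

Section one_horizon.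
Context d (Omega : measurableType d) (R : realType) (P : probability Omega R).
Variables (B : R -> {RV P >-> R}) (B_BM : brownian_motion B).
Variables (p : nat) (phi : R -> 'cV[R]_p).
Variables (theta0 thetas : 'cV[R]_(p + 1)) (D sigma C G m0 : R) (N K K1 : nat).
Hypotheses (D_gt0 : 0 < D) (D_le1 : D <= 1) (sigma_ge0 : 0 <= sigma) (C_ge0 : 0 <= C)
  (a0_gt0 : 0 < a_of theta0) (as_gt0 : 0 < a_of thetas)
  (level0_le : forall u, 0 <= u -> `|mean_level phi theta0 u| <= C)
  (levels_le : forall u, 0 <= u -> `|mean_level phi thetas u| <= C)
  (G_ge0 : 0 <= G) (phi_le : forall u l, 0 <= u -> `|phi u l 0| <= G).
Let am := Num.min (a_of theta0) (a_of thetas).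
Let aM := Num.max (a_of theta0) (a_of thetas).
Hypotheses (aMD : aM * D <= 1 / 2) (D_small : 64 * aM ^+ 4 * D ^+ 2 <= am ^+ 2)
  (N_gt0 : (0 < N)%N) (ND_ge1 : 1 <= N%:R * D)
  (NK : (N <= K)%N) (K1K : (K1 * N <= K)%N).
Variable X : R -> {RV P >-> R}.
Hypothesis X0_sqr : absmean_le P (fun w => X 0 w ^+ 2) m0.
Hypothesis X_sde : {ae P, forall w,
  [/\ {within `[0, +oo[, continuous (fun t : R => X t w)},
      solves_sde phi sigma theta0 `[0, grid D (N + K1)] (fun t => X t w) (fun t => B t w)
    & solves_sde phi sigma thetas `[grid D (N + K1), +oo[
        (fun t => X t w) (fun t => B t w)]}.

Let th := regime theta0 thetas (N + K1).
Let a_ i := a_of (th i).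
Let f_ := cell_drift phi theta0 thetas (N + K1) D.
Let X_ i : Omega -> R := X (grid D i).
Let q i := sqr_displacement B (grid D i) D.

Let am_gt0 : 0 < am. Proof. by rewrite lt_min a0_gt0. Qed.

Let a_ge i : am <= a_ i.
Proof. by rewrite /a_ /th /regime /am; case: ifP => _; rewrite ge_min lexx ?orbT. Qed.

Let a_le i : a_ i <= aM.
Proof. by rewrite /a_ /th /regime /aM; case: ifP => _; rewrite le_max lexx ?orbT. Qed.

Let D0 : 0 <= D. Proof. exact: ltW. Qed.

Let a0D : a_of theta0 * D <= 1 / 2.
Proof. by apply: le_trans aMD; rewrite ler_wpM2r// le_max lexx. Qed.

Let asD : a_of thetas * D <= 1 / 2.
Proof. by apply: le_trans aMD; rewrite ler_wpM2r// le_max lexx orbT. Qed.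

Let step := observed_step D_gt0 sigma_ge0 C_ge0 a0_gt0 as_gt0 a0D asD
  level0_le levels_le (tau := N + K1).

(** The limit does not involve the path, so a single path that solves the equation
    shows that it exists. *)
Lemma cell_drift_cvg i : rsum (mean_level phi (th i)) (grid D i) D n @[n --> \oo] --> f_ i.
Proof.
have [_ _ _ B_cont] := B_BM.
have [w [[cX sde0 sdes] cB]] : exists w, [/\ {within `[0, +oo[, continuous (fun t : R => X t w)},
      solves_sde phi sigma theta0 `[0, grid D (N + K1)] (fun t => X t w) (fun t => B t w)
    & solves_sde phi sigma thetas `[grid D (N + K1), +oo[
        (fun t => X t w) (fun t => B t w)] /\
    {within `[0, +oo[, continuous (fun t : R => B t w)}.
  by apply: (@ae_exists _ _ _ P); apply: filterS2 X_sde B_cont => w.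
by have [beta []] := step i cX cB sde0 sdes.
Qed.

Let f_le i : `|f_ i| <= D * C.
Proof. exact (cell_drift_le D_gt0 level0_le levels_le (@cell_drift_cvg i)). Qed.

Lemma observed_error_ae : {ae P, forall w, forall i,
  euler_error B D a_ f_ sigma X_ i w ^+ 2 <=
  16 * aM ^+ 2 * D ^+ 4 * (C ^+ 2 + aM ^+ 2 * X_ i w ^+ 2) +
  8 * aM ^+ 2 * sigma ^+ 2 * q i w}.
Proof.
have [_ _ _ B_cont] := B_BM.
apply: filterS2 X_sde B_cont => w [cX sde0 sdes] cB i.
have [beta [_ cbeta beta0 err]] := step i cX cB sde0 sdes.
rewrite /q (sqr_displacementE cbeta).
by apply: (sqr_step_error (ltW (lt_le_trans am_gt0 (a_ge i))) (a_le i) D0 C_ge0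
  sigma_ge0 beta0 err).
Qed.

Variables (hp : (0 < p)%N) (eps e : R).
Hypotheses (eps_gt0 : 0 < eps) (e_eps : e <= eps) (K1_lt : (K1 < K)%N)
  (level : detection_level hp theta0 thetas G (C / am) sigma eps).
Hypothesis averages : forall F0 Fs : nat -> R,
  cell_integral phi theta0 D F0 -> cell_integral phi thetas D Fs ->
  averages_close hp phi theta0 thetas D N K K1 F0 Fs e.

Let r i := f_ i - D * \sum_l phi (grid D i) l 0 * mu_of theta0 l 0.

Lemma observed_averages :
  averages_close hp phi theta0 thetas D N K K1 f_ f_ e.
Proof.
pose F0 i := if (i < N + K1)%N then f_ i else D * mean_level phi theta0 (grid D i).
pose Fs i := if (i < N + K1)%N then D * mean_level phi thetas (grid D i) else f_ i.
have c0 : cell_integral phi theta0 D F0.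
  move=> i; rewrite /F0; case: ltnP => iN; [left|by right].
  by have := @cell_drift_cvg i; rewrite /th /regime iN.
have cs : cell_integral phi thetas D Fs.
  move=> i; rewrite /Fs; case: ltnP => iN; [by right|left].
  by have := @cell_drift_cvg i; rewrite /th /regime ltnNge iN.
have [h1 h2 h3 h4] := averages c0 cs; split=> //.
  have -> : \sum_(i < N) `|r i| =
      \sum_(i < N) `|F0 i - D * \sum_l phi (grid D i) l 0 * mu_of theta0 l 0| => //.
  by apply: eq_bigr => i _; rewrite /F0 ltn_addr.
have -> : \sum_(N + K1 <= i < N + K) f_ i = \sum_(N + K1 <= i < N + K) Fs i => //.
by apply: eq_big_nat => i /andP[iN _]; rewrite /Fs ltnNge iN.
Qed.

Let pc := path_error_const sigma am aM C m0 p G.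

(** Off the event where path_error exceeds eps^2, which Markov's inequality
    bounds, the pathwise detection applies. *)
Lemma detection_probability :
  ((1 - pc * (mesh_rate D N + e) / eps ^+ 2)%:E <=
   P [set w | (`|kappaQ hp theta0 thetas| / 2 * (K%:R * D) <=
     Num.sqrt D * `|Qhat phi D (fun t => X t w) N K|)%R])%E.
Proof.
have [avg1 avg2 avg3 avg4] := observed_averages.
have close : averages_close hp phi theta0 thetas D N K K1 f_ f_ eps.
  by split=> [l m||| l]; apply: le_trans e_eps.
have q_mean i : absmean_le P (q i) (8 * D ^+ 3).
  by apply: sqr_displacement_mean => //; exact: grid_ge0.
have mX i : measurable_fun setT (X_ i) by [].
have X00 : absmean_le P (fun w => X_ 0%N w ^+ 2) m0 by rewrite /X_ /grid mul0r.
have phi_grid l i : `|phi (grid D i) l 0| <= G by apply: phi_le; exact: grid_ge0.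
have := path_error_mean B_BM D_gt0 D_le1 am_gt0 a_ge a_le aMD D_small C_ge0 f_le mX X00
  q_mean observed_error_ae N_gt0 ND_ge1 NK K1K G_ge0 phi_grid r.
set pe := (fun w => _) => peM.
have rate0 : 0 < mesh_rate D N.
  rewrite /mesh_rate ltr_wpDr ?sqrtr_ge0// invr_gt0 mulr_gt0// ltr0n//.
have r0 : 0 <= (N%:R * D)^-1 * \sum_(i < N) `|r i|.
  by rewrite mulr_ge0 ?invr_ge0 ?mulr_ge0//; exact: sumr_ge0.
have pc0 : 0 <= pc.
  by have := absmean_le_ge0 peM; rewrite pmulr_lge0// ltr_wpDr.
have eps2 : 0 < eps ^+ 2 by rewrite exprn_gt0.
have pe_le : absmean_le P pe (pc * (mesh_rate D N + e)).
  by apply: absmean_leW peM; rewrite ler_wpM2l// lerD2l.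
have bad := markov_absmean eps2 pe_le.
have mbad : measurable [set w | eps ^+ 2 <= `|pe w|].
  have [mpe _] := pe_le.
  rewrite -[X in measurable X]setTI; apply: measurable_fun_ler => //.
  exact: measurableT_comp.
rewrite EFinB leeBlDr//.
apply: (@le_trans _ _ (P [set w | (`|kappaQ hp theta0 thetas| / 2 * (K%:R * D) <=
     Num.sqrt D * `|Qhat phi D (fun t => X t w) N K|)%R] + P [set w | (eps ^+ 2 <= `|pe w|)%R])%E);
  last by rewrite leeD2l.
rewrite -(probability_setT P).
have mgood : measurable [set w | (`|kappaQ hp theta0 thetas| / 2 * (K%:R * D) <=
     Num.sqrt D * `|Qhat phi D (fun t => X t w) N K|)%R].
  rewrite -[X in measurable X]setTI; apply: measurable_fun_ler => //.
  apply: measurable_funM => //; apply: measurableT_comp => //.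
  by apply: (measurable_Qhat phi D (X := X)).
apply: le_trans (measureU2 P mgood mbad); apply: le_measure; rewrite ?inE//.
  exact: measurableU.
move=> w _; have [pw|pw] := leP (eps ^+ 2) `|pe w|; first by right.
left => /=; apply: (level (h := signal D a_ f_) (U := noise B D a_ sigma ^~ w)
  (J := fun i => decay D a_ i * X_ 0%N w)
  (W := remainder B D a_ f_ sigma X_ ^~ w) (xi := bincr B D ^~ w) (f := f_)
  (e := euler_error B D a_ f_ sigma X_ ^~ w) D_gt0 N_gt0 K1_lt a0D).
- by move=> i l; exact: phi_grid.
- by move=> i; have := signal_le D_gt0 am_gt0 a_ge a_le aMD C_ge0 f_le i.
- by move=> i; rewrite /remainder /X_; ring.
- by move=> i; rewrite /euler_error /a_ /th /regime; case: ifP.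
- by apply: noise_energy => i iN; rewrite /a_ /th /regime ltn_addr.
- exact: close.
- exact: le_trans (ler_norm _) (ltW pw).
Qed.

End one_horizon.

(** * The limit of a long training horizon *)

Lemma mean_level_le (R : realType) (p : nat) (phi : R -> 'cV[R]_p)
    (theta : 'cV[R]_(p + 1)) (G : R) :
  (forall t l, 0 <= t -> `|phi t l 0| <= G) -> forall t, 0 <= t ->
  `|mean_level phi theta t| <= G * \sum_l `|mu_of theta l 0|.
Proof.
move=> phiG t t0; rewrite mean_levelE mulr_sumr.
apply: le_trans (ler_norm_sum _ _ _) _; apply: ler_sum => l _.
by rewrite normrM ler_wpM2r// phiG.
Qed.

(** x^2 <= 1 + |x|^q for q >= 2. *)
Lemma moment_absmean_sqr d (Omega : measurableType d) (R : realType)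
    (P : probability Omega R) (X : {RV P >-> R}) (q : R) : 2 <= q ->
  ('E_P[fun w => (`|X w| `^ q)%R] < +oo)%E ->
  exists m, absmean_le P (fun w => X w ^+ 2) m.
Proof.
move=> q2; rewrite unlock => Eq.
pose E := (\int[P]_w (`|X w| `^ q)%:E)%E.
have E0 : (0 <= E)%E by apply: integral_ge0 => w _; rewrite lee_fin powR_ge0.
have mf : measurable_fun setT (fun w => `|X w| `^ q).
  by apply: (measurableT_comp (measurable_powR _)); exact: measurableT_comp.
have h1 : absmean_le P (fun w => `|X w| `^ q) (fine E).
  split=> //; rewrite fineK ?ge0_fin_numE//.
  by under eq_integral => w _ do rewrite ger0_norm ?powR_ge0//.
have h2 := absmean_leD (absmean_le_cst P 1) h1.
eexists; apply: absmean_le_dom h2; first exact: measurable_funX.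
move=> w; rewrite /cst ger0_norm ?sqr_ge0// ger0_norm ?addr_ge0 ?powR_ge0//.
rewrite -(real_normK (num_real (X w))).
have [x1|x1] := leP `|X w| 1.
  have x2 : `|X w| ^+ 2 <= 1 by rewrite expr_le1.
  by have := powR_ge0 `|X w| q; lra.
rewrite -powR_mulrn//; apply: le_trans (ler_powR (ltW x1) q2) _.
by rewrite lerDr.
Qed.

Lemma mesh_sample_size (R : realType) (delta T : R) : (0 < sample_size delta T)%N ->
  (sample_size delta T)%:R * mesh delta T = T.
Proof. by move=> N0; rewrite /mesh mulrC divfK// pnatr_eq0 -lt0n. Qed.

Lemma sample_size_gt0 (R : realType) (delta T : R) : 0 <= delta -> 1 <= T ->
  (0 < sample_size delta T)%N.
Proof.
move=> d0 T1; rewrite /sample_size truncn_gt0.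
by have := ler_powR T1 d0; rewrite powRr0.
Qed.

(** T D = T^2 / N is at most 2 T^(2 - delta): this is where delta > 2 enters. *)
Lemma horizon_mesh_small (R : realType) (delta kap : R) : 2 < delta -> 0 < kap ->
  \forall T \near +oo, T * mesh delta T <= kap.
Proof.
move=> d2 k0; pose b := delta - 2; have b0 : 0 < b by rewrite subr_gt0.
pose A := 2 / kap; have A0 : 0 < A by rewrite divr_gt0.
near=> T; have T1 : 1 <= T by near: T; exact: nbhs_pinfty_ge.
have T0 : 0 < T by exact: lt_le_trans T1.
have TA : A `^ b^-1 <= T by near: T; exact: nbhs_pinfty_ge.
have ATb : A <= T `^ b.
  rewrite -[leLHS](powRr1 (ltW A0)) -(mulVf (lt0r_neq0 b0)) powRrM.
  by apply: ge0_ler_powR; rewrite ?nnegrE ?powR_ge0 ?ltW.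
have N0 : (0 < sample_size delta T)%N by apply: sample_size_gt0 => //; lra.
have NR : 0 < (sample_size delta T)%:R :> R by rewrite ltr0n.
have N1 : 1 <= (sample_size delta T)%:R :> R by rewrite ler1n.
have TN : T `^ delta <= 2 * (sample_size delta T)%:R.
  have := truncnS_gt (T `^ delta); rewrite -/(sample_size delta T) -natr1; lra.
have TE : T `^ delta = T ^+ 2 * T `^ b.
  rewrite -powR_mulrn ?(ltW T0)// -powRD; last by rewrite (gt_eqF T0) implybT.
  by rewrite /b addrC subrK.
rewrite /mesh mulrA -expr2 ler_pdivrMr//.
have : kap * (T ^+ 2 * A) <= kap * (2 * (sample_size delta T)%:R).
  rewrite ler_wpM2l ?(ltW k0)//; apply: le_trans TN; rewrite TE.
  by rewrite ler_wpM2l ?sqr_ge0.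
have -> : kap * (T ^+ 2 * A) = 2 * T ^+ 2 by rewrite /A; field; rewrite gt_eqF.
by lra.
Unshelve. all: by end_near. Qed.

Lemma probability_cvg1 d (Omega : measurableType d) (R : realType)
    (P : probability Omega R) (A : R -> set Omega) :
  (forall T, measurable (A T)) ->
  (forall eta : R, 0 < eta -> \forall T \near +oo, ((1 - eta)%:E <= P (A T))%E) ->
  P (A T) @[T --> +oo] --> 1%E.
Proof.
move=> mA H.
have fin T : P (A T) = (fine (P (A T)))%:E by rewrite fineK// fin_num_measure.
under eq_fun do rewrite fin.
apply: cvg_EFin; first by near=> T.
apply/cvgrPdist_le => eta eta0; near=> T.
have h1 : (P (A T) <= 1)%E by exact: probability_le1.
have h2 : ((1 - eta)%:E <= P (A T))%E by near: T; exact: H.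
move: h1 h2; rewrite fin !lee_fin => h1 h2.
by rewrite /= ger0_norm; lra.
Unshelve. all: by end_near. Qed.

(** As N <= K, the boundary is at most 2 K / sqrt N, so that a statistic of order
    K sqrt D exceeds it by a factor of order sqrt (N D), the root of the
    horizon. *)
Lemma statistic_ratio (R : realType) (gamma D kap Q M : R) (N K : nat) :
  0 <= gamma -> 0 < D -> (0 < N)%N -> (N <= K)%N -> 0 <= kap ->
  kap / 2 * (K%:R * D) <= Num.sqrt D * Q ->
  M < kap / 4 * Num.sqrt (N%:R * D) -> M < Q / g1 gamma N K.
Proof.
move=> gam0 D0 N0 NK kap0 hQ; have K0 := leq_trans N0 NK.
move=> /lt_le_trans; apply.
have NR : 0 < N%:R :> R by rewrite ltr0n.
have KR : 0 < K%:R :> R by rewrite ltr0n.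
have sN : 0 < Num.sqrt N%:R :> R by rewrite sqrtr_gt0.
have sD : 0 < Num.sqrt D by rewrite sqrtr_gt0.
rewrite ler_pdivlMr ?g1_gt0//.
apply: (@le_trans _ _ (kap / 4 * Num.sqrt (N%:R * D) * ((N%:R + K%:R) / Num.sqrt N%:R))).
  by rewrite ler_wpM2l ?g1_le// mulr_ge0 ?sqrtr_ge0// divr_ge0.
rewrite sqrtrM ?(ltW NR)//.
have -> : kap / 4 * (Num.sqrt N%:R * Num.sqrt D) * ((N%:R + K%:R) / Num.sqrt N%:R) =
  kap / 4 * (N%:R + K%:R) * Num.sqrt D by field; rewrite gt_eqF.
have hQ' : kap / 2 * K%:R * Num.sqrt D <= Q.
  rewrite -(ler_pM2l sD); apply: le_trans hQ; rewrite le_eqVlt; apply/orP; left.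
  by apply/eqP; rewrite -[in RHS](sqr_sqrtr (ltW D0)); ring.
apply: le_trans hQ'; rewrite ler_wpM2r ?(ltW sD)//.
have : N%:R <= K%:R :> R by rewrite ler_nat.
by nra.
Qed.

Lemma kappa_horizon_large (R : realType) (kap M : R) : 0 < kap ->
  \forall T \near +oo, M < kap * Num.sqrt T.
Proof.
move=> k0; near=> T.
have hM : (`|M| / kap + 1) ^+ 2 <= T by near: T; apply: nbhs_pinfty_ge; exact: num_real.
have q0 : 0 <= `|M| / kap by rewrite divr_ge0// ltW.
have : `|M| / kap + 1 <= Num.sqrt T.
  by rewrite -(ger0_norm (addr_ge0 q0 ler01)) -sqrtr_sqr ler_wsqrtr.
rewrite -(ler_pM2l k0) mulrDr mulr1 mulrC divfK ?gt_eqF//.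
by have := ler_norm M; lra.
Unshelve. all: by end_near. Qed.

Theorem theorem4p2 (R : realType) (d : measure_display)
  (Omega : measurableType d) (P : probability Omega R)
  (Pcomplete : measure_is_complete P)
  (B : R -> {RV P >-> R}) (B_BM : brownian_motion B)
  (p : nat) (hp : (0 < p)%N) (phi : R -> 'cV[R]_p)
  (sigma : R) (sigma_gt0 : 0 < sigma)
  (X0 : {RV P >-> R}) (X0_indep : independent_of_process X0 B)
  (X0_moment : exists2 q : R, 2 <= q & ('E_P[fun w => (`|X0 w| `^ q)%R] < +oo)%E)
  (O : set 'cV[R]_(p + 1)) (O_pos : O `<=` [set theta | 0 < a_of theta])
  (theta0 thetas : 'cV[R]_(p + 1)) (theta0_O : O theta0) (thetas_O : O thetas)
  (phi_int : forall T : R, 0 < T -> forall j : 'I_p,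
     riemann_integrable (fun t => phi t j 0) 0 T)
  (phi1 : forall t : R, 0 <= t -> phi t (Ordinal hp) 0 = 1)
  (phi_per : forall t : R, 0 <= t -> phi (t + 1) = phi t)
  (phi_orth : forall j k : 'I_p,
     is_riemann_integral (fun t => (phi t *m (phi t)^T) j k) 0 1
       ((1%:M : 'M[R]_p) j k))
  (gamma delta : R) (gamma_ge0 : 0 <= gamma) (gamma_lt : gamma < 1 / 2)
  (delta_gt2 : 2 < delta) (delta_lt : gamma = 0 \/ delta < 1 / gamma)
  (mesh_cvg0 : mesh delta T @[T --> +oo] --> (0 : R))
  (phi_mod : exists C : R, \forall T \near +oo,
     `|modulus phi (mesh delta T)| <= C * Num.sqrt (mesh delta T))
  (Kstar : nat -> nat) (tstar : R) (tstar_ge0 : 0 <= tstar)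
  (Kstar_cvg :
     (Kstar (sample_size delta T))%:R / (sample_size delta T)%:R
       @[T --> +oo] --> tstar)
  (kappa_neq0 : kappaQ hp theta0 thetas != 0)
  (theta_neq : thetas <> theta0)
  (* X T is the process under the alternative when the training horizon is T *)
  (X : R -> R -> {RV P >-> R})
  (X_H1 : forall T : R, 1 <= T ->
     let N := sample_size delta T in
     let tchange := grid (mesh delta T) (N + Kstar N) in
     {ae P, forall w,
        [/\ X T 0 w = X0 w,
            {within `[0, +oo[, continuous (fun t : R => X T t w)},
            solves_sde phi sigma theta0 `[0, tchange]
              (fun t => X T t w) (fun t => B t w)
          & solves_sde phi sigma thetas `[tchange, +oo[
              (fun t => X T t w) (fun t => B t w)]})
  (c : R) (c_gt0 : 0 < c) :
  (forall M : R,
     P [set w | (M%:E < supQ phi (mesh delta T) (fun t => X T t w) gamma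
                          (sample_size delta T))%E] @[T --> +oo] --> 1%E) /\
  P [set w | (tauQ phi (mesh delta T) (fun t => X T t w) c sigma gamma
                (sample_size delta T) < +oo)%E] @[T --> +oo] --> 1%E.
Proof.
have delta0 : 0 <= delta by clear -delta_gt2; lra.
have a0 : 0 < a_of theta0 by have := O_pos theta0 theta0_O.
have as0 : 0 < a_of thetas by have := O_pos thetas thetas_O.
have [G G0 phiG] := regressor_bounded phi1 phi_per phi_orth.
pose C := G * (\sum_l `|mu_of theta0 l 0| + \sum_l `|mu_of thetas l 0|).
have sum0 (th : 'cV[R]_(p + 1)) : 0 <= \sum_l `|mu_of th l 0| by exact: sumr_ge0.
have C0 : 0 <= C by rewrite mulr_ge0// addr_ge0.
have level0 u : 0 <= u -> `|mean_level phi theta0 u| <= C.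
  move=> u0; apply: le_trans (mean_level_le theta0 phiG u0) _.
  by rewrite ler_wpM2l// lerDl.
have levels u : 0 <= u -> `|mean_level phi thetas u| <= C.
  move=> u0; apply: le_trans (mean_level_le thetas phiG u0) _.
  by rewrite ler_wpM2l// lerDr.
pose am := Num.min (a_of theta0) (a_of thetas).
pose aM := Num.max (a_of theta0) (a_of thetas).
have am0 : 0 < am by rewrite lt_min a0.
have aM0 : 0 < aM by rewrite lt_max a0.
have H0 : 0 <= C / am by rewrite divr_ge0// ltW.
have [eps [eps0 _ level]] := detection_threshold sigma_gt0 G0 H0 a0 as0 kappa_neq0.
have [q q2 Eq] := X0_moment; have [m0 X0m] := moment_absmean_sqr q2 Eq.
pose pc := path_error_const sigma am aM C m0 p G.
(* the window has N observations for each one that precedes the change, and at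
   least N in all *)
pose N T := sample_size delta T; pose K T := (N T * (Kstar (N T)).+1)%N.
have kap0 : 0 < `|kappaQ hp theta0 thetas| by rewrite normr_gt0.
have prob eta : 0 < eta -> \forall T \near +oo, ((1 - eta)%:E <=
    P [set w | (`|kappaQ hp theta0 thetas| / 2 * ((K T)%:R * mesh delta T) <=
      Num.sqrt (mesh delta T) * `|Qhat phi (mesh delta T) (fun t => X T t w) (N T) (K T)|)%R])%E.
  (* the three terms, at most e each, of the bound on the mean path error give a
     probability at most eta after division by eps^2 *)
  move=> eta0; pose e := Num.min eps (eps ^+ 2 * eta / (3 * (`|pc| + 1))).
  have pc1 : 0 < `|pc| + 1 by rewrite ltr_wpDl.
  have e0 : 0 < e by rewrite lt_min eps0 divr_gt0 ?mulr_gt0// exprn_gt0.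
  have [h h0 [T0 averages]] := regressor_averages theta0 thetas phi1 phi_per phi_orth e0.
  (* the bounds on T D that make the rate, the averages and the Euler scheme
     good *)
  pose k := Num.min (e ^+ 2) (Num.min h (Num.min 1
      (Num.min (1 / (2 * aM)) (am / (8 * aM ^+ 2))))).
  have k0 : 0 < k.
    have k1 : 0 < 1 / (2 * aM) by rewrite divr_gt0// mulr_gt0.
    have k2 : 0 < am / (8 * aM ^+ 2) by rewrite divr_gt0// mulr_gt0// exprn_gt0.
    by rewrite !lt_min exprn_gt0// h0 ltr01 k1 k2.
  have k2 : 0 < k / 2 by rewrite divr_gt0.
  near=> T; have T1 : 1 <= T by near: T; exact: nbhs_pinfty_ge.
  have T_gt0 : 0 < T by exact: lt_le_trans T1.
  have Te : e^-1 <= T by near: T; apply: nbhs_pinfty_ge; exact: num_real.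
  have TT0 : T0 <= T by near: T; apply: nbhs_pinfty_ge; exact: num_real.
  have small : T * mesh delta T < k.
    have : T * mesh delta T <= k / 2 by near: T; exact: horizon_mesh_small.
    by move=> /le_lt_trans; apply; rewrite ltr_pdivrMr// ltr_pMr// ltr1n.
  have NT0 : (0 < N T)%N by exact: (sample_size_gt0 delta0 T1).
  have D0 : 0 < mesh delta T by rewrite divr_gt0// ltr0n.
  have ND : (N T)%:R * mesh delta T = T by exact: mesh_sample_size.
  move: small; rewrite !lt_min => /and5P[TDe TDh TD1 TDa TDb].
  have DT : mesh delta T <= T * mesh delta T by rewrite ler_peMl// ltW.
  have Dh := le_lt_trans DT TDh; have D1 := le_lt_trans DT TD1.
  have Da := le_lt_trans DT TDa; have Db := le_lt_trans DT TDb.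
  have aMD : aM * mesh delta T <= 1 / 2.
    by move: Da; rewrite ltr_pdivlMr ?mulr_gt0//; clear; lra.
  have D_small : 64 * aM ^+ 4 * mesh delta T ^+ 2 <= am ^+ 2.
    have : (8 * aM ^+ 2 * mesh delta T) ^+ 2 <= am ^+ 2.
      have aM2 : 0 < 8 * aM ^+ 2 by rewrite mulr_gt0// exprn_gt0.
      have le8 : 8 * aM ^+ 2 * mesh delta T <= am.
        by move: Db; rewrite ltr_pdivlMr// mulrC => /ltW.
      have nn : 0 <= 8 * aM ^+ 2 * mesh delta T by rewrite mulr_ge0 ?(ltW aM2) ?(ltW D0).
      by rewrite lerXn2r ?nnegrE ?(ltW am0).
    by apply: le_trans; rewrite le_eqVlt; apply/orP; left; apply/eqP; ring.
  have NK : (N T <= K T)%N by rewrite leq_pmulr.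
  have K1K : (Kstar (N T) * N T <= K T)%N by rewrite mulnC leq_mul2l leqnSn orbT.
  have K1_lt : (Kstar (N T) < K T)%N by rewrite /K leq_pmull.
  have X00 : absmean_le P (fun w => X T 0 w ^+ 2) m0.
    apply: absmean_le_ae X0m; first exact: measurable_funX.
    by apply: filterS (X_H1 T T1) => w [-> _ _ _].
  have sde : {ae P, forall w,
      [/\ {within `[0, +oo[, continuous (fun t : R => X T t w)},
        solves_sde phi sigma theta0 `[0, grid (mesh delta T) (N T + Kstar (N T))]
          (fun t => X T t w) (fun t => B t w)
      & solves_sde phi sigma thetas `[grid (mesh delta T) (N T + Kstar (N T)), +oo[
          (fun t => X T t w) (fun t => B t w)]}.
    by apply: filterS (X_H1 T T1) => w [].
  have avgs F0 Fs := averages (mesh delta T) (N T) (K T) (Kstar (N T)) F0 Fs D0 Dh NT0.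
  have TT0' : T0 <= (N T)%:R * mesh delta T by rewrite ND.
  have e_eps : e <= eps by rewrite ge_min lexx.
  have ND1 : 1 <= (N T)%:R * mesh delta T by rewrite ND.
  have := detection_probability B_BM D0 (ltW D1) (ltW sigma_gt0) C0 a0 as0 level0 levels
    G0 phiG aMD D_small NT0 ND1 NK K1K X00 sde eps0 e_eps K1_lt level
    (fun F0 Fs => avgs F0 Fs TT0' NK K1K).
  apply: le_trans; rewrite lee_fin lerD2l lerN2 -/am -/aM -/pc.
  have rate : mesh_rate (mesh delta T) (N T) <= 2 * e.
    rewrite /mesh_rate ND.
    have : T^-1 <= e by rewrite invf_ple ?posrE.
    have : Num.sqrt (T * mesh delta T) <= e.
      by rewrite -(ger0_norm (ltW e0)) -sqrtr_sqr ler_wsqrtr// ltW.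
    by clear; lra.
  have rate0 : 0 <= mesh_rate (mesh delta T) (N T).
    by rewrite /mesh_rate addr_ge0 ?sqrtr_ge0// invr_ge0 ND ltW.
  rewrite ler_pdivrMr ?exprn_gt0//.
  have e3 : 3 * (`|pc| + 1) * e <= eps ^+ 2 * eta.
    have : e <= eps ^+ 2 * eta / (3 * (`|pc| + 1)) by rewrite ge_min lexx orbT.
    by rewrite ler_pdivlMr ?mulr_gt0// mulrC.
  apply: le_trans (_ : (`|pc| + 1) * (3 * e) <= _).
    apply: (@le_trans _ _ ((`|pc| + 1) * (mesh_rate (mesh delta T) (N T) + e))).
      apply: ler_wpM2r; first by rewrite addr_ge0// ltW.
      by rewrite (le_trans (ler_norm pc))// lerDl.
    by rewrite ler_wpM2l ?(ltW pc1)//; clear -rate; lra.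
  by rewrite mulrCA mulrA (mulrC eta).
have supM M eta : 0 < eta -> \forall T \near +oo, ((1 - eta)%:E <=
    P [set w | (M%:E < supQ phi (mesh delta T) (fun t => X T t w) gamma
                         (sample_size delta T))%E])%E.
  move=> eta0; near=> T; have T1 : 1 <= T by near: T; exact: nbhs_pinfty_ge.
  have T_gt0 : 0 < T by exact: lt_le_trans T1.
  have NT0 : (0 < N T)%N by exact: (sample_size_gt0 delta0 T1).
  have D0 : 0 < mesh delta T by rewrite divr_gt0// ltr0n.
  have ND : (N T)%:R * mesh delta T = T by exact: mesh_sample_size.
  have : ((1 - eta)%:E <=
    P [set w | (`|kappaQ hp theta0 thetas| / 2 * ((K T)%:R * mesh delta T) <=
      Num.sqrt (mesh delta T) * `|Qhat phi (mesh delta T) (fun t => X T t w) (N T) (K T)|)%R])%E.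
    by near: T; exact: prob.
  move=> /le_trans; apply; apply: le_measure; rewrite ?inE.
  - rewrite -[X in measurable X]setTI; apply: measurable_fun_ler => //.
    apply: measurable_funM => //; apply: measurableT_comp => //.
    by apply: (measurable_Qhat phi (mesh delta T) (X := X T)).
  - exact: measurable_supQ_gt.
  move=> w /= hw; apply/supQ_gtP; exists (K T); first by rewrite muln_gt0 NT0.
  apply: statistic_ratio hw _ => //; first by rewrite leq_pmulr.
  rewrite ND; near: T; apply: kappa_horizon_large; rewrite divr_gt0//.
split=> [M|].
  by apply: probability_cvg1 => [T|eta eta0]; [exact: measurable_supQ_gt|exact: supM].
apply: probability_cvg1 => [T|eta eta0]; first exact: measurable_tauQ_lty.
near=> T; have T1 : 1 <= T by near: T; exact: nbhs_pinfty_ge.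
have : ((1 - eta)%:E <=
    P [set w | ((c * sigma)%:E < supQ phi (mesh delta T) (fun t => X T t w) gamma
                         (sample_size delta T))%E])%E.
  by near: T; exact: supM.
move=> /le_trans; apply; apply: le_measure; rewrite ?inE.
- exact: measurable_supQ_gt.
- exact: measurable_tauQ_lty.
- move=> w; apply: supQ_gt_tauQ_lty; exact: (sample_size_gt0 delta0 T1).
Unshelve. all: by end_near. Qed.
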